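(* The space of $H$-invariant eigendistributions on $\mathfrak q$ for the character $\chi$ that are defined by an analytic function on $\mathfrak q$ is spanned by $F_{ana}$.
   Context: $H=\{\mathrm{diag}(A,B):A,B\in GL(2,\mathbb R)\}$ (block diagonal) acts by conjugation on $\mathfrak q=\{X=\begin{pmatrix}0&U\\ V&0\end{pmatrix}:U,V\in M_2(\mathbb R)\}$. Put $Q(X)=\frac12\mathrm{tr}(X^2)$, $S(X)=\det X$, $S_0=Q^2-4S$; $\delta=\sqrt{S_0}$ if $S_0\ge0$, $\delta=i\sqrt{|S_0|}$ if $S_0<0$; $u=\frac{Q+\delta}2$, $v=\frac{Q-\delta}2$. One has $\mathbb C[\mathfrak q]^H=\mathbb C[Q,S]$. Fix $\lambda_1,\lambda_2\in\mathbb C$ with $\lambda_1\lambda_2(\lambda_1-\lambda_2)\ne0$ and let $\chi$ be the character of $\mathbb C[Q,S]$ with $\chi(Q)=\lambda_1+\lambda_2$, $\chi(S)=\lambda_1\lambda_2$. For $P\in\mathbb C[\mathfrak q]$, $\partial(P)$ is the constant coefficient differential operator on $\mathfrak q$ corresponding to $P$ under $\mathfrak q\simeq\mathfrak q^*$ via $\omega(X,X')=\frac12\mathrm{tr}(XX')$ (the linear form $\omega(A,\cdot)$ is sent to the derivative in direction $A$). An invariant eigendistribution for $\chi$ is an $H$-invariant distribution $T$ with $\partial(P)T=\chi(P)T$ for all $P\in\mathbb C[\mathfrak q]^H$; a locally integrable $F$ defines $f\mapsto\int_{\mathfrak q}F(X)f(X)\,dX$. With $\Phi_\lambda(z)=\sum_{n\ge0}\frac{(\lambda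 z)^n}{4^n(n!)^2}$, $$F_{ana}=\frac{\Phi_{\lambda_1}(u)\Phi_{\lambda_2}(v)-\Phi_{\lambda_1}(v)\Phi_{\lambda_2}(u)}{u-v},$$ extended analytically to all of $\mathfrak q$ (it is an entire function of $Q$ and $S_0$). *)

(* Defs.v *)
From HB Require Import structures.
From mathcomp Require Import all_boot all_order all_algebra.
From mathcomp Require Import -(notations) mpoly.
From mathcomp Require Import complex.
From mathcomp Require Import all_classical all_reals all_analysis.
Set Implicit Arguments.
Unset Strict Implicit.
Unset Printing Implicit Defensive.
Import Order.TTheory GRing.Theory Num.Theory.
Import numFieldNormedType.Exports.
Local Open Scope classical_set_scope.
Local Open Scope ring_scope.
Local Open Scope complex_scope.

(* The pair (U, V) stands for the block matrix (0 U; V 0), see qmx. Other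
   coefficient rings than the reals are used for the generic point of q. *)
Notation qspace A := ('M[A]_2 * 'M[A]_2)%type.

(* The dimension of q, written so that the coordinates (the entries of U and
   then those of V, in row-major order) are a row_mx of two mxvec. *)
Notation dimq := (2 * 2 + 2 * 2)%N.

(* C[q], the variables being the coordinates of q. *)
Notation Cpolyq R := (mpoly dimq R[i]).

Definition qmx (A : pzRingType) (X : qspace A) : 'M[A]_(2 + 2) :=
  block_mx 0 X.1 X.2 0.

Definition qcoord (A : Type) (X : qspace A) : 'rV[A]_dimq :=
  row_mx (mxvec X.1) (mxvec X.2).

Definition qpoint (A : Type) (r : 'rV[A]_dimq) : qspace A :=
  (vec_mx (lsubmx r), vec_mx (rsubmx r)).

Definition qbasis (A : pzRingType) (k : 'I_dimq) : qspace A :=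
  qpoint (delta_mx 0 k).

Section Geometry.
Variable R : realType.
Implicit Types (X Y : qspace R) (A B : 'M[R]_2).

(* The action of diag(A, B) in terms of (U, V), see qmx_act. *)
Definition act A B X : qspace R :=
  (A *m X.1 *m invmx B, B *m X.2 *m invmx A).

Definition omega X Y : R := 2^-1 * \tr (qmx X *m qmx Y).

(* The vector A_k with omega (A_k, .) = k-th coordinate, see omega_qdual. *)
Definition qdual (k : 'I_dimq) : qspace R :=
  (2 *: (qbasis R k).2^T, 2 *: (qbasis R k).1^T).

Definition Qfun X : R := 2^-1 * \tr (qmx X *m qmx X).
Definition Sfun X : R := \det (qmx X).
Definition S0fun X : R := Qfun X ^+ 2 - 4 * Sfun X.

Definition deltafun X : R[i] :=
  if 0 <= S0fun X then (Num.sqrt (S0fun X))%:C else 0 +i* Num.sqrt `|S0fun X|.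
Definition ufun X : R[i] := ((Qfun X)%:C + deltafun X) / 2.
Definition vfun X : R[i] := ((Qfun X)%:C - deltafun X) / 2.

Lemma qmx_act A B X : A \in unitmx -> B \in unitmx ->
  qmx (act A B X) =
  block_mx A 0 0 B *m qmx X *m invmx (block_mx A 0 0 B).
Proof.
move=> uA uB; have uAB : block_mx A 0 0 B \in unitmx.
  by rewrite unitmxE det_ublock unitrM -!unitmxE uA uB.
apply: (canRL (mulmxK uAB)); rewrite /qmx /act /= !mulmx_block.
by rewrite !mul0mx !mulmx0 !addr0 !add0r !mulmxKV.
Qed.

Lemma omega_qdual (k : 'I_dimq) X : omega (qdual k) X = qcoord X 0 k.
Proof.
have trE (M N : 'M[R]_2) : \tr (M^T *m N) = \sum_l mxvec M 0 l * mxvec N 0 l.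
  rewrite (reindex _ (curry_mxvec_bij 2 2)) /=.
  rewrite (eq_bigr (fun ij => M ij.1 ij.2 * N ij.1 ij.2)); last first.
    by move=> [i j] _; rewrite /= !mxvecE.
  rewrite -(pair_bigA _ (fun i j => M i j * N i j)) exchange_big.
  apply: eq_bigr => j _; rewrite mxE; apply: eq_bigr => i _.
  by rewrite mxE.
rewrite /omega /qmx /qdual /qbasis /qpoint /qcoord /= mulmx_block.
rewrite !mul0mx !mulmx0 !addr0 !add0r mxtrace_block -!scalemxAl !mxtraceZ.
rewrite -mulrDr mulrA mulVf ?pnatr_eq0 // mul1r !trE !vec_mxK.
case: (split_ordP k) => j ->.
  rewrite row_mxEl [X in X + _]big1 ?add0r => [|l _]; last first.
    by rewrite !mxE /= eq_rlshift mul0r.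
  rewrite (bigD1 j) //= big1 ?addr0 => [|l jl]; last first.
    by rewrite !mxE /= eq_lshift (negbTE jl) mul0r.
  by rewrite !mxE /= !eqxx mul1r.
rewrite row_mxEr [X in _ + X]big1 ?addr0 => [|l _]; last first.
  by rewrite !mxE /= eq_lrshift mul0r.
rewrite (bigD1 j) //= big1 ?addr0 => [|l jl]; last first.
  by rewrite !mxE /= eq_rshift (negbTE jl) mul0r.
by rewrite !mxE /= !eqxx mul1r.
Qed.

End Geometry.

Section Polynomials.
Variable R : realType.

Definition evalq (P : Cpolyq R) (X : qspace R) : R[i] :=
  meval (fun k => (qcoord X 0 k)%:C) P.

Definition invariant_poly (P : Cpolyq R) : Prop :=
  forall A B : 'M[R]_2, A \in unitmx -> B \in unitmx ->
  forall X, evalq P (act A B X) = evalq P X.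

Definition generic_point : qspace (Cpolyq R) :=
  qpoint (\row_k (mpolyX R[i] (mnm1 k))).

Definition Qpoly : Cpolyq R :=
  (2^-1 : R[i]) *: \tr (qmx generic_point *m qmx generic_point).
Definition Spoly : Cpolyq R := \det (qmx generic_point).

Lemma map_qmx_generic X :
  map_mx (meval (fun k => (qcoord X 0 k)%:C)) (qmx generic_point) =
  map_mx (fun x : R => x%:C) (qmx X).
Proof.
rewrite /qmx !map_block_mx !map_mx0; congr block_mx.
  apply/matrixP => i j; rewrite !mxE mevalXU /qcoord.
  by rewrite row_mxEl mxvecE.
apply/matrixP => i j; rewrite !mxE mevalXU /qcoord.
by rewrite row_mxEr mxvecE.
Qed.

Lemma evalq_Qpoly X : evalq Qpoly X = (Qfun X)%:C.
Proof.
rewrite /evalq /Qpoly mevalZ -trace_map_mx map_mxM !map_qmx_generic.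
by rewrite -map_mxM trace_map_mx /Qfun rmorphM fmorphV /= rmorph_nat.
Qed.

Lemma evalq_Spoly X : evalq Spoly X = (Sfun X)%:C.
Proof. by rewrite /evalq /Spoly -det_map_mx map_qmx_generic det_map_mx. Qed.

(* A character of the algebra C[q]^H, given as a function on C[q] whose
   values outside C[q]^H are irrelevant. *)
Definition is_character (chi : Cpolyq R -> R[i]) : Prop :=
  [/\ chi 1 = 1,
      forall P P', invariant_poly P -> invariant_poly P' ->
        chi (P + P') = chi P + chi P',
      forall P P', invariant_poly P -> invariant_poly P' ->
        chi (P * P') = chi P * chi P' &
      forall (c : R[i]) P, invariant_poly P -> chi (c *: P) = c * chi P].

End Polynomials.

(* The library does not infer that m \x m is sigma-finite; this alias of
   m \x m carries that instance. *)
Section MeasureSquare.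
Local Open Scope ereal_scope.
Context d (T : measurableType d) (R : realType).
Variable m : {sigma_finite_measure set T -> \bar R}.

Definition measure_square : set (T * T) -> \bar R := m \x m.

HB.instance Definition _ := Measure.on measure_square.

Lemma measure_square_sigma_finite : sigma_finite setT measure_square.
Proof.
have /sigma_finiteP[F [TF ndF Foo]] := sigma_finiteT m.
exists (fun n => F n `*` F n).
  rewrite -setXTT {1 2}TF predeqE => -[x y]; split.
    move=> [/= [n _ Fnx] [k _ Fky]]; exists (maxn n k) => //; split.
    - by move: x Fnx; exact/subsetPset/ndF/leq_maxl.
    - by move: y Fky; exact/subsetPset/ndF/leq_maxr.
  by move=> [n _ []/= ? ?]; split; exists n.
move=> k; have [? ?] := Foo k; split; first exact: measurableX.
by rewrite /measure_square product_measure1E// lte_mul_pinfty// ge0_fin_numE.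
Qed.

HB.instance Definition _ :=
  Measure_isSigmaFinite.Build _ _ _ measure_square measure_square_sigma_finite.

End MeasureSquare.

Section Analysis.
Variable R : realType.
Implicit Types (f g F : qspace R -> R[i]) (X Y : qspace R).

(* Derivatives, integrals, smoothness and analyticity of complex-valued
   functions are taken on real and imaginary parts. *)
Definition rpart f : qspace R -> R^o := fun X => complex.Re (f X).
Definition ipart f : qspace R -> R^o := fun X => complex.Im (f X).

Definition dderiv (w : qspace R) f : qspace R -> R[i] :=
  fun X => ('D_w (rpart f) X) +i* ('D_w (ipart f) X).

Definition derivs (s : seq (qspace R)) f : qspace R -> R[i] :=
  foldr dderiv f s.

Definition smooth f : Prop := forall s X,
  differentiable (rpart (derivs s f)) X /\
  differentiable (ipart (derivs s f)) X.

Definition support f : set (qspace R) := closure [set X | f X != 0].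

Definition test_function f : Prop := smooth f /\ compact (support f).

(* A family of coefficients a indexed by the monomials represents h on a
   neighbourhood of X0, the power series being absolutely convergent there. *)
Definition real_analytic_at (h : qspace R -> R) X0 : Prop :=
  exists (r : R) (a : multinom dimq -> R), 0 < r /\
  forall X, (forall k, `|qcoord (X - X0) 0 k| < r) ->
    let t (m : multinom dimq) := a m * mmap1 (qcoord (X - X0) 0) m in
    (exists M, forall N, \sum_(m : bmultinom dimq N) `|t (bmnm m)| <= M) /\
    (fun N => \sum_(m : bmultinom dimq N) t (bmnm m) : R) @ \oo --> h X.

Definition analytic F : Prop :=
  forall X, real_analytic_at (rpart F) X /\ real_analytic_at (ipart F) X.

(* A distribution is a function on all of qspace R -> R[i] of which only the
   values on test functions matter. *)
Definition functional := (qspace R -> R[i]) -> R[i].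
Implicit Types (T : functional).

(* Continuity on the test functions with support in a given compact K, for
   the seminorms max_(size s <= N) sup |derivs s f|. *)
Definition is_distribution T : Prop :=
  (forall (c : R[i]) f g, test_function f -> test_function g ->
     T (fun X => c * f X + g X) = c * T f + T g) /\
  (forall K : set (qspace R), compact K ->
     exists (N : nat) (C : R), forall f, test_function f -> support f `<=` K ->
     forall M : R,
       (forall (s : seq 'I_dimq) X, (size s <= N)%N ->
          Num.norm (derivs (map (@qbasis R) s) f X) <= M%:C) ->
       Num.norm (T f) <= (C * M)%:C).

Definition H_invariant T : Prop :=
  forall A B : 'M[R]_2, A \in unitmx -> B \in unitmx ->
  forall f, test_function f -> T (fun X => f (act A B X)) = T f.

Definition mono_dirs (m : multinom dimq) : seq (qspace R) :=
  flatten [seq nseq (m k) (@qdual R k) | k <- enum 'I_dimq].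

(* The formal transpose of the operator attached to P: x_k is sent to the
   derivative in direction qdual k, whose transpose is its opposite. *)
Definition partialT (P : Cpolyq R) f : qspace R -> R[i] :=
  fun X => \sum_(m <- msupp P)
    (-1) ^+ mdeg m * mcoeff m P * derivs (mono_dirs m) f X.

(* The operator attached to P, on distributions. *)
Definition partialD (P : Cpolyq R) T : functional :=
  fun f => T (partialT P f).

Definition is_invariant_eigendistribution (chi : Cpolyq R -> R[i]) T : Prop :=
  [/\ is_distribution T, H_invariant T &
      forall P, invariant_poly P ->
      forall f, test_function f -> partialD P T f = chi P * T f].

(* The Lebesgue measure of R^8, with R^8 as ((R^2)^2)^2. *)
Definition lebesgue8 :=
  measure_square (measure_square (measure_square (@lebesgue_measure R))).

Definition mx2 (p : (R * R) * (R * R)) : 'M[R]_2 :=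
  block_mx p.1.1%:M p.1.2%:M p.2.1%:M p.2.2%:M : 'M[R]_(1 + 1).

Definition integralq f : R[i] :=
  (\int[lebesgue8]_t rpart f (mx2 t.1, mx2 t.2))%R +i*
  (\int[lebesgue8]_t ipart f (mx2 t.1, mx2 t.2))%R.

Definition distribution_of F : functional :=
  fun f => integralq (fun X => F X * f X).

Definition defined_by F T : Prop :=
  forall f, test_function f -> T f = distribution_of F f.

End Analysis.

Section Fana.
Variable R : realType.

Definition Phi_partial (lambda z : R[i]) (N : nat) : R[i] :=
  \sum_(n < N) (lambda * z) ^+ n / (4 ^+ n * (n`!)%:R ^+ 2).

Definition Phi (lambda z : R[i]) : R[i] :=
  limn (fun N => complex.Re (Phi_partial lambda z N) : R^o) +i*
  limn (fun N => complex.Im (Phi_partial lambda z N) : R^o).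

Definition Fana_quotient (lambda1 lambda2 : R[i]) (X : qspace R) : R[i] :=
  (Phi lambda1 (ufun X) * Phi lambda2 (vfun X) -
   Phi lambda1 (vfun X) * Phi lambda2 (ufun X)) / (ufun X - vfun X).

(* u - v = delta, so the quotient is meaningful exactly where S0 != 0; this
   set is dense, so there is at most one such F. *)
Definition is_Fana (lambda1 lambda2 : R[i]) (F : qspace R -> R[i]) : Prop :=
  analytic F /\
  forall X, S0fun X != 0 -> F X = Fana_quotient lambda1 lambda2 X.

End Fana.

(* Main.v *)
From HB Require Import structures.
Require Import Defs.
From mathcomp Require Import all_boot all_order all_algebra.
From mathcomp Require Import -(notations) mpoly.
From mathcomp Require Import complex.
From mathcomp Require Import all_classical all_reals all_analysis.
From mathcomp Require Import measurable_realfun ring lra.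
Set Implicit Arguments.
Unset Strict Implicit.
Unset Printing Implicit Defensive.
Import Order.TTheory GRing.Theory Num.Theory.
Import numFieldNormedType.Exports.
Local Open Scope classical_set_scope.
Local Open Scope ring_scope.
Local Open Scope complex_scope.

(* The radial parts of the operators attached to Q and S send the polynomials
   (u^m v^n - u^n v^m) / (u - v) to combinations of polynomials of the same
   kind; hence the degree d components p_d of Fana satisfy
   Q(D) p_(d+1) = (lambda1 + lambda2) p_d, S(D) p_(d+2) = lambda1 lambda2 p_d.
   As the invariant polynomials are the polynomials in Q and S, integration by
   parts of each p_d against a test function and summation over d show that
   Fana defines an eigendistribution.
   Conversely, let F be an analytic solution, and subtract a multiple of Fana so
   that the difference G vanishes at 0 (Fana(0) = (lambda1 - lambda2) / 4). The
   homogeneous components G_d of G at 0 are H-invariant, and so is the conjugate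
   P of G_d under the Cartan involution (U, V) -> (V^T, U^T). The equation
   P(D) G = chi(P) G at 0 says that the Fischer norm of G_d is
   chi(P) G(0) = 0, so G_d = 0 for all d, and G = 0 by analyticity. *)

(** * Complex sequences *)

(** On the polynomials [schur2] the two operators only lower m and n, with factors 4 m^2 and 4 n^2;
    the coefficients 1 / (4^n n!^2) of Phi are exactly what absorbs these factors. The H-invariance
    of the integral is obtained without Jacobians. Since H acts on V contragrediently to its action
    on U, its action can be factored into shears (U + F V, V) and (U, V + F U), which preserve
    Lebesgue measure by Fubini and translation invariance. In the converse, G satisfies its
    equations only weakly, so evaluation at 0 means testing against bumps that shrink to 0, with
    estimates uniform in the length of the partial sums of the series of G. The form [omega] pairs U
    with V and is indefinite. The Cartan involution and the conjugation of coefficients repair this,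
    and invariance survives because H is stable under transposition. Components of different degrees
    do not pair at 0, so testing with the conjugate of G_d isolates G_d. Vanishing near 0 is then
    propagated along rays, because analyticity is only a local statement at each point. *)

Section ComplexSeq.
Variable R : realType.
Implicit Types (z : R[i]) (u v : nat -> R[i]).

Local Notation nc := (@ComplexField.Normc.normc R).

Lemma normr_normc z : `|z| = (nc z)%:C. Proof. by []. Qed.

Lemma normc_ge0 z : 0 <= nc z.
Proof. by have := normr_ge0 z; rewrite normr_normc lecR. Qed.
Lemma normcD z z' : nc (z + z') <= nc z + nc z'.
Proof. by have := ler_normD z z'; rewrite !normr_normc -rmorphD lecR. Qed.
Lemma normcN z : nc (- z) = nc z.
Proof. by have := normrN z; rewrite !normr_normc => -[]. Qed.
Lemma normcM z z' : nc (z * z') = nc z * nc z'.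
Proof. exact: ComplexField.Normc.normcM. Qed.
Lemma normc0 : nc 0 = 0. Proof. exact: ComplexField.Normc.normc0. Qed.
Lemma normc_eq0 z : nc z = 0 -> z = 0.
Proof. exact: ComplexField.Normc.eq0_normc. Qed.
Lemma normc_sum (I : Type) (r : seq I) (F : I -> R[i]) :
  nc (\sum_(i <- r) F i) <= \sum_(i <- r) nc (F i).
Proof.
elim: r => [|i r IH]; first by rewrite !big_nil normc0.
by rewrite !big_cons (le_trans (normcD _ _)) ?lerD2l.
Qed.
Lemma normc_Re z : `|complex.Re z| <= nc z.
Proof. by have := normc_ge_Re z; rewrite normr_normc lecR. Qed.
Lemma normc_Im z : `|complex.Im z| <= nc z.
Proof.
case: z => a b /=; rewrite -[X in X <= _]sqrtr_sqr -[leLHS]ger0_norm ?sqrtr_ge0 //.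
by rewrite ger0_norm ?sqrtr_ge0 // ler_sqrt ?sqrtr_sqr ?addr_ge0 ?sqr_ge0 // lerDr sqr_ge0.
Qed.
Lemma normc_le_ReIm z : nc z <= `|complex.Re z| + `|complex.Im z|.
Proof.
case: z => a b /=; rewrite -[leRHS]ger0_norm ?addr_ge0 // -sqrtr_sqr.
rewrite ler_sqrt ?sqr_ge0 // sqrrD !real_normK ?num_real // lerD2r lerDl.
by rewrite mulrn_wge0 ?mulr_ge0.
Qed.
Lemma normc_real (x : R) : nc x%:C = `|x|.
Proof. by rewrite /= expr0n addr0 sqrtr_sqr. Qed.

Definition cvgC u z := (fun n => nc (u n - z) : R^o) @ \oo --> (0 : R^o).

Lemma cvgC_squeeze u z (e : nat -> R^o) : (forall n, nc (u n - z) <= e n) ->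
  e @ \oo --> (0 : R^o) -> cvgC u z.
Proof.
move=> ue e0; apply: (squeeze_cvgr _ (cvg_cst 0) e0).
by near=> n; rewrite normc_ge0 ue.
Unshelve. all: by end_near. Qed.

Lemma cvgC_cst z : cvgC (fun=> z) z.
Proof.
by apply: (@cvgC_squeeze _ _ (fun=> 0)) => [n|]; [rewrite subrr normc0|exact: cvg_cst].
Qed.

Lemma cvgCD u v z z' : cvgC u z -> cvgC v z' -> cvgC (fun n => u n + v n) (z + z').
Proof.
move=> uz vz; apply: (cvgC_squeeze (e := fun n => nc (u n - z) + nc (v n - z'))).
  by move=> n; rewrite opprD addrACA normcD.
by rewrite -[0](addr0 (0 : R^o)); apply: cvgD.
Qed.

Lemma cvgCZ c u z : cvgC u z -> cvgC (fun n => c * u n) (c * z).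
Proof.
move=> uz; apply: (cvgC_squeeze (e := fun n => nc c * nc (u n - z))).
  by move=> n; rewrite -mulrBr normcM.
by rewrite -[0](mulr0 (nc c : R^o)); apply: cvgM; [exact: cvg_cst|exact: uz].
Qed.

Lemma cvgCB u v z z' : cvgC u z -> cvgC v z' -> cvgC (fun n => u n - v n) (z - z').
Proof.
move=> uz vz; rewrite (_ : (fun n => u n - v n) = (fun n => u n + (-1) * v n)).
  by rewrite -[- z']mulN1r; apply: cvgCD => //; exact: cvgCZ.
by apply/funext => n; rewrite mulN1r.
Qed.

Lemma cvgC_bounded u z : cvgC u z -> exists M, forall n, nc (u n) <= M.
Proof.
move=> uz; have /cvg_seq_bounded[M [_ Mu]] : cvgn (fun n => nc (u n - z) : R^o).
  by apply/cvg_ex; exists 0.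
exists (`|M| + 1 + nc z) => n; rewrite -{1}(subrK z (u n)) (le_trans (normcD _ _)) // lerD2r.
have /Mu/(_ n I) : M < `|M| + 1 by rewrite (le_lt_trans (ler_norm _)) // ltrDl.
exact: le_trans (ler_norm _).
Qed.

Lemma cvgCM u v z z' : cvgC u z -> cvgC v z' -> cvgC (fun n => u n * v n) (z * z').
Proof.
move=> uz vz; have [M uM] := cvgC_bounded uz.
apply: (cvgC_squeeze (e := fun n => M * nc (v n - z') + nc z' * nc (u n - z))).
  move=> n; have -> : u n * v n - z * z' = u n * (v n - z') + z' * (u n - z) by ring.
  rewrite (le_trans (normcD _ _)) // !normcM lerD2r.
  by rewrite ler_wpM2r ?normc_ge0.
rewrite (_ : 0 = M * 0 + nc z' * 0 :> R^o); last by rewrite !mulr0 addr0.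
by apply: cvgD; apply: cvgM; try exact: cvg_cst; [exact: vz|exact: uz].
Qed.

Lemma cvgC_unique u z z' : cvgC u z -> cvgC u z' -> z = z'.
Proof.
move=> uz uz'; apply/eqP; rewrite eq_sym -subr_eq0; apply/eqP/normc_eq0.
have := cvgCB uz uz'; rewrite /cvgC => h.
have : (fun n => nc (u n - u n - (z - z')) : R^o) @ \oo --> (nc (z' - z) : R^o).
  rewrite (_ : (fun n => _) = fun=> nc (z' - z)); first exact: cvg_cst.
  by apply/funext => n; rewrite subrr sub0r opprB.
by move/cvg_unique => /(_ (@Rhausdorff R)) /(_ _ h).
Qed.

Lemma cvgC_shift k u z : cvgC (fun n => u (n + k)%N) z <-> cvgC u z.
Proof. by rewrite /cvgC -(cvg_shiftn k (fun n => nc (u n - z) : R^o)). Qed.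

(** [Phi] and [analytic] speak of real and imaginary parts separately; this is the bridge to
    estimates of moduli. *)
Lemma cvgC_ReIm u z : cvgC u z <->
  (fun n => complex.Re (u n) : R^o) @ \oo --> (complex.Re z : R^o) /\
  (fun n => complex.Im (u n) : R^o) @ \oo --> (complex.Im z : R^o).
Proof.
split=> [uz|[uR uI]].
  split; apply/cvgrPdist_le => e e0; move/cvgrPdist_le: uz => /(_ e e0); apply: filterS => n.
  - rewrite sub0r normrN ger0_norm ?normc_ge0 //; apply: le_trans.
    by rewrite distrC -raddfB normc_Re.
  - rewrite sub0r normrN ger0_norm ?normc_ge0 //; apply: le_trans.
    by rewrite distrC -raddfB normc_Im.
apply: (cvgC_squeeze (e := fun n => `|complex.Re (u n) - complex.Re z| + `|complex.Im (u n) - complex.Im z|)).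
  by move=> n; rewrite (le_trans (normc_le_ReIm _)) // !raddfB.
by rewrite -[0](addr0 (0 : R^o)); apply: cvgD;
  [rewrite -(normr0 R) -(subrr (complex.Re z))|rewrite -(normr0 R) -(subrr (complex.Im z))];
  apply: cvg_norm; apply: cvgB => //; exact: cvg_cst.
Qed.

End ComplexSeq.

(** * The radial parts of the invariant operators *)

Section SchurTwo.
Variable B : comNzRingType.
Implicit Types (q s x y : B).

(* With q = x + y and s = x y, the complete homogeneous symmetric polynomial
   of degree k in x and y. *)
Fixpoint hsym q s k : B :=
  if k is k1.+1 then
    if k1 is k2.+1 then q * hsym q s k1 - s * hsym q s k2 else q
  else 1.

(* With q = x + y and s = x y, the quotient of x^m y^n - x^n y^m by x - y. *)
Definition schur2 q s m n : B :=
  if (n < m)%N then s ^+ n * hsym q s (m - n).-1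
  else if (m < n)%N then - (s ^+ m * hsym q s (n - m).-1) else 0.

Lemma hsymSS q s k : hsym q s k.+2 = q * hsym q s k.+1 - s * hsym q s k.
Proof. by []. Qed.

Lemma hsym_ind (P : nat -> Prop) : P 0 -> P 1%N ->
  (forall k, P k -> P k.+1 -> P k.+2) -> forall k, P k.
Proof.
move=> P0 P1 PS k; suff: P k /\ P k.+1 by case.
by elim: k => // k [Pk PkS]; split=> //; apply: PS.
Qed.

Lemma hsymE x y k :
  (x - y) * hsym (x + y) (x * y) k = x ^+ k.+1 - y ^+ k.+1.
Proof.
elim/hsym_ind: k => [||k IH1 IH2]; rewrite ?hsymSS.
- by rewrite /= mulr1 !expr1.
- by rewrite /=; ring.
- rewrite mulrBr mulrCA IH2 mulrCA IH1 !exprS; ring.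
Qed.

Lemma schur2_addl q s k l : schur2 q s (k + l).+1 k = s ^+ k * hsym q s l.
Proof. by rewrite /schur2 ltnS leq_addr -addnS addKn. Qed.
Lemma schur2_diag q s k : schur2 q s k k = 0.
Proof. by rewrite /schur2 ltnn. Qed.
Lemma schur2_anti q s k l : schur2 q s k l = - schur2 q s l k.
Proof. by rewrite /schur2; case: ltngtP => _; rewrite ?opprK ?oppr0. Qed.

Lemma schur2E x y m n :
  (x - y) * schur2 (x + y) (x * y) m n = x ^+ m * y ^+ n - x ^+ n * y ^+ m.
Proof.
rewrite /schur2; case: ltngtP => [lt|lt|->]; last by rewrite mulr0 subrr.
- have E z : z ^+ m = z ^+ (m - n) * z ^+ n by rewrite -exprD subnK // ltnW.
  by rewrite mulrCA hsymE exprMn prednK ?subn_gt0 // !E; ring.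
- have E z : z ^+ n = z ^+ (n - m) * z ^+ m by rewrite -exprD subnK // ltnW.
  by rewrite mulrN mulrCA hsymE exprMn prednK ?subn_gt0 // !E; ring.
Qed.

End SchurTwo.

Lemma rmorph_hsym (B C : comNzRingType) (phi : {rmorphism B -> C}) q s k :
  phi (hsym q s k) = hsym (phi q) (phi s) k.
Proof.
elim/hsym_ind: k => [||k IH1 IH2] //; first exact: rmorph1.
by rewrite !hsymSS rmorphB !rmorphM IH1 IH2.
Qed.

Lemma rmorph_schur2 (B C : comNzRingType) (phi : {rmorphism B -> C}) q s m n :
  phi (schur2 q s m n) = schur2 (phi q) (phi s) m n.
Proof.
rewrite /schur2; case: ifP => _; first by rewrite rmorphM rmorphXn rmorph_hsym.
case: ifP => _; last by rewrite rmorph0.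
by rewrite rmorphN rmorphM rmorphXn rmorph_hsym.
Qed.

Section RadialDefs.
Variable A : comNzRingType.
Implicit Types (u v : 'I_2 -> 'I_2 -> A) (du dv : 'I_2 -> 'I_2 -> A -> A) (f g : A).

Definition derivation (d : A -> A) :=
  {morph d : f g / f + g} /\ forall f g, d (f * g) = d f * g + f * d g.

Lemma derivation0 d : derivation d -> d 0 = 0.
Proof. by case=> dD _; apply: (addIr (d 0)); rewrite -dD !add0r. Qed.

Lemma derivationN d f : derivation d -> d (- f) = - d f.
Proof.
by move=> dd; apply: (addIr (d f)); rewrite -dd.1 !addNr derivation0.
Qed.

Lemma derivation1 d : derivation d -> d 1 = 0.
Proof.
case=> _ dM; have := dM 1 1; rewrite !mulr1 mul1r => h.
by apply: (addIr (d 1)); rewrite add0r -h.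
Qed.

Lemma derivationX d n f : derivation d -> d (f ^+ n) = n%:R * f ^+ n.-1 * d f.
Proof.
move=> dd; elim: n => [|n IH]; first by rewrite expr0 derivation1 // !mul0r.
rewrite exprS dd.2 IH; case: n {IH} => [|n] /=; first by rewrite !mul0r !mul1r expr0; ring.
by rewrite !exprS -!natr1; ring.
Qed.

Definition det2 u : A := u 0 0 * u 1 1 - u 0 1 * u 1 0.
Definition truv u v : A := u 0 0 * v 0 0 + u 0 1 * v 1 0 +
  (u 1 0 * v 0 1 + u 1 1 * v 1 1).
Definition suv u v : A := det2 u * det2 v.

Lemma truvC u v : truv u v = truv v u. Proof. by rewrite /truv; ring. Qed.
Lemma suvC u v : suv u v = suv v u. Proof. exact: mulrC. Qed.

(** Cayley's operator det(d/dU). Next to it, [eul] is the Euler operator, [polar] the derivative in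
    the direction of the adjugate of v, and [lapuv] is tr(d/dU d/dV). *)
Definition cay du f := du 1 1 (du 0 0 f) - du 1 0 (du 0 1 f).
Definition eul u du f := u 0 0 * du 0 0 f + u 0 1 * du 0 1 f +
  (u 1 0 * du 1 0 f + u 1 1 * du 1 1 f).
Definition polar v du f := v 0 0 * du 1 1 f + v 1 1 * du 0 0 f -
  (v 1 0 * du 1 0 f + v 0 1 * du 0 1 f).
Definition lapuv du dv f := dv 0 0 (du 0 0 f) + dv 1 0 (du 0 1 f) +
  (dv 0 1 (du 1 0 f) + dv 1 1 (du 1 1 f)).

End RadialDefs.

(** * Operators in the entries of one of the two blocks *)

Section HalfRadial.
Variables (A : comNzRingType) (u v : 'I_2 -> 'I_2 -> A).
Variable du : 'I_2 -> 'I_2 -> A -> A.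
Implicit Types (f g : A) (i j : 'I_2) (n k : nat).
Hypothesis du_der : forall i j, derivation (du i j).
Hypothesis duu : forall i j (k l : 'I_2), du i j (u k l) = ((i == k) && (j == l))%:R.
Hypothesis duv : forall i j (k l : 'I_2), du i j (v k l) = 0.
Local Notation h := (hsym (truv u v) (suv u v)).
Local Notation cayu := (cay du).
Local Notation eulu := (eul u du).
Local Notation polu := (polar v du).

Let duD i j : {morph du i j : f g / f + g}. Proof. by case: (du_der i j). Qed.
Let duM i j f g : du i j (f * g) = du i j f * g + f * du i j g.
Proof. by case: (du_der i j). Qed.
Let duN i j f : du i j (- f) = - du i j f. Proof. exact: derivationN. Qed.
Let du0 i j : du i j 0 = 0. Proof. exact: derivation0. Qed.
Let du1 i j : du i j 1 = 0. Proof. exact: derivation1. Qed.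

Local Ltac dsimp :=
  rewrite /cay /eul /polar /suv /det2 /truv;
  do 3 rewrite ?(duM, duD, duN, du0, du1, duu, duv) /=.

Lemma cay_detM f : cayu (det2 u * f) = det2 u * cayu f + eulu f + 2 * f.
Proof. by dsimp; ring. Qed.
Lemma cay_detM_other f : cayu (det2 v * f) = det2 v * cayu f.
Proof. by dsimp; ring. Qed.
Lemma cay_suvM f :
  cayu (suv u v * f) = det2 v * (det2 u * cayu f + eulu f + 2 * f).
Proof. by rewrite /suv [det2 u * _]mulrC -mulrA cay_detM_other cay_detM. Qed.
Lemma cay_truvM f : cayu (truv u v * f) = truv u v * cayu f + polu f.
Proof. by dsimp; ring. Qed.
Lemma eul_der : derivation eulu.
Proof. by split=> f g; dsimp; ring. Qed.
Lemma polar_der : derivation polu.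
Proof. by split=> f g; dsimp; ring. Qed.
Lemma cayD f g : cayu (f + g) = cayu f + cayu g.
Proof. by dsimp; ring. Qed.
Lemma cayN f : cayu (- f) = - cayu f.
Proof. by dsimp; ring. Qed.
Lemma cay_1 : cayu 1 = 0.
Proof. by dsimp; ring. Qed.
Lemma eul_truv : eulu (truv u v) = truv u v. Proof. by dsimp; ring. Qed.
Lemma eul_det : eulu (det2 u) = 2 * det2 u. Proof. by dsimp; ring. Qed.
Lemma eul_suv : eulu (suv u v) = 2 * suv u v. Proof. by dsimp; ring. Qed.
Lemma polar_truv : polu (truv u v) = 2 * det2 v. Proof. by dsimp; ring. Qed.
Lemma polar_suv : polu (suv u v) = det2 v * truv u v.
Proof. by dsimp; ring. Qed.

Lemma derivation_hsymSS d k : derivation d -> d (h k.+2) =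
  d (truv u v) * h k.+1 + truv u v * d (h k.+1) -
  (d (suv u v) * h k + suv u v * d (h k)).
Proof. by move=> dd; rewrite hsymSS dd.1 derivationN // !dd.2. Qed.

Lemma eul_hsym k : eulu (h k) = k%:R * h k.
Proof.
elim/hsym_ind: k => [||k IH1 IH2].
- by rewrite derivation1 ?mul0r //; exact: eul_der.
- by rewrite eul_truv mul1r.
- rewrite (derivation_hsymSS _ eul_der) eul_truv eul_suv IH1 IH2 hsymSS.
  by rewrite -!natr1; ring.
Qed.

Lemma polar_hsym0 : polu (h 0) = 0.
Proof. exact/derivation1/polar_der. Qed.

Lemma polar_hsym k : polu (h k.+1) = k.+2%:R * det2 v * h k.
Proof.
elim/hsym_ind: k => [||k IH1 IH2].
- by rewrite polar_truv mulr1.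
- rewrite (derivation_hsymSS _ polar_der) polar_hsym0 polar_truv polar_suv /=; ring.
- rewrite (derivation_hsymSS _ polar_der) polar_truv polar_suv IH1 IH2 !hsymSS.
  by rewrite -!natr1; ring.
Qed.

(** [h k] is the trace of the k-th symmetric power of UV, whose matrix coefficients in U are
    annihilated by det(d/dU). In the recursion, the term (k + 2) det(v) h k of [polar_hsym] cancels
    the one coming from [cay_suvM]. *)
Lemma cay_hsym k : cayu (h k) = 0.
Proof.
elim/hsym_ind: k => [||k IH1 IH2]; first exact: cay_1.
- rewrite -[h 1]mulr1 cay_truvM cay_1 derivation1 ?mulr0 ?addr0 //.
  exact: polar_der.
- rewrite hsymSS cayD cayN cay_truvM cay_suvM IH1 IH2 polar_hsym eul_hsym.
  by rewrite -!natr1; ring.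
Qed.

Lemma eul_detX n k :
  eulu (det2 u ^+ n * h k) = (n%:R * 2 + k%:R) * (det2 u ^+ n * h k).
Proof.
elim: n => [|n IH]; first by rewrite expr0 !mul1r eul_hsym mul0r add0r.
rewrite exprS -mulrA eul_der.2 IH eul_det -natr1; ring.
Qed.

(** A Capelli identity. Each factor det(u) contributes the commutator [eulu] + 2, with eigenvalue 2
    j + k + 2 on det(u)^j h k, and these values for j < n add up to n (n + k + 1). *)
Lemma cay_detX n k : cayu (det2 u ^+ n * h k) =
  n%:R * (n%:R + k%:R + 1) * (det2 u ^+ n.-1 * h k).
Proof.
elim: n => [|n IH]; first by rewrite expr0 mul1r cay_hsym !mul0r.
rewrite exprS -mulrA cay_detM IH eul_detX.
by case: n {IH} => [|n] /=; rewrite ?exprS -?natr1; ring.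
Qed.

Lemma cay_detX_other n f : cayu (det2 v ^+ n * f) = det2 v ^+ n * cayu f.
Proof.
elim: n f => [|n IH] f; first by rewrite !mul1r.
by rewrite exprS -mulrA cay_detM_other IH mulrA.
Qed.

Lemma cay_natM n f : cayu (n%:R * f) = n%:R * cayu f.
Proof.
elim: n => [|n IH]; first by rewrite !mul0r; dsimp; ring.
by rewrite -natr1 !mulrDl cayD IH !mul1r.
Qed.

End HalfRadial.

(** * Action of the radial parts on the antisymmetric quotients *)

Section Radial.
Variables (A : comNzRingType) (u v : 'I_2 -> 'I_2 -> A).
Variables (du dv : 'I_2 -> 'I_2 -> A -> A).
Implicit Types (f g : A) (n k l : nat).
Hypotheses (du_der : forall i j, derivation (du i j))
  (dv_der : forall i j, derivation (dv i j)).
Hypothesis duu : forall i j (k l : 'I_2), du i j (u k l) = ((i == k) && (j == l))%:R.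
Hypothesis dvv : forall i j (k l : 'I_2), dv i j (v k l) = ((i == k) && (j == l))%:R.
Hypothesis duv : forall i j (k l : 'I_2), du i j (v k l) = 0.
Hypothesis dvu : forall i j (k l : 'I_2), dv i j (u k l) = 0.
Local Notation h := (hsym (truv u v) (suv u v)).
Local Notation cayu := (cay du).
Local Notation cayv := (cay dv).
Local Notation eulu := (eul u du).
Local Notation eulv := (eul v dv).
Local Notation polu := (polar v du).
Local Notation polv := (polar u dv).
Local Notation lap := (lapuv du dv).
Local Notation tr := (truv u v).
Local Notation s := (suv u v).

Let duD i j : {morph du i j : f g / f + g}. Proof. by case: (du_der i j). Qed.
Let dvD i j : {morph dv i j : f g / f + g}. Proof. by case: (dv_der i j). Qed.
Let duM i j f g : du i j (f * g) = du i j f * g + f * du i j g.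
Proof. by case: (du_der i j). Qed.
Let dvM i j f g : dv i j (f * g) = dv i j f * g + f * dv i j g.
Proof. by case: (dv_der i j). Qed.
Let duN i j f : du i j (- f) = - du i j f. Proof. exact: derivationN. Qed.
Let dvN i j f : dv i j (- f) = - dv i j f. Proof. exact: derivationN. Qed.
Let du0 i j : du i j 0 = 0. Proof. exact: derivation0. Qed.
Let dv0 i j : dv i j 0 = 0. Proof. exact: derivation0. Qed.
Let du1 i j : du i j 1 = 0. Proof. exact: derivation1. Qed.
Let dv1 i j : dv i j 1 = 0. Proof. exact: derivation1. Qed.

Local Ltac dsimp :=
  rewrite /lapuv /eul /polar /suv /det2 /truv;
  do 3 rewrite ?(duM, dvM, duD, dvD, duN, dvN, du0, dv0, du1, dv1, duu, duv,
    dvu, dvv) /=.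

Let eulu_der := eul_der u du_der.
Let eulv_der := eul_der v dv_der.
Let polu_der := polar_der v du_der.
Let polv_der := polar_der u dv_der.
Let eulu_1 : eulu 1 = 0. Proof. exact/derivation1/eulu_der. Qed.
Let eulv_1 : eulv 1 = 0. Proof. exact/derivation1/eulv_der. Qed.
Let polu_1 : polu 1 = 0. Proof. exact/derivation1/polu_der. Qed.
Let polv_1 : polv 1 = 0. Proof. exact/derivation1/polv_der. Qed.
Let eulv_truv : eulv tr = tr.
Proof. by rewrite truvC; exact: eul_truv. Qed.
Let polv_suv : polv s = det2 u * tr.
Proof. by rewrite truvC suvC; exact: polar_suv. Qed.
Let eulv_hsym k : eulv (h k) = k%:R * h k.
Proof. by rewrite truvC suvC; exact: eul_hsym. Qed.
Let polv_hsym k : polv (h k.+1) = k.+2%:R * det2 u * h k.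
Proof. by rewrite truvC suvC; exact: polar_hsym. Qed.
Let cayv_detX n k : cayv (det2 v ^+ n * h k) =
  n%:R * (n%:R + k%:R + 1) * (det2 v ^+ n.-1 * h k).
Proof. by rewrite truvC suvC; exact: cay_detX. Qed.

Lemma lapuv_truvM f :
  lap (tr * f) = tr * lap f + eulu f + eulv f + 4 * f.
Proof. by dsimp; ring. Qed.
Lemma lapuv_suvM f : lap (s * f) =
  s * lap f + det2 u * polu f + det2 v * polv f + tr * f.
Proof. by dsimp; ring. Qed.
Lemma lapuvD f g : lap (f + g) = lap f + lap g.
Proof. by dsimp; ring. Qed.
Lemma lapuvN f : lap (- f) = - lap f.
Proof. by dsimp; ring. Qed.
Lemma lapuv_1 : lap 1 = 0. Proof. by dsimp; ring. Qed.

Lemma suvX n : s ^+ n = det2 u ^+ n * det2 v ^+ n. Proof. exact: exprMn. Qed.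

Lemma caycay_suvX n k : cayv (cayu (s ^+ n * h k)) =
  (n%:R * (n%:R + k%:R + 1)) ^+ 2 * (s ^+ n.-1 * h k).
Proof.
have -> : s ^+ n * h k = det2 v ^+ n * (det2 u ^+ n * h k).
  by rewrite suvX; ring.
have natE : n%:R * (n%:R + k%:R + 1) = (n * (n + k + 1))%:R :> A.
  by rewrite natrM !natrD.
rewrite (cay_detX_other du_der duv) (cay_detX du_der duu duv) natE mulrCA (cay_natM dv_der).
have -> : det2 v ^+ n * (det2 u ^+ n.-1 * h k) = det2 u ^+ n.-1 * (det2 v ^+ n * h k).
  by ring.
rewrite (cay_detX_other dv_der dvu) cayv_detX -natE suvX; ring.
Qed.

Lemma lapuv_hsym k : lap (h k.+1) = (k.+2 ^ 2)%:R * h k.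
Proof.
elim/hsym_ind: k => [||k IH1 IH2].
- by rewrite -[h 1]mulr1 lapuv_truvM lapuv_1 eulu_1 eulv_1 -[h 0]/1; ring.
- rewrite hsymSS lapuvD lapuvN lapuv_truvM lapuv_suvM -[h 0]/1 -[h 1]mulr1.
  rewrite lapuv_truvM mulr1 !lapuv_1 eulu_1 eulv_1 polu_1 polv_1.
  by rewrite !mulr1 (eul_truv du_der duu duv) eulv_truv -[h 1]/tr; ring.
- rewrite hsymSS lapuvD lapuvN lapuv_truvM lapuv_suvM IH1 IH2.
  rewrite (eul_hsym du_der duu duv) eulv_hsym (polar_hsym du_der duu duv) polv_hsym hsymSS /suv.
  by rewrite !natrX -!natr1; ring.
Qed.

(** The convention h(-1) = 0, under which the recursion [hsymSE] holds from k = 0 on. *)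
Definition hpred k : A := if k is k1.+1 then h k1 else 0.

Lemma lapuv_hsymE k : lap (h k) = (k.+1 ^ 2)%:R * hpred k.
Proof. by case: k => [|k]; rewrite ?lapuv_hsym // lapuv_1 mulr0. Qed.
Lemma polu_hsymE k : polu (h k) = k.+1%:R * det2 v * hpred k.
Proof. by case: k => [|k]; [rewrite polu_1 mulr0|exact: polar_hsym]. Qed.
Lemma polv_hsymE k : polv (h k) = k.+1%:R * det2 u * hpred k.
Proof. by case: k => [|k]; [rewrite polv_1 mulr0|exact: polv_hsym]. Qed.
Lemma hsymSE k : h k.+1 = tr * h k - s * hpred k.
Proof. by case: k => [|k]; rewrite /= ?mulr0 ?subr0 ?mulr1. Qed.

Lemma lapuv_suvX n k : lap (s ^+ n * h k) =
  ((n + k).+1 ^ 2)%:R * (s ^+ n * hpred k) +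
  (n ^ 2)%:R * (s ^+ n.-1 * h k.+1).
Proof.
elim: n => [|n IH]; first by rewrite mul1r lapuv_hsymE mul0r addr0 mul1r add0n.
rewrite exprS -mulrA lapuv_suvM IH polu_der.2 polv_der.2.
rewrite (derivationX _ _ polu_der) (derivationX _ _ polv_der).
rewrite (polar_suv du_der duu duv) polv_suv polu_hsymE polv_hsymE hsymSE.
rewrite addSn !natrX -!natr1 natrD /suv.
by case: n {IH} => [|n] /=; rewrite ?expr0 ?exprS -?natr1; ring.
Qed.

(** In the eigenvalues x, y of UV, conjugation by x - y turns tr(d/dU d/dV) into D_x + D_y with D =
    x (d/dx)^2 + d/dx, and D x^m = m^2 x^(m-1). The truncation [m.-1] at m = 0 is harmless because
    of the factor m^2. *)
Lemma lapuv_schur2 m n : lap (schur2 tr s m n) =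
  (m ^ 2)%:R * schur2 tr s m.-1 n + (n ^ 2)%:R * schur2 tr s m n.-1.
Proof.
have main k l : lap (schur2 tr s (k + l).+1 k) =
    ((k + l).+1 ^ 2)%:R * schur2 tr s (k + l) k +
    (k ^ 2)%:R * schur2 tr s (k + l).+1 k.-1.
  rewrite schur2_addl lapuv_suvX; congr (_ * _ + _).
    case: l => [|l]; first by rewrite addn0 schur2_diag mulr0.
    by rewrite addnS schur2_addl.
  case: k => [|k]; first by rewrite !mul0r.
  by rewrite addSnnS schur2_addl.
case: (ltngtP m n) => [lt|lt|->].
- rewrite schur2_anti lapuvN -(subnK lt) addnS addnC main /=.
  by rewrite (schur2_anti _ _ m) (schur2_anti _ _ m.-1) !mulrN -opprD addrC.
- by rewrite -(subnK lt) addnS addnC main.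
- rewrite schur2_diag (schur2_anti _ _ n n.-1) mulrN subrr.
  by dsimp; ring.
Qed.

(** The same conjugation turns det(d/dU) det(d/dV) into the product D_x D_y. *)
Lemma caycay_schur2 m n : cayv (cayu (schur2 tr s m n)) =
  (m ^ 2 * n ^ 2)%:R * schur2 tr s m.-1 n.-1.
Proof.
have main k l : cayv (cayu (schur2 tr s (k + l).+1 k)) =
    ((k + l).+1 ^ 2 * k ^ 2)%:R * schur2 tr s (k + l) k.-1.
  rewrite schur2_addl caycay_suvX.
  case: k => [|k]; first by rewrite muln0 !mul0r expr0n !mul0r.
  rewrite addSn schur2_addl; congr (_ * _).
  by rewrite -natrD natr1 -natrM -natrX -expnMn mulnC.
case: (ltngtP m n) => [lt|lt|->].
- rewrite schur2_anti (cayN du_der) (cayN dv_der) -(subnK lt) addnS addnC main /=.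
  by rewrite (schur2_anti _ _ m.-1) mulrN mulnC.
- by rewrite -(subnK lt) addnS addnC main.
- rewrite !schur2_diag mulr0.
  by rewrite /cay ?(du0, subr0) ?(dv0, subr0).
Qed.

End Radial.

(** * Constant coefficient operators on polynomials *)

Section PolyDer.
Variable R : realType.
Local Notation poly := (Cpolyq R).
Implicit Types (p q P : poly) (m : multinom dimq) (w : qspace R).

Definition polydir w p : poly :=
  \sum_l (qcoord w 0 l)%:C *: mderiv l p.

Definition polyderivs (s : seq (qspace R)) p : poly := foldr polydir p s.

Definition polyop P p : poly :=
  \sum_(m <- msupp P) mcoeff m P *: polyderivs (mono_dirs R m) p.

Lemma polydir_is_linear w : linear (polydir w).
Proof.
move=> c p q; rewrite /polydir scaler_sumr -big_split /=; apply: eq_bigr => l _.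
by rewrite linearP scalerDr !scalerA mulrC.
Qed.
HB.instance Definition _ w :=
  GRing.isLinear.Build _ _ _ _ (polydir w) (polydir_is_linear w).

Lemma polydirC w1 w2 p : polydir w1 (polydir w2 p) = polydir w2 (polydir w1 p).
Proof.
have E u v : polydir u (polydir v p) =
    \sum_k \sum_l ((qcoord u 0 k)%:C * (qcoord v 0 l)%:C) *: mderiv k (mderiv l p).
  rewrite {1}/polydir; apply: eq_bigr => k _.
  rewrite {1}/polydir (linear_sum (mderiv k)) scaler_sumr; apply: eq_bigr => l _.
  by rewrite linearZ /= scalerA.
rewrite !E exchange_big; apply: eq_bigr => l _; apply: eq_bigr => k _.
by rewrite mulrC mderiv_comm.
Qed.

Lemma polyderivs_is_linear s : linear (polyderivs s).
Proof. by elim: s => [|w s IH] c p q //=; rewrite IH linearP. Qed.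
HB.instance Definition _ s :=
  GRing.isLinear.Build _ _ _ _ (polyderivs s) (polyderivs_is_linear s).

Lemma polyderivs_cat s t p :
  polyderivs (s ++ t) p = polyderivs s (polyderivs t p).
Proof. exact: foldr_cat. Qed.

(** Derivatives in constant directions commute; this is what makes [polyop] multiplicative in the
    operator ([polyopM]). *)
Lemma polyderivs_perm s t p :
  perm_eq s t -> polyderivs s p = polyderivs t p.
Proof.
have mv w u : polyderivs u (polydir w p) = polydir w (polyderivs u p).
  elim: u => [//|x u IH].
  exact: (etrans (congr1 (polydir x) IH) (polydirC x w (polyderivs u p))).
elim: s t => [|w s IH] t; first by rewrite perm_sym => /perm_small_eq ->.
move=> pst; have wt : w \in t by rewrite -(perm_mem pst) mem_head.
case/splitPr: t / wt pst => t1 t2.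
rewrite perm_sym perm_catC cat_cons perm_cons perm_catC perm_sym => /IH /= ->.
rewrite !polyderivs_cat /=; elim: t1 => [//|x t1 IH2] /=; rewrite -IH2; exact: polydirC.
Qed.

Lemma polyopE k P p : (msize P <= k)%N -> polyop P p =
  \sum_(m : bmultinom dimq k) mcoeff m P *: polyderivs (mono_dirs R m) p.
Proof.
move=> lePk; set I : subFinType _ := bmultinom dimq k.
rewrite /polyop (ssrcomplements.big_mksub I) ?msupp_uniq //=; first last.
  by move=> x /msize_mdeg_lt /leq_trans; apply.
by rewrite big_rmcond //= => j /memN_msupp_eq0 ->; rewrite scale0r.
Qed.

Lemma polyop_is_linear P : linear (polyop P).
Proof.
move=> c p q; rewrite /polyop scaler_sumr -big_split /=; apply: eq_bigr => m _.
by rewrite linearP scalerDr !scalerA mulrC.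
Qed.
HB.instance Definition _ P :=
  GRing.isLinear.Build _ _ _ _ (polyop P) (polyop_is_linear P).

Lemma polyopZr P c p : polyop P (c *: p) = c *: polyop P p.
Proof. exact: linearZZ. Qed.
Lemma polyop_sumr P I (r : seq I) (p : I -> poly) :
  polyop P (\sum_(i <- r) p i) = \sum_(i <- r) polyop P (p i).
Proof. exact: linear_sum. Qed.

Lemma polyopP c P P' p : polyop (c *: P + P') p = c *: polyop P p + polyop P' p.
Proof.
pose k := maxn (msize (c *: P + P')) (maxn (msize P) (msize P')).
rewrite !(@polyopE k) ?leq_max ?leqnn ?orbT // scaler_sumr -big_split /=.
by apply: eq_bigr => m _; rewrite mcoeffD mcoeffZ scalerDl scalerA.
Qed.
Lemma polyop0 p : polyop 0 p = 0.
Proof. by rewrite /polyop msupp0 big_nil. Qed.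
Lemma polyopD P P' p : polyop (P + P') p = polyop P p + polyop P' p.
Proof. by rewrite -{1}[P]scale1r polyopP scale1r. Qed.
Lemma polyopZ c P p : polyop (c *: P) p = c *: polyop P p.
Proof. by rewrite -[c *: P]addr0 polyopP polyop0 addr0. Qed.

Lemma polyopX m p : polyop (mpolyX R[i] m) p = polyderivs (mono_dirs R m) p.
Proof. by rewrite /polyop msuppX big_seq1 mcoeffX eqxx scale1r. Qed.

Lemma polyop1 p : polyop 1 p = p.
Proof.
rewrite -(mpolyX0 dimq R[i]) polyopX.
rewrite (_ : mono_dirs R _ = [::]) // /mono_dirs; elim: (enum _) => //= k s ->.
by rewrite mnm0E.
Qed.

Lemma count_mono_dirs a m :
  count a (mono_dirs R m) = (\sum_k m k * a (qdual R k))%N.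
Proof.
rewrite /mono_dirs count_flatten -map_comp sumnE big_map big_enum /=.
by apply: eq_bigr => k _; rewrite count_nseq mulnC.
Qed.

Lemma size_mono_dirs m : size (mono_dirs R m) = mdeg m.
Proof.
rewrite -count_predT count_mono_dirs mdegE; apply: eq_bigr => k _.
by rewrite muln1.
Qed.

Lemma perm_mono_dirsD m1 m2 :
  perm_eq (mono_dirs R (mnm_add m1 m2)) (mono_dirs R m1 ++ mono_dirs R m2).
Proof.
apply/permP => a; rewrite count_cat !count_mono_dirs -big_split /=.
by apply: eq_bigr => k _; rewrite mnmDE mulnDl.
Qed.

Lemma mono_dirs1 k : mono_dirs R (mnm1 k) = [:: qdual R k].
Proof.
apply/perm_small_eq => //; apply/permP => a; rewrite count_mono_dirs /=.
rewrite (bigD1 k) //= mnm1E eqxx mul1n big1 // => i ik.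
by rewrite mnm1E eq_sym (negbTE ik).
Qed.

Lemma polyopM P P' p : polyop (P * P') p = polyop P (polyop P' p).
Proof.
elim/mpolyind: P => [|c m P _ _ IH]; first by rewrite mul0r !polyop0.
rewrite mulrDl polyopD IH [RHS]polyopD; congr (_ + _).
rewrite -scalerAl !polyopZ polyopX; congr (_ *: _).
elim/mpolyind: P' {P IH} => [|c' m' P' _ _ IH].
  by rewrite mulr0 !polyop0 linear0.
rewrite mulrDr !polyopD linearD IH /=; congr (_ + _).
rewrite -scalerAr !polyopZ linearZ /= -mpolyXD !polyopX; congr (_ *: _).
by rewrite (polyderivs_perm _ (perm_mono_dirsD _ _)) polyderivs_cat.
Qed.

End PolyDer.

(** * The operators attached to Q and S in matrix entries *)

Section RadialPoly.
Variable R : realType.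
Local Notation poly := (Cpolyq R).
Implicit Types (p q P : poly) (i j : 'I_2).

Definition idU i j : 'I_dimq := lshift (2 * 2) (mxvec_index i j).
Definition idV i j : 'I_dimq := rshift (2 * 2) (mxvec_index i j).
Definition Uvar i j : poly := mpolyX R[i] (mnm1 (idU i j)).
Definition Vvar i j : poly := mpolyX R[i] (mnm1 (idV i j)).
Definition dU i j p : poly := mderiv (idU i j) p.
Definition dV i j p : poly := mderiv (idV i j) p.

Lemma mxvec_index_eq i j (k l : 'I_2) :
  (mxvec_index i j == mxvec_index k l) = (i == k) && (j == l).
Proof. by rewrite /mxvec_index (inj_eq (@cast_ord_inj _ _ _)) (inj_eq enum_rank_inj). Qed.

Lemma mderivXU (k l : 'I_dimq) :
  mderiv k (mpolyX R[i] (mnm1 l)) = (l == k)%:R :> poly.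
Proof.
rewrite mderivX mnm1E; case: eqVneq => [->|_]; last by rewrite scale0r.
rewrite scale1r (_ : mnm_sub _ _ = mnm0) ?mpolyX0 //.
by apply/mnmP => i; rewrite mnmBE subnn mnm0E.
Qed.

Lemma dU_der i j : derivation (dU i j).
Proof. by split=> [p q|p q]; [exact: mderivD|exact: mderivM]. Qed.
Lemma dV_der i j : derivation (dV i j).
Proof. by split=> [p q|p q]; [exact: mderivD|exact: mderivM]. Qed.
Lemma dUC i j (k l : 'I_2) p : dU i j (dU k l p) = dU k l (dU i j p).
Proof. exact: mderiv_comm. Qed.
Lemma dVC i j (k l : 'I_2) p : dV i j (dV k l p) = dV k l (dV i j p).
Proof. exact: mderiv_comm. Qed.
Lemma dUU i j (k l : 'I_2) : dU i j (Uvar k l) = ((i == k) && (j == l))%:R.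
Proof. by rewrite /dU mderivXU eq_lshift mxvec_index_eq eq_sym [l == j]eq_sym. Qed.
Lemma dUV i j (k l : 'I_2) : dU i j (Vvar k l) = 0.
Proof. by rewrite /dU mderivXU eq_rlshift. Qed.
Lemma dVU i j (k l : 'I_2) : dV i j (Uvar k l) = 0.
Proof. by rewrite /dV mderivXU eq_lrshift. Qed.
Lemma dVV i j (k l : 'I_2) : dV i j (Vvar k l) = ((i == k) && (j == l))%:R.
Proof. by rewrite /dV mderivXU eq_rshift mxvec_index_eq eq_sym [l == j]eq_sym. Qed.

Lemma dUZ i j c p : dU i j (c *: p) = c *: dU i j p.
Proof. exact: mderivZ. Qed.
Lemma dVZ i j c p : dV i j (c *: p) = c *: dV i j p.
Proof. exact: mderivZ. Qed.

Lemma generic_pointE : generic_point R =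
  (\matrix_(i, j) Uvar i j, \matrix_(i, j) Vvar i j).
Proof.
by congr pair; apply/matrixP => i j; rewrite !mxE.
Qed.

Lemma mxtrace2 (A : pzRingType) (M : 'M[A]_2) : \tr M = M 0 0 + M 1 1.
Proof.
by rewrite /mxtrace big_ord_recl big_ord1; congr (_ + M _ _); apply/val_inj.
Qed.

Lemma det2E (A : comPzRingType) (M : 'M[A]_2) :
  \det M = M 0 0 * M 1 1 - M 0 1 * M 1 0.
Proof.
rewrite (expand_det_row _ 0) big_ord_recl big_ord1 /cofactor !det_mx11 !mxE /=.
rewrite expr0 expr1 mul1r mulN1r mulrN.
by congr (_ * M _ _ - M _ _ * M _ _); apply/val_inj.
Qed.

Lemma mulmx2E (A : pzRingType) (M N : 'M[A]_2) (i j : 'I_2) :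
  (M *m N) i j = M i 0 * N 0 j + M i 1 * N 1 j.
Proof.
rewrite mxE big_ord_recl big_ord1.
by congr (_ + M _ _ * N _ _); apply/val_inj.
Qed.

Lemma qmx_trace (A : comPzRingType) (X : qspace A) :
  \tr (qmx X *m qmx X) = (\tr (X.1 *m X.2)) *+ 2.
Proof.
rewrite /qmx mulmx_block !mul0mx !mulmx0 !addr0 !add0r mxtrace_block.
by rewrite (mxtrace_mulC X.2) mulr2n.
Qed.

Lemma qmx_det (A : comPzRingType) (X : qspace A) :
  \det (qmx X) = \det X.1 * \det X.2.
Proof.
(* The three unipotent factors multiply to (0 1; -1 0), and [- X.2] has the determinant of [X.2]
   because the size is even. *)
have -> : qmx X = block_mx 1%:M 1%:M 0 1%:M *m block_mx 1%:M 0 (- 1%:M) 1%:M *m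
    block_mx 1%:M 1%:M 0 1%:M *m block_mx (- X.2) 0 0 X.1.
  rewrite !mulmx_block !(mul0mx, mulmx0, mul1mx, mulmx1, mulmxN, mulNmx).
  by do ![rewrite !(addr0, add0r, oppr0, subrr, mul0mx, mul1mx, mulNmx, opprK, addNr)].
rewrite !det_mulmx !det_ublock det_lblock !det1 !mul1r -scaleN1r detZ.
by rewrite sqrrN expr1n mul1r mulrC.
Qed.

Lemma Qpoly_truv : Qpoly R = truv Uvar Vvar.
Proof.
rewrite /Qpoly qmx_trace generic_pointE mxtrace2 !mulmx2E !mxE.
by rewrite -scalerMnr scalerMnl -mulr_natr mulVf ?pnatr_eq0 // scale1r.
Qed.

Lemma Spoly_suv : Spoly R = suv Uvar Vvar.
Proof.
by rewrite /Spoly qmx_det generic_pointE !det2E !mxE.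
Qed.

(** As half the trace form, [omega] pairs the entry (i, j) of U with the entry (j, i) of V, and
    dualizing the factor 1/2 brings in a 2. *)
Lemma qdual_idU i j : qdual R (idU i j) = (0, 2 *: delta_mx j i).
Proof.
rewrite /qdual /qbasis /qpoint /idU /=; congr (_, _).
  by apply/matrixP => k l; rewrite !mxE eq_rlshift andbF mulr0.
rewrite (_ : lsubmx _ = delta_mx 0 (mxvec_index i j)).
  by rewrite vec_mx_delta trmx_delta.
by apply/matrixP => k l; rewrite !mxE eq_lshift.
Qed.
Lemma qdual_idV i j : qdual R (idV i j) = (2 *: delta_mx j i, 0).
Proof.
rewrite /qdual /qbasis /qpoint /idV /=; congr (_, _).
  rewrite (_ : rsubmx _ = delta_mx 0 (mxvec_index i j)).
    by rewrite vec_mx_delta trmx_delta.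
  by apply/matrixP => k l; rewrite !mxE eq_rshift.
by apply/matrixP => k l; rewrite !mxE eq_lrshift andbF mulr0.
Qed.

Lemma polydir_delta (w : qspace R) k p : (forall l, qcoord w 0 l = 2 * (l == k)%:R) ->
  polydir w p = 2 *: mderiv k p.
Proof.
move=> wE; rewrite /polydir (bigD1 k) //= big1 ?addr0 => [|l lk].
  by rewrite wE eqxx mulr1 rmorph_nat.
by rewrite wE (negbTE lk) mulr0 scale0r.
Qed.

Lemma polydir_qdualU i j p : polydir (qdual R (idU i j)) p = 2 *: dV j i p.
Proof.
apply: polydir_delta => l; rewrite qdual_idU /qcoord /idV.
case: (split_ordP l) => k ->.
  by rewrite row_mxEl eq_lrshift mulr0; case/mxvec_indexP: k => a b; rewrite mxvecE mxE.
rewrite row_mxEr eq_rshift; case/mxvec_indexP: k => a b.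
by rewrite mxvecE !mxE mxvec_index_eq.
Qed.

Lemma polydir_qdualV i j p : polydir (qdual R (idV i j)) p = 2 *: dU j i p.
Proof.
apply: polydir_delta => l; rewrite qdual_idV /qcoord /idU.
case: (split_ordP l) => k ->; last first.
  by rewrite row_mxEr eq_rlshift mulr0; case/mxvec_indexP: k => a b; rewrite mxvecE mxE.
rewrite row_mxEl eq_lshift; case/mxvec_indexP: k => a b.
by rewrite mxvecE !mxE mxvec_index_eq.
Qed.

Lemma polyop_Uvar i j p : polyop (Uvar i j) p = 2 *: dV j i p.
Proof. by rewrite polyopX mono_dirs1 /= polydir_qdualU. Qed.
Lemma polyop_Vvar i j p : polyop (Vvar i j) p = 2 *: dU j i p.
Proof. by rewrite polyopX mono_dirs1 /= polydir_qdualV. Qed.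

(** Every variable contributes a factor 2, hence 4 for the quadratic Q and 16 for the quartic S. *)
Lemma polyop_Qpoly p : polyop (Qpoly R) p = 4 *: lapuv dU dV p.
Proof.
have UV i j k l : polyop (Uvar i j * Vvar k l) p = 4 *: dV j i (dU l k p).
  by rewrite polyopM polyop_Uvar polyop_Vvar dVZ scalerA -natrM.
by rewrite Qpoly_truv /truv !polyopD !UV /lapuv !scalerDr.
Qed.

Lemma polyop_Spoly p :
  polyop (Spoly R) p = 16 *: cay dV (cay dU p).
Proof.
have polyopB P P' q : polyop (P - P') q = polyop P q - polyop P' q.
  by rewrite polyopD -scaleN1r polyopZ scaleN1r.
have opV q : polyop (det2 Vvar) q = 4 *: cay dU q.
  have VV i j k l : polyop (Vvar i j * Vvar k l) q = 4 *: dU j i (dU l k q).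
    by rewrite polyopM !polyop_Vvar dUZ scalerA -natrM.
  by rewrite /det2 polyopB !VV -scalerBr dUC.
have opU q : polyop (det2 Uvar) q = 4 *: cay dV q.
  have UU i j k l : polyop (Uvar i j * Uvar k l) q = 4 *: dV j i (dV l k q).
    by rewrite polyopM !polyop_Uvar dVZ scalerA -natrM.
  by rewrite /det2 polyopB !UU -scalerBr dVC.
rewrite Spoly_suv /suv polyopM opU opV.
by rewrite /cay !dVZ -scalerBr scalerA -natrM.
Qed.

End RadialPoly.

(** * Invariant polynomials *)

Section VanishingPoly.
Variables (K : idomainType) (D : {pred K}).
Hypothesis Dinf : forall s : seq K, exists2 x, x \in D & x \notin s.

Lemma poly_vanish (p : {poly K}) :
  (forall t, t \in D -> horner p t = 0) -> p = 0.
Proof.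
move=> p0; apply/eqP; apply: contraT => pn0.
have ex n : exists s : seq K, [/\ size s = n, uniq s & all (root p) s].
  elim: n => [|n [s [ss us rs]]]; first by exists [::].
  have [x xD xs] := Dinf s; exists (x :: s); split => /=.
  - by rewrite ss.
  - by rewrite xs.
  - by rewrite rs andbT; apply/rootP/p0.
have [s [ss us rs]] := ex (size p).
by have := max_poly_roots pn0 rs us; rewrite ss ltnn.
Qed.

Lemma widen_ord_lift n (j : 'I_n) :
  widen_ord (leqnSn n) j = lift ord_max j.
Proof. by apply/val_inj; rewrite /= /bump leqNgt ltn_ord. Qed.

Lemma muni_coef n (p : mpoly n.+1 K) (m : multinom n.+1) :
  mcoeff (Multinom [tuple m (widen_ord (leqnSn n) i) | i < n])
    (muni p)`_(m ord_max) = mcoeff m p.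
Proof.
rewrite muniE coef_sum raddf_sum /= [in RHS](mpolyE p) raddf_sum /=.
apply: eq_bigr => m' _; rewrite coefZ coefXn mcoeffZ mcoeffX.
have [->|mm'] := eqVneq m' m.
  by rewrite !eqxx !mulr1 mcoeffZ mcoeffX eqxx mulr1.
rewrite mulr0; have [mmax|_] := eqVneq; last by rewrite mulr0 mcoeff0.
rewrite mulr1 mcoeffZ mcoeffX; case: eqP => [/mnmP tm|]; last by rewrite mulr0.
case/eqP: mm'; apply/mnmP => i; case: (unliftP ord_max i) => [j ->|-> //].
by rewrite -widen_ord_lift; have := tm j; rewrite !mnmE.
Qed.

(** Fixing all variables but the last in D leaves a polynomial in one variable with infinitely many
    roots; so the coefficients with respect to the last variable, given by [muni], vanish on D and
    the induction applies to them. *)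
Lemma mpoly_vanish n (p : mpoly n K) :
  (forall v, (forall i, v i \in D) -> meval v p = 0) -> p = 0.
Proof.
elim: n p => [|n IH] p p0.
  have [x xD _] := Dinf [::].
  have := p0 (fun=> x) (fun=> xD).
  by rewrite (nvar0_mpolyC p) mevalC => ->; rewrite mpolyC0.
have evE v : meval v p = horner (map_poly (meval (fun i => v (widen_ord (leqnSn n) i))) (muni p)) (v ord_max).
  rewrite mevalE muniE raddf_sum horner_sum; apply: eq_bigr => m _ /=.
  rewrite map_polyZ hornerZ map_polyXn hornerXn /= mevalZ mevalX big_ord_recr /=.
  by rewrite -mulrA; congr (_ * (_ * _)); apply: eq_bigr => i _; rewrite mnmE.
apply/mpolyP => m; rewrite -muni_coef mcoeff0.
suff -> : muni p = 0 by rewrite coef0 mcoeff0.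
apply/polyP => k; rewrite coef0; apply: IH => v vD.
have mp0 : map_poly (meval v) (muni p) = 0.
  apply: poly_vanish => t tD.
  pose v' i := oapp v t (unlift ord_max i).
  have := p0 v'; rewrite evE /v' unlift_none /= => <-.
    congr (horner (map_poly _ _) _); apply/funext => q; apply: meval_eq => i.
    by rewrite widen_ord_lift liftK.
  by move=> i; case: unliftP => [j|] _ /=.
by have := congr1 (fun q : {poly K} => q`_k) mp0; rewrite coef_map coef0.
Qed.

End VanishingPoly.

(** * The invariants are the polynomials in Q and S *)

Section Structure.
Variable R : realType.
Local Notation poly := (Cpolyq R).
Implicit Types (P : poly) (X : qspace R).

Lemma qcoord_qpoint (A : Type) (r : 'rV[A]_dimq) : qcoord (qpoint r) = r.
Proof. by rewrite /qcoord /qpoint /= !vec_mxK hsubmxK. Qed.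

(** The points of q are the real points of C^8, and the real numbers form an infinite subset of
    C. *)
Lemma evalq_eq0 P : (forall X, evalq P X = 0) -> P = 0.
Proof.
move=> P0; apply: (@mpoly_vanish _ (fun z : R[i] => complex.Im z == 0)).
  move=> s; pose M := \sum_(z <- s) `|complex.Re z|.
  exists (1 + M)%:C; first by rewrite unfold_in.
  apply/negP => Ms.
  have : `|1 + M| <= M.
    by rewrite {2}/M (big_rem _ Ms) /= lerDl sumr_ge0.
  by rewrite leNgt ger0_norm ?addr_ge0 ?sumr_ge0 // ltrDr ltr01.
move=> v vR.
have := P0 (qpoint (\row_k complex.Re (v k))).
rewrite /evalq qcoord_qpoint => <-; apply: meval_eq => k; rewrite mxE.
by move: (vR k); rewrite unfold_in; case: (v k) => a b /= /eqP ->.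
Qed.

Lemma evalqM P P' X : evalq (P * P') X = evalq P X * evalq P' X.
Proof. exact: mevalM. Qed.
Lemma evalqD P P' X : evalq (P + P') X = evalq P X + evalq P' X.
Proof. exact: mevalD. Qed.
Lemma evalqB P P' X : evalq (P - P') X = evalq P X - evalq P' X.
Proof. exact: mevalB. Qed.
Lemma evalqZ c P X : evalq (c *: P) X = c * evalq P X.
Proof. exact: mevalZ. Qed.
Lemma evalq_Uvar i j X : evalq (Uvar R i j) X = (X.1 i j)%:C.
Proof. by rewrite /evalq mevalXU /qcoord row_mxEl mxvecE. Qed.
Lemma evalq_Vvar i j X : evalq (Vvar R i j) X = (X.2 i j)%:C.
Proof. by rewrite /evalq mevalXU /qcoord row_mxEr mxvecE. Qed.

Definition qspoly (p : mpoly 2 R[i]) : poly :=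
  comp_mpoly [tuple Qpoly R; Spoly R] p.

Lemma evalq_qspoly p X : evalq (qspoly p) X =
  meval (tnth [tuple (Qfun X)%:C; (Sfun X)%:C]) p.
Proof.
rewrite /evalq /qspoly comp_mpoly_meval; apply: meval_eq => i.
by case: i => [[|[]]] //= ?; [exact: evalq_Qpoly|exact: evalq_Spoly].
Qed.

Definition companion (A : pzRingType) (q s : A) : 'M[A]_2 :=
  \matrix_(i, j) if (i == 0) && (j == 0) then 0 else
    if i == 0 then - s else if j == 0 then 1 else q.

Lemma matrix2P (A : Type) (M N : 'M[A]_2) : M 0 0 = N 0 0 -> M 0 1 = N 0 1 ->
  M 1 0 = N 1 0 -> M 1 1 = N 1 1 -> M = N.
Proof.
move=> h1 h2 h3 h4; apply/matrixP => i j.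
have ord2 (k : 'I_2) : k = 0 \/ k = 1.
  by case: k => [[|[]]] // ?; [left|right]; exact/val_inj.
by case: (ord2 i) (ord2 j) => -> [] ->.
Qed.

Lemma QfunE X : Qfun X = \tr (X.1 *m X.2).
Proof.
by rewrite /Qfun qmx_trace mulrnAr -mulrnAl -mulr_natr mulVf ?pnatr_eq0 ?mul1r.
Qed.
Lemma SfunE X : Sfun X = \det X.1 * \det X.2.
Proof. exact: qmx_det. Qed.

(** A slice for the generic orbits. If the entry (1, 0) of M = UV is nonzero, then e_0 is a cyclic
    vector; N has the columns e_0 and M e_0, so N^-1 M N is the companion matrix of t^2 - Q t + S.
    The choice of B then turns U into 1. *)
Lemma act_companion X : \det X.1 != 0 -> (X.1 *m X.2) 1 0 != 0 ->
  exists A B, [/\ A \in unitmx, B \in unitmx &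
    act A B X = (1%:M, companion (Qfun X) (Sfun X))].
Proof.
move=> dU M10; set M := X.1 *m X.2.
pose N : 'M[R]_2 := \matrix_(i, j) if j == 0 then (i == 0)%:R else M i 0.
have dN : \det N = M 1 0 by rewrite det2E !mxE /= mul1r mulr0 subr0.
have uN : N \in unitmx by rewrite unitmxE dN unitfE.
have uU : X.1 \in unitmx by rewrite unitmxE unitfE.
exists (invmx N), (invmx N *m X.1); split.
- by rewrite unitmx_inv.
- by rewrite unitmx_mul unitmx_inv uN.
rewrite /act /=; congr pair.
  by rewrite mulmxV // unitmx_mul unitmx_inv uN.
rewrite invmxK -mulmxA -mulmxA (mulmxA X.1) -/M.
apply: (canLR (mulKmx uN)).
have -> : Sfun X = \det M by rewrite SfunE det_mulmx.
rewrite QfunE -/M mxtrace2 det2E; clearbody M.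
by apply: matrix2P; rewrite !mulmx2E !mxE /=; ring.
Qed.

(** Restricting P to the slice (1, companion q s), with q and s as variables, gives p; invariance
    carries the equality to all generic points. *)
Lemma invariant_polyP P : invariant_poly P -> exists p, P = qspoly p.
Proof.
move=> invP.
pose W : qspace (mpoly 2 R[i]) :=
  (1%:M, companion (mpolyX _ (mnm1 0)) (mpolyX _ (mnm1 1))).
pose p : mpoly 2 R[i] := comp_mpoly [tuple qcoord W 0 k | k < dimq] P.
exists p; apply/eqP; rewrite -subr_eq0.
(* E is nonzero exactly where [act_companion] applies. So (P - p(Q, S)) E vanishes identically, and
   C[q] is a domain. *)
pose E : poly := det2 (Uvar R) *
  (Uvar R 1 0 * Vvar R 0 0 + Uvar R 1 1 * Vvar R 1 0).
have evE X : evalq E X = (\det X.1 * (X.1 *m X.2) 1 0)%:C.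
  rewrite /E /det2 evalqM evalqB evalqD !evalqM !evalq_Uvar !evalq_Vvar.
  by rewrite det2E mulmx2E !(rmorphM, rmorphD, rmorphN).
have: (P - qspoly p) * E = 0.
  apply: evalq_eq0 => X; rewrite evalqM evE evalqB.
  have [->|dU] := eqVneq (\det X.1) 0; first by rewrite mul0r mulr0.
  have [->|M10] := eqVneq ((X.1 *m X.2) 1 0) 0; first by rewrite !mulr0.
  have [A [B [uA uB AB]]] := act_companion dU M10.
  rewrite -(invP A B uA uB X) AB evalq_qspoly comp_mpoly_meval.
  rewrite [X in X - _](_ : _ = meval (fun i => meval
     (tnth [tuple (Qfun X)%:C; (Sfun X)%:C]) (tnth [tuple qcoord W 0 k | k < dimq] i)) P).
    by rewrite subrr mul0r.
  rewrite /evalq; apply: meval_eq => i; rewrite tnth_mktuple /qcoord.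
  case: (split_ordP i) => k ->; rewrite ?row_mxEl ?row_mxEr.
  - case/mxvec_indexP: k => k l; rewrite !mxvecE !mxE.
    by rewrite rmorph_nat -(rmorph_nat (@mpolyC 2 R[i])) mevalC.
  - case/mxvec_indexP: k => k l; rewrite !mxvecE !mxE.
    case: ifP => _; first by rewrite meval0.
    case: ifP => _; first by rewrite mevalN mevalXU rmorphN.
    by case: ifP => _; rewrite ?meval1 ?mevalXU ?rmorph1.
move/eqP; rewrite mulf_eq0 => /orP[//|/eqP E0].
(* E is not the zero polynomial: its value at (1, companion 0 0) is 1. *)
have := evE (1%:M, companion 0 0); rewrite E0 /evalq meval0 /= det1 mul1r mul1mx.
by rewrite mxE /= => /eqP; rewrite eq_sym oner_eq0.
Qed.

End Structure.

(* Locked: conversion would otherwise unfold the recursive definition. *)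
HB.lock Definition schurQS (R : realType) m n : Cpolyq R :=
  schur2 (Qpoly R) (Spoly R) m n.

(** * The components of Fana and their eigenvalue relations *)

Section FanaPoly.
Variable R : realType.
Variables lambda1 lambda2 : R[i].
Local Notation poly := (Cpolyq R).
Local Notation schurQS := (schurQS R).
Implicit Types (P : poly) (d i : nat).

Definition bcoef (l : R[i]) n : R[i] := l ^+ n / (4 ^+ n * (n`!)%:R ^+ 2).

(** The numerator of Fana is the sum over i, j of b_i(lambda1) b_j(lambda2) (u^i v^j - u^j v^i). The
    terms with i + j = d, divided by u - v, form [fpoly d]; it is 0 for d = 0 and has degree d - 1
    in u and v otherwise. *)
Definition fpoly d : poly :=
  \sum_(i < d.+1) (bcoef lambda1 i * bcoef lambda2 (d - i)) *: schurQS i (d - i).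

(** The denominators of Phi cancel the factors 4 m^2 of [polyop_Qschur] and [polyop_Sschur], leaving
    a factor lambda. *)
Lemma bcoefS l n : bcoef l n.+1 * (4 * n.+1%:R ^+ 2) = l * bcoef l n.
Proof.
have fn : (n`!)%:R != 0 :> R[i] by rewrite pnatr_eq0 -lt0n fact_gt0.
rewrite /bcoef factS natrM !exprS; field.
by rewrite fn nat1r pnatr_eq0 expf_neq0 ?pnatr_eq0.
Qed.

Lemma polyop_Qschur m n : polyop (Qpoly R) (schurQS m n) =
  (4 * m%:R ^+ 2) *: schurQS m.-1 n + (4 * n%:R ^+ 2) *: schurQS m n.-1.
Proof.
rewrite !schurQS.unlock polyop_Qpoly Qpoly_truv Spoly_suv.
rewrite (lapuv_schur2 (@dU_der R) (@dV_der R)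
  (@dUU R) (@dVV R) (@dUV R) (@dVU R)).
by rewrite -!natrX -!natrM !scaler_nat !mulr_natl mulrnDl -!mulrnA !(mulnC 4).
Qed.

Lemma polyop_Sschur m n : polyop (Spoly R) (schurQS m n) =
  ((4 * m%:R ^+ 2) * (4 * n%:R ^+ 2)) *: schurQS m.-1 n.-1.
Proof.
rewrite !schurQS.unlock polyop_Spoly Qpoly_truv Spoly_suv.
rewrite (caycay_schur2 (@dU_der R) (@dV_der R)
  (@dUU R) (@dVV R) (@dUV R) (@dVU R)).
rewrite -!natrX -!natrM !scaler_nat mulr_natl -mulrnA; congr (_ *+ _).
by rewrite mulnACA mulnC.
Qed.

Lemma polyop_QschurZ c m n : polyop (Qpoly R) (c *: schurQS m n) =
  (c * (4 * m%:R ^+ 2)) *: schurQS m.-1 n + (c * (4 * n%:R ^+ 2)) *: schurQS m n.-1.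
Proof. by rewrite polyopZr polyop_Qschur scalerDr !scalerA. Qed.

Lemma polyop_SschurZ c m n : polyop (Spoly R) (c *: schurQS m n) =
  (c * ((4 * m%:R ^+ 2) * (4 * n%:R ^+ 2))) *: schurQS m.-1 n.-1.
Proof. by rewrite polyopZr polyop_Sschur scalerA. Qed.

Lemma polyop_Qfpoly0 : polyop (Qpoly R) (fpoly 0) = 0.
Proof.
rewrite /fpoly big_ord1 polyopZr polyop_Qschur /=.
by rewrite expr0n /= mulr0 !scale0r addr0 scaler0.
Qed.

(** Lowering m and lowering n give two sums. Each loses the end term whose factor is 0^2; after a
    shift of the index the first is lambda1 times, the second lambda2 times [fpoly d]. *)
Lemma polyop_Qfpoly d :
  polyop (Qpoly R) (fpoly d.+1) = (lambda1 + lambda2) *: fpoly d.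
Proof.
rewrite /fpoly polyop_sumr.
under eq_bigr do rewrite polyop_QschurZ.
rewrite big_split scalerDl !scaler_sumr /=; congr (_ + _).
  rewrite big_ord_recl /= expr0n !mulr0 scale0r add0r; apply: eq_bigr => i _.
  rewrite /= subSS scalerA; congr (_ *: _).
  by rewrite mulrAC bcoefS !mulrA.
rewrite big_ord_recr /= subnn expr0n !mulr0 scale0r addr0; apply: eq_bigr => i _.
rewrite scalerA subSn ?leq_ord //=; congr (_ *: _).
by rewrite -mulrA bcoefS mulrCA.
Qed.

Lemma polyop_Sfpoly0 d : (d < 2)%N -> polyop (Spoly R) (fpoly d) = 0.
Proof.
move=> d2; rewrite /fpoly polyop_sumr big1 // => i _.
rewrite polyopZr polyop_Sschur /=.
suff -> : 4 * i%:R ^+ 2 * (4 * (d - i)%:R ^+ 2) = 0 :> R[i].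
  by rewrite scale0r scaler0.
case: i => [[|i] /= id]; first by rewrite expr0n mulr0 mul0r.
have -> : (d - i.+1 = 0)%N by apply/eqP; rewrite subn_eq0 -ltnS (leq_trans d2).
by rewrite expr0n !mulr0.
Qed.

Lemma polyop_Sfpoly d :
  polyop (Spoly R) (fpoly d.+2) = (lambda1 * lambda2) *: fpoly d.
Proof.
rewrite /fpoly polyop_sumr.
under eq_bigr do rewrite polyop_SschurZ.
rewrite big_ord_recl /= expr0n mulr0 mul0r mulr0 scale0r add0r.
rewrite big_ord_recr /= subSS subnn expr0n !mulr0 scale0r addr0 scaler_sumr.
apply: eq_bigr => i _; rewrite /= subSS scalerA subSn ?leq_ord //=; congr (_ *: _).
by rewrite mulrACA !bcoefS mulrACA.
Qed.

Definition fsum N : poly := \sum_(d < N) fpoly d.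

Lemma polyop_Qfsum N :
  polyop (Qpoly R) (fsum N.+1) = (lambda1 + lambda2) *: fsum N.
Proof.
rewrite /fsum polyop_sumr big_ord_recl polyop_Qfpoly0 add0r scaler_sumr.
by apply: eq_bigr => i _; exact: polyop_Qfpoly.
Qed.

Lemma polyop_Sfsum N :
  polyop (Spoly R) (fsum N.+2) = (lambda1 * lambda2) *: fsum N.
Proof.
rewrite /fsum polyop_sumr !big_ord_recl !polyop_Sfpoly0 // !add0r scaler_sumr.
by apply: eq_bigr => i _; exact: polyop_Sfpoly.
Qed.

Variable chi : poly -> R[i].
Hypothesis hchi : is_character chi.
Hypothesis chiQ : chi (Qpoly R) = lambda1 + lambda2.
Hypothesis chiS : chi (Spoly R) = lambda1 * lambda2.

Lemma invariant_Qpoly : invariant_poly (Qpoly R).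
Proof.
move=> A B uA uB X; rewrite !evalq_Qpoly !QfunE /act /=.
by rewrite -!mulmxA mxtrace_mulC -!mulmxA mulVmx // mulmx1 mulKmx // mulmxA.
Qed.
Lemma invariant_Spoly : invariant_poly (Spoly R).
Proof.
move=> A B uA uB X; rewrite !evalq_Spoly !SfunE /act /= !det_mulmx !det_inv.
congr (_ %:C); rewrite !unitmxE in uA uB.
by rewrite mulrACA; move: uA uB; rewrite !unitfE => ??; field; apply/andP.
Qed.
Lemma invariant_polyM P P' :
  invariant_poly P -> invariant_poly P' -> invariant_poly (P * P').
Proof. by move=> iP iP' A B uA uB X; rewrite !evalqM iP ?iP'. Qed.
Lemma invariant_polyZ c P : invariant_poly P -> invariant_poly (c *: P).
Proof. by move=> iP A B uA uB X; rewrite !evalqZ iP. Qed.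
Lemma invariant_poly1 : invariant_poly (1 : poly).
Proof. by move=> A B uA uB X; rewrite /evalq !meval1. Qed.
Lemma invariant_polyX P n : invariant_poly P -> invariant_poly (P ^+ n).
Proof.
move=> iP; elim: n => [|n IH]; first exact: invariant_poly1.
by rewrite exprS; exact: invariant_polyM.
Qed.

Lemma invariant_qspoly p : invariant_poly (qspoly p : poly).
Proof.
move=> A B uA uB X; rewrite !evalq_qspoly; apply: meval_eq => -[[|[]]] //= ?.
  by have := invariant_Qpoly uA uB X; rewrite !evalq_Qpoly.
by have := invariant_Spoly uA uB X; rewrite !evalq_Spoly.
Qed.

Lemma qspolyX (m : multinom 2) : qspoly (mpolyX R[i] m) = Qpoly R ^+ m 0 * Spoly R ^+ m 1.
Proof.
rewrite /qspoly comp_mpolyX big_ord_recl big_ord1; congr (_ * _ ^+ m _).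
exact/val_inj.
Qed.

Lemma chiX P n : invariant_poly P -> chi (P ^+ n) = chi P ^+ n.
Proof.
case: hchi => chi1 _ chiM _ iP.
elim: n => [|n IH]; first by rewrite !expr0.
by rewrite !exprS chiM ?IH //; exact: invariant_polyX.
Qed.

Lemma polyop_QSfsum a b N :
  polyop (Qpoly R ^+ a * Spoly R ^+ b) (fsum (N + (a + b.*2))) =
  (chi (Qpoly R) ^+ a * chi (Spoly R) ^+ b) *: fsum N.
Proof.
rewrite chiQ chiS addnA polyopM.
have -> M : polyop (Spoly R ^+ b) (fsum (M + b.*2)) = (lambda1 * lambda2) ^+ b *: fsum M.
  elim: b => [|b IH]; first by rewrite double0 addn0 expr0 polyop1 scale1r.
  by rewrite exprSr polyopM doubleS !addnS polyop_Sfsum polyopZr IH scalerA -exprS.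
rewrite polyopZr (mulrC (_ ^+ a)) -scalerA; congr (_ *: _).
elim: a => [|a IH]; first by rewrite addn0 expr0 polyop1 scale1r.
by rewrite exprSr polyopM !addnS polyop_Qfsum polyopZr IH scalerA -exprS.
Qed.

(** Here phi stands for integration against a fixed test function. By linearity P is a monomial Q^a
    S^b, and its operator sends the partial sum of length N + a + 2 b to a multiple of the one of
    length N, which has the same limit under phi. *)
Lemma polyop_fsum_cvg (phi : poly -> R[i]) (L : R[i]) :
  (forall c p q, phi (c *: p + q) = c * phi p + phi q) ->
  cvgC (fun N => phi (fsum N)) L -> forall P, invariant_poly P ->
  cvgC (fun N => phi (polyop P (fsum N))) (chi P * L).
Proof.
move=> phiP phiL P /invariant_polyP[p ->] {P}.
have phi0 : phi 0 = 0 by have := phiP (-1) 0 0; rewrite scaler0 addr0 mulN1r addNr.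
have phiZ c q : phi (c *: q) = c * phi q by rewrite -[c *: q]addr0 phiP phi0 addr0.
case: hchi => chi1 chiD chiM chiZ.
elim/mpolyind: p => [|c m p _ _ IH].
  have -> : qspoly 0 = 0 :> poly by exact: comp_mpoly0.
  have -> : chi 0 = 0 by rewrite -(scale0r 1) chiZ ?mul0r //; exact: invariant_poly1.
  rewrite mul0r (_ : (fun N => _) = fun=> 0); first exact: cvgC_cst.
  by apply/funext => N; rewrite polyop0.
have -> : qspoly (c *: mpolyX R[i] m + p) = c *: qspoly (mpolyX R[i] m) + qspoly p.
  by rewrite /qspoly comp_mpolyD comp_mpolyZ.
rewrite chiD ?chiZ; try (by do ?apply: invariant_polyZ; exact: invariant_qspoly).
rewrite mulrDl -mulrA.
rewrite (_ : (fun N => _) = fun N => c * phi (polyop (qspoly (mpolyX R[i] m)) (fsum N)) +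
  phi (polyop (qspoly p) (fsum N))); last first.
  by apply/funext => N; rewrite polyopD polyopZ phiP.
apply: cvgCD => //; apply: cvgCZ.
rewrite qspolyX chiM ?chiX; try (by do ?apply: invariant_polyX;
  first [exact: invariant_Qpoly|exact: invariant_Spoly]).
apply/(@cvgC_shift _ (m 0 + (m 1).*2)).
under eq_fun do rewrite polyop_QSfsum phiZ.
exact: cvgCZ.
Qed.

End FanaPoly.

(** * A norm on polynomials *)

Section PolyNorm.
Variables (R : realType) (n : nat).
Local Notation poly := (mpoly n R[i]).
Local Notation nc := (@ComplexField.Normc.normc R).
Implicit Types (p q : poly) (r : R) (m : multinom n).

(** A weighted l^1 norm. It dominates the values on the polydisc of radius r, is submultiplicative,
    and is the quantity that absolute convergence of a power series bounds. *)
Definition mnorm r p : R := \sum_(m <- msupp p) nc (mcoeff m p) * r ^+ mdeg m.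

Lemma mnormE k r p : (msize p <= k)%N ->
  mnorm r p = \sum_(m : bmultinom n k) nc (mcoeff m p) * r ^+ mdeg m.
Proof.
move=> lepk; set I : subFinType _ := bmultinom n k.
rewrite /mnorm (ssrcomplements.big_mksub I) ?msupp_uniq //=; first last.
  by move=> x /msize_mdeg_lt /leq_trans; apply.
by rewrite big_rmcond //= => j /memN_msupp_eq0 ->; rewrite normc0 mul0r.
Qed.

Lemma mnorm_ge0 r p : 0 <= r -> 0 <= mnorm r p.
Proof.
by move=> r0; apply: sumr_ge0 => m _; rewrite mulr_ge0 ?normc_ge0 ?exprn_ge0.
Qed.

Lemma mnorm_le r s p : 0 <= r -> r <= s -> mnorm r p <= mnorm s p.
Proof.
move=> r0 rs; apply: ler_sum => m _.
by rewrite ler_wpM2l ?normc_ge0 // lerXn2r // nnegrE (le_trans r0).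
Qed.

Lemma mnorm0 r : mnorm r 0 = 0.
Proof. by rewrite /mnorm msupp0 big_nil. Qed.

Lemma mnormD r p q : 0 <= r -> mnorm r (p + q) <= mnorm r p + mnorm r q.
Proof.
move=> r0; pose k := maxn (msize (p + q)) (maxn (msize p) (msize q)).
rewrite !(@mnormE k) ?leq_max ?leqnn ?orbT // -big_split /=.
by apply: ler_sum => m _; rewrite mcoeffD -mulrDl ler_wpM2r ?exprn_ge0 // normcD.
Qed.

Lemma mnorm_sum r (I : Type) (s : seq I) (F : I -> poly) : 0 <= r ->
  mnorm r (\sum_(i <- s) F i) <= \sum_(i <- s) mnorm r (F i).
Proof.
move=> r0; elim: s => [|i s IH]; first by rewrite !big_nil mnorm0.
by rewrite !big_cons (le_trans (mnormD _ _ r0)) // lerD2l.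
Qed.

Lemma mnormZ r c p : mnorm r (c *: p) = nc c * mnorm r p.
Proof.
pose k := maxn (msize (c *: p)) (msize p).
rewrite !(@mnormE k) ?leq_max ?leqnn ?orbT // mulr_sumr.
by apply: eq_bigr => m _; rewrite mcoeffZ normcM mulrA.
Qed.

Lemma mnormN r p : mnorm r (- p) = mnorm r p.
Proof. by rewrite -scaleN1r mnormZ normcN ComplexField.Normc.normc1 mul1r. Qed.

Lemma mnormX r m : mnorm r (mpolyX R[i] m) = r ^+ mdeg m.
Proof.
by rewrite /mnorm msuppX big_seq1 mcoeffX eqxx ComplexField.Normc.normc1 mul1r.
Qed.

Lemma mnorm1 r : mnorm r 1 = 1.
Proof. by rewrite -mpolyX0 mnormX mdeg0 expr0. Qed.

Lemma mnormC r c : mnorm r (mpolyC n c) = nc c.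
Proof. by rewrite -alg_mpolyC mnormZ mnorm1 mulr1. Qed.

Lemma mnormM r p q : 0 <= r -> mnorm r (p * q) <= mnorm r p * mnorm r q.
Proof.
move=> r0; rewrite {1}(mpolyE p) {1}(mpolyE q) mulr_suml.
rewrite (le_trans (mnorm_sum _ _ r0)) // [leRHS]mulr_suml; apply: ler_sum => m _.
rewrite mulr_sumr (le_trans (mnorm_sum _ _ r0)) // [leRHS]mulr_sumr.
apply: ler_sum => m' _.
rewrite -scalerAl -scalerAr -mpolyXD !mnormZ mnormX mdegD exprD le_eqVlt.
by apply/orP; left; apply/eqP; ring.
Qed.

Lemma mnormXn r p k : 0 <= r -> mnorm r (p ^+ k) <= mnorm r p ^+ k.
Proof.
move=> r0; elim: k => [|k IH]; first by rewrite !expr0 mnorm1.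
rewrite !exprS (le_trans (mnormM _ _ r0)) // ler_wpM2l //; exact: mnorm_ge0.
Qed.

Lemma mnorm_prod r (I : Type) (s : seq I) (F : I -> poly) : 0 <= r ->
  mnorm r (\prod_(i <- s) F i) <= \prod_(i <- s) mnorm r (F i).
Proof.
move=> r0; elim: s => [|i s IH]; first by rewrite !big_nil mnorm1.
rewrite !big_cons (le_trans (mnormM _ _ r0)) // ler_wpM2l //; exact: mnorm_ge0.
Qed.

Lemma mmap1_prod_deg (A : comNzRingType) (c : A) m :
  mmap1 (fun _ : 'I_n => c) m = c ^+ mdeg m.
Proof. by rewrite /mmap1 mdegE prodrXr. Qed.

Lemma normc_prod (I : Type) (s : seq I) (F : I -> R[i]) :
  nc (\prod_(i <- s) F i) = \prod_(i <- s) nc (F i).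
Proof. exact: (big_morph _ (@normcM R) (ComplexField.Normc.normc1 R)). Qed.

Lemma normcX z k : nc (z ^+ k) = nc z ^+ k.
Proof.
elim: k => [|k IH]; first by rewrite !expr0 ComplexField.Normc.normc1.
by rewrite !exprS normcM IH.
Qed.

Lemma normc_mmap1 r (v : 'I_n -> R[i]) m : (forall i, nc (v i) <= r) ->
  nc (mmap1 v m) <= r ^+ mdeg m.
Proof.
move=> vr; rewrite -mmap1_prod_deg /mmap1 normc_prod; apply: ler_prod => i _.
rewrite normcX exprn_ge0 ?normc_ge0 // lerXn2r // nnegrE ?normc_ge0 //.
by rewrite (le_trans _ (vr i)) ?normc_ge0.
Qed.

Lemma normc_meval r (v : 'I_n -> R[i]) p : (forall i, nc (v i) <= r) ->
  nc (meval v p) <= mnorm r p.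
Proof.
move=> vr; rewrite /meval /mmap (le_trans (normc_sum _ _)) // ler_sum // => m _.
by rewrite normcM ler_wpM2l ?normc_ge0 // normc_mmap1.
Qed.

Definition mshift (c : 'I_n -> R[i]) p : poly :=
  comp_mpoly [tuple mpolyX R[i] (mnm1 i) + mpolyC n (c i) | i < n] p.

Lemma meval_mshift c p (v : 'I_n -> R[i]) :
  meval v (mshift c p) = meval (fun i => v i + c i) p.
Proof.
rewrite comp_mpoly_meval; apply: meval_eq => i.
by rewrite tnth_mktuple mevalD mevalXU mevalC.
Qed.

Lemma mnorm_mshift r s (c : 'I_n -> R[i]) p : 0 <= r ->
  (forall i, nc (c i) <= s) -> mnorm r (mshift c p) <= mnorm (r + s) p.
Proof.
move=> r0 cs; rewrite /mshift comp_mpolyE (le_trans (mnorm_sum _ _ r0)) //.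
apply: ler_sum => m _; rewrite mnormZ ler_wpM2l ?normc_ge0 //.
rewrite -mmap1_prod_deg /mmap1 (le_trans (mnorm_prod _ _ r0)) //.
apply: ler_prod => i _; rewrite mnorm_ge0 //= (le_trans (mnormXn _ _ r0)) //.
have s0 : 0 <= s by rewrite (le_trans (normc_ge0 (c i))).
rewrite lerXn2r ?nnegrE ?mnorm_ge0 ?addr_ge0 //.
rewrite tnth_mktuple (le_trans (mnormD _ _ r0)) // mnormX mdeg1 expr1 mnormC.
by rewrite lerD2l.
Qed.

Lemma mnorm_deg_le k r p : 0 <= r ->
  \sum_(m : bmultinom n k) nc (mcoeff m p) * r ^+ mdeg m <= mnorm r p.
Proof.
move=> r0; pose K := maxn k (msize p).
rewrite (@mnormE K) ?leq_maxr //.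
pose F m := nc (mcoeff m p) * r ^+ mdeg m.
have F0 m : 0 <= F m by rewrite mulr_ge0 ?normc_ge0 ?exprn_ge0.
have kK : (k <= K)%N by rewrite leq_maxl.
pose w (m : bmultinom n k) : bmultinom n K := BMultinom (leq_trans (bmdeg m) kK).
have winj : injective w by move=> m m' /(congr1 val) /= h; apply/val_inj.
rewrite [leLHS](_ : _ = \sum_(m in [set w m | m : bmultinom n k]) F m); last first.
  by rewrite big_imset //= => ? ? _ _; exact: winj.
rewrite [leRHS](bigID (mem [set w m | m : bmultinom n k])) /= lerDl.
by apply: sumr_ge0 => m _; exact: F0.
Qed.

(** The Cauchy estimate: a derivative is controlled at the price of a larger radius. *)
Lemma mnorm_mderiv r s i p : 0 <= r -> r < s ->
  mnorm r (mderiv i p) <= mnorm s p / (s - r).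
Proof.
move=> r0 rs; rewrite {1}(mpolyE p) linear_sum /= (le_trans (mnorm_sum _ _ r0)) //.
rewrite [leRHS]mulr_suml; apply: ler_sum => m _.
rewrite mderivZ mnormZ -mulrA ler_wpM2l ?normc_ge0 // mderivX mnormZ mnormX.
rewrite ler_pdivlMr ?subr_gt0 //.
have [->|mi0] := eqVneq (m i) 0; first by rewrite normc0 !mul0r exprn_ge0 // (le_trans r0) ?ltW.
have dm : mdeg m = (mdeg (mnm_sub m (mnm1 i))).+1.
  rewrite -[in LHS](@submK _ (mnm1 i) m) ?lep1mP // mdegD mdeg1 addn1 //.
have mim : (m i <= mdeg m)%N by rewrite mdegE (bigD1 i) //= leq_addr.
rewrite dm; set k := mdeg (mnm_sub m (mnm1 i)) in dm *.
have s0 : 0 <= s by rewrite (le_trans r0) ?ltW.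
(* The quotient of s^(k+1) - r^(k+1) by s - r is a sum of k + 1 terms, each at least r^k, and the
   exponent m i is at most k + 1. *)
apply: (@le_trans _ _ (s ^+ k.+1 - r ^+ k.+1)); last by rewrite gerBl exprn_ge0.
rewrite subrXX mulrC ler_wpM2l ?subr_ge0 ?(ltW rs) //.
rewrite (_ : nc (m i)%:R = (m i)%:R); last first.
  by rewrite -(rmorph_nat (real_complex R)) normc_real ger0_norm.
apply: (@le_trans _ _ (\sum_(j < k.+1) r ^+ k)).
  rewrite sumr_const card_ord -[leRHS]mulr_natl ler_wpM2r ?exprn_ge0 // ler_nat -dm //.
apply: ler_sum => j _; rewrite /=.
rewrite -{1}(subnK (leq_ord j)) exprD ler_wpM2r ?exprn_ge0 //.
by rewrite lerXn2r // ?nnegrE // ltW.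
Qed.

End PolyNorm.

(** * Normally convergent series of polynomials *)

Section NormalSeries.
Variable R : realType.
Local Notation nc := (@ComplexField.Normc.normc R).

Lemma bounded_sum_cvg (b : nat -> R) (M : R) : (forall d, 0 <= b d) ->
  (forall N, \sum_(d < N) b d <= M) ->
  exists T : R, (forall N, \sum_(d < N) b d <= T) /\
    (fun N => \sum_(d < N) b d : R^o) @ \oo --> (T : R^o).
Proof.
move=> b0 bM; set B := fun N => _ : R^o.
have Bnd : nondecreasing_seq B.
  apply/nondecreasing_seqP => N; by rewrite /B big_ord_recr /= lerDl.
have Bub : has_ubound (range B) by exists M => _ [N _ <-]; exact: bM.
exists (sup (range B)); split; last exact: nondecreasing_cvgn.
by move=> N; apply: ub_le_sup => //; exists N.
Qed.

Lemma cvg_sub_lim (u : nat -> R^o) (T : R^o) : u @ \oo --> T ->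
  (fun N => T - u N : R^o) @ \oo --> (0 : R^o).
Proof.
move=> uT; have cT : (fun _ : nat => T) @ \oo --> T by exact: cvg_cst.
have -> : (0 : R^o) = T - T by rewrite subrr.
exact: cvgB.
Qed.

Definition limC (u : nat -> R[i]) : R[i] :=
  limn (fun n => complex.Re (u n) : R^o) +i* limn (fun n => complex.Im (u n) : R^o).

Lemma cvgC_lim u z : cvgC u z -> limC u = z.
Proof.
move=> /cvgC_ReIm[uR uI]; rewrite /limC (cvg_lim _ uR) // (cvg_lim _ uI) //.
by case: z {uR uI}.
Qed.

Section MTest.
Variables (b : nat -> R) (T : R) (z : nat -> R[i]).
Hypothesis zb : forall d, nc (z d) <= b d.
Hypothesis bT : forall N, \sum_(d < N) b d <= T.
Hypothesis bcvg : (fun N => \sum_(d < N) b d : R^o) @ \oo --> (T : R^o).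
Local Notation S N := (\sum_(d < N) z d).
Local Notation B N := (\sum_(d < N) b d).

Lemma sum_split_ord (V : zmodType) (f : nat -> V) N k :
  \sum_(d < N + k) f d - \sum_(d < N) f d = \sum_(d < k) f (N + d)%N.
Proof. by rewrite big_split_ord /= addrAC subrr add0r. Qed.

Lemma mtest_dist N k : nc (S (N + k) - S N) <= B (N + k) - B N.
Proof.
rewrite !sum_split_ord (le_trans (normc_sum _ _)) //.
by apply: ler_sum => d _; exact: zb.
Qed.

Lemma mtest_cvg : cvgC (fun N => S N) (limC (fun N => S N)).
Proof.
have real_cvg (f : nat -> R) : (forall d, `|f d| <= b d) ->
    cvgn (fun N => \sum_(d < N) f d : R^o).
  move=> fb.
  have -> : (fun N => \sum_(d < N) f d : R^o) = series f.
    by apply/funext => N; rewrite /series /= big_mkord.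
  apply: normed_cvg; apply: (@series_le_cvg _ _ b) => //.
  - by move=> d /=.
  - by move=> d; exact: (le_trans _ (fb d)).
  - rewrite (_ : series b = fun N => B N : R^o); first by apply/cvg_ex; exists T.
    by apply/funext => N; rewrite /series /= big_mkord.
have hR : cvgn (fun N => complex.Re (S N) : R^o).
  rewrite (_ : (fun N => _) = fun N => \sum_(d < N) complex.Re (z d)).
    by apply: (real_cvg (fun d => complex.Re (z d))) => d; exact: le_trans (normc_Re _) (zb d).
  by apply/funext => N; rewrite raddf_sum.
have hI : cvgn (fun N => complex.Im (S N) : R^o).
  rewrite (_ : (fun N => _) = fun N => \sum_(d < N) complex.Im (z d)).
    by apply: (real_cvg (fun d => complex.Im (z d))) => d; exact: le_trans (normc_Im _) (zb d).
  by apply/funext => N; rewrite raddf_sum.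
by apply/cvgC_ReIm; split.
Qed.

(** The bound depends on the majorants b alone, so the convergence is uniform over all sequences z
    dominated by b. *)
Lemma mtest_rate N : nc (limC (fun N => S N) - S N) <= T - B N.
Proof.
set s := limC _; apply/ler_addgt0Pr => e e0.
have /cvgrPdist_le/(_ e e0)[K _ hK] := mtest_cvg.
pose k := K; have /hK : (K <= N + k)%N by rewrite leq_addl.
rewrite sub0r normrN ger0_norm ?normc_ge0 // => h.
have -> : s - S N = (S (N + k) - S N) - (S (N + k) - s) by ring.
rewrite (le_trans (normcD _ _)) // normcN lerD //.
by rewrite (le_trans (mtest_dist N k)) // lerD2r.
Qed.

End MTest.

Variable n : nat.
Local Notation poly := (mpoly n R[i]).
Implicit Types (p : nat -> poly) (r s : R) (v c : 'I_n -> R[i]).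

Definition nsummable r p := exists M, forall N, \sum_(d < N) mnorm r (p d) <= M.

Definition psum p v : R[i] := limC (fun N => \sum_(d < N) meval v (p d)).

Lemma nsummable_le r s p : 0 <= r -> r <= s -> nsummable s p -> nsummable r p.
Proof.
move=> r0 rs [M hM]; exists M => N; apply: le_trans (hM N).
by apply: ler_sum => d _; exact: mnorm_le.
Qed.

Lemma psum_rate r p : 0 <= r -> nsummable r p ->
  exists e : nat -> R^o, e @ \oo --> (0 : R^o) /\
  forall v, (forall i, nc (v i) <= r) ->
  forall N, nc (psum p v - \sum_(d < N) meval v (p d)) <= e N.
Proof.
move=> r0 [M hM]; have p0 d : 0 <= mnorm r (p d) by exact: mnorm_ge0.
have [T [bT bc]] := bounded_sum_cvg p0 hM.
exists (fun N => T - \sum_(d < N) mnorm r (p d)); split.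
  exact: cvg_sub_lim.
move=> v vr N; apply: (@mtest_rate (fun d => mnorm r (p d)) T (fun d => meval v (p d))) => // d.
exact: normc_meval.
Qed.

Lemma psum_cvg r p v : 0 <= r -> nsummable r p -> (forall i, nc (v i) <= r) ->
  cvgC (fun N => \sum_(d < N) meval v (p d)) (psum p v).
Proof.
move=> r0 sp vr; have [e [e0 he]] := psum_rate r0 sp.
by apply: (cvgC_squeeze _ e0) => N; rewrite -opprB normcN he.
Qed.

Lemma meval_near0 r t v (q : poly) : 0 <= r -> 0 <= t -> t <= 1 ->
  (forall i, nc (v i) <= t * r) -> nc (meval v q - meval (fun=> 0) q) <= t * mnorm r q.
Proof.
move=> r0 t0 t1 vt.
rewrite /meval /mmap -sumrB (le_trans (normc_sum _ _)) // mulr_sumr.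
apply: ler_sum => m _; rewrite /= -mulrBr normcM mulrCA ler_wpM2l ?normc_ge0 //.
rewrite (mmap1_prod_deg (0 : R[i])); have [/eqP m0|m0] := eqVneq (mdeg m) 0%N.
  rewrite mdeg_eq0 in m0; rewrite (eqP m0).
  by rewrite mmap11 mdeg0 !expr0 subrr normc0 mulr1.
rewrite expr0n (negbTE m0) subr0 (le_trans (normc_mmap1 _ vt)) // exprMn.
rewrite ler_wpM2r ?exprn_ge0 // -[leRHS]expr1 ler_wiXn2l //.
by rewrite lt0n.
Qed.

Lemma psum_near0 r p : 0 < r -> nsummable r p -> exists C, forall t v,
  0 <= t -> t <= 1 -> (forall i, nc (v i) <= t * r) ->
  nc (psum p v - psum p (fun=> 0)) <= t * C.
Proof.
move=> r0 sp; have [M hM] := sp; exists M => t v t0 t1 vt.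
have key (q : poly) := meval_near0 q (ltW r0) t0 t1 vt.
apply/ler_addgt0Pr => e e0.
have vr i : nc (v i) <= r.
  by rewrite (le_trans (vt i)) // ler_piMl // ltW.
have zr (i : 'I_n) : nc 0 <= r by rewrite normc0 ltW.
have := cvgCB (psum_cvg (ltW r0) sp vr) (psum_cvg (ltW r0) sp zr).
move=> /cvgrPdist_le/(_ e e0)[K _ /(_ K (leqnn K))].
rewrite sub0r normrN ger0_norm ?normc_ge0 //; set B := psum p v - _.
set A := (X in nc (X - B)) => AB; rewrite -(subKr A B) (le_trans (normcD _ _)) // normcN lerD //.
rewrite /A -sumrB (le_trans (normc_sum _ _)) //.
apply: (@le_trans _ _ (\sum_(d < K) t * mnorm r (p d))); first exact: ler_sum.
by rewrite -mulr_sumr ler_wpM2l.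
Qed.

(** Recentring at c maps norms of radius r + s to norms of radius r ([mnorm_mshift]). The double
    series over the index d and the monomials m is then absolutely summable and may be rearranged
    into a power series around c. *)
Lemma psum_expand r s p c : 0 < r -> 0 <= s -> (forall i, nc (c i) <= s) ->
  nsummable (r + s) p -> exists (a : multinom n -> R[i]) (M : R),
  (forall N, \sum_(m : bmultinom n N) nc (a m) * r ^+ mdeg m <= M) /\
  forall v, (forall i, nc (v i) <= r) ->
    cvgC (fun N => \sum_(m : bmultinom n N) a m * mmap1 v m)
         (psum p (fun i => v i + c i)).
Proof.
move=> r0 s0 cs [M hM]; pose q d := mshift c (p d).
have q0 d : 0 <= mnorm r (q d) by apply: mnorm_ge0; exact: ltW.
have qM N : \sum_(d < N) mnorm r (q d) <= M.
  apply: le_trans (hM N); apply: ler_sum => d _.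
  by apply: mnorm_mshift => //; exact: ltW.
have [T [bT bc]] := bounded_sum_cvg q0 qM.
have rm0 m : 0 < r ^+ mdeg (m : multinom n) by exact: exprn_gt0.
pose S D m := \sum_(d < D) mcoeff m (q d).
have cb m d : nc (mcoeff m (q d) * (r ^+ mdeg m)%:C) <= mnorm r (q d).
  apply: le_trans (mnorm_deg_le (mdeg m).+1 _ (ltW r0)).
  rewrite (bigD1 (BMultinom (ltnSn (mdeg m)))) //= normcM normc_real ger0_norm; last exact/ltW.
  by rewrite lerDl sumr_ge0 // => ? _; rewrite mulr_ge0 ?normc_ge0 // ltW.
(* The coefficients are summed after scaling by r^|m|, because in this form [mnorm r (q d)] is a
   majorant. *)
pose a m := limC (fun D => \sum_(d < D) (mcoeff m (q d) * (r ^+ mdeg m)%:C)) / (r ^+ mdeg m)%:C.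
have am m : a m * (r ^+ mdeg m)%:C = limC (fun D => \sum_(d < D) (mcoeff m (q d) * (r ^+ mdeg m)%:C)).
  by rewrite /a divfK // fmorph_eq0 gt_eqF.
(* This bound must not depend on N. Each limit over d is replaced by the partial sum of length D +
   K; the finitely many errors vanish as K grows, and exchanging the sums bounds the rest by the
   tail of the norms. *)
have tail N D : \sum_(m : bmultinom n N) nc (a m - S D m) * r ^+ mdeg m <=
    T - \sum_(d < D) mnorm r (q d).
  pose z m d := mcoeff m (q d) * (r ^+ mdeg m)%:C.
  pose L m := limC (fun D => \sum_(d < D) z m d).
  rewrite (eq_bigr (fun m : bmultinom n N => nc (L m - \sum_(d < D) z m d))); last first.
    move=> m _; rewrite -mulr_suml /L -am -mulrBl normcM normc_real.
    by rewrite ger0_norm // ltW.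
  pose B D := \sum_(d < D) mnorm r (q d).
  have TB0 : (fun K => #|{: bmultinom n N}|%:R * (T - B (D + K)%N) : R^o) @ \oo --> (0 : R^o).
    rewrite -(mulr0 (#|{: bmultinom n N}|%:R : R^o)); apply: cvgM; first exact: cvg_cst.
    apply: cvg_sub_lim; move: bc; rewrite -(cvg_shiftn D) => bcD.
    by rewrite (_ : (fun _ => _) = fun K => B (K + D)%N : R^o) //;
       apply/funext => K; rewrite addnC.
  apply/ler_addgt0Pr => e e0.
  have /cvgrPdist_le/(_ e e0)[K _ /(_ K (leqnn K))] := TB0.
  rewrite sub0r normrN => /(le_trans (ler_norm _)) => hK.
  apply: (@le_trans _ _ (\sum_(m : bmultinom n N) (nc (\sum_(d < D + K) z m d - \sum_(d < D) z m d) +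
      (T - B (D + K)%N)))).
    apply: ler_sum => m _; rewrite [leRHS]addrC.
    rewrite -(subrKA (\sum_(d < D + K) z m d)) (le_trans (normcD _ _)) // lerD2r.
    by apply: (@mtest_rate (fun d => mnorm r (q d)) T (z m)) => // d; exact: cb.
  rewrite big_split /= sumr_const -[X in _ + X]mulr_natl lerD //.
  apply: (@le_trans _ _ (B (D + K)%N - B D)); last by rewrite lerD2r; exact: bT.
  rewrite [leRHS](_ : _ = \sum_(d < K) mnorm r (q (D + d)%N)); last first.
    exact: (sum_split_ord (fun d => mnorm r (q d))).
  under eq_bigr do rewrite sum_split_ord.
  apply: (@le_trans _ _ (\sum_(m : bmultinom n N) \sum_(d < K) nc (z m (D + d)%N))).
    by apply: ler_sum => m _; exact: normc_sum.
  rewrite exchange_big /=; apply: ler_sum => d _.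
  apply: le_trans (mnorm_deg_le N _ (ltW r0)); apply: ler_sum => m _.
  by rewrite /z normcM normc_real ger0_norm // ltW.
exists a, T; split.
  move=> N; have := tail N 0%N; rewrite big_ord0 subr0; apply: le_trans.
  by apply: ler_sum => m _; rewrite /S big_ord0 subr0.
move=> v vr; apply/cvgrPdist_le => e e0.
have e20 : 0 < e / 2 by rewrite divr_gt0.
have vc i : nc (v i + c i) <= r + s by rewrite (le_trans (normcD _ _)) // lerD.
have rs0 : 0 <= r + s by rewrite addr_ge0 // ltW.
have pc : cvgC (fun D => \sum_(d < D) meval v (q d)) (psum p (fun i => v i + c i)).
  under eq_fun do under eq_bigr do rewrite meval_mshift.
  by apply: psum_cvg vc => //; exists M.
have /cvgrPdist_le/(_ _ e20)[K1 _ hK1] := pc.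
have /cvgrPdist_le/(_ _ e20)[K2 _ hK2] := bc.
pose D := maxn K1 K2.
have {}hK1 := hK1 D (leq_maxl _ _); have {}hK2 := hK2 D (leq_maxr _ _).
rewrite sub0r normrN ger0_norm ?normc_ge0 // in hK1.
move/(le_trans (ler_norm _)): hK2 => hK2.
(* Beyond the degrees of the first D polynomials, the truncation at N contains all their monomials,
   so that it evaluates them exactly. *)
exists (\max_(d < D) msize (q d)) => // N /= ltN.
rewrite sub0r normrN ger0_norm ?normc_ge0 //.
set A := \sum_(m : bmultinom n N) _; set S1 := \sum_(d < D) meval v (q d) in hK1.
have AS : nc (A - S1) <= e / 2.
  have -> : S1 = \sum_(m : bmultinom n N) S D m * mmap1 v m.
    rewrite /S; under [RHS]eq_bigr do rewrite mulr_suml.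
    rewrite exchange_big; apply: eq_bigr => d _; rewrite /meval (@mmapE _ _ _ _ _ _ N) //.
    by apply: leq_trans ltN; exact: (leq_bigmax d).
  rewrite /A -sumrB (le_trans (normc_sum _ _)) // (le_trans _ hK2) // (le_trans _ (tail N D)) //.
  apply: ler_sum => m _; rewrite -mulrBl normcM ler_wpM2l ?normc_ge0 //.
  exact: normc_mmap1.
rewrite -(subrKA S1) (le_trans (normcD _ _)) // (splitr e) lerD //.
Qed.

End NormalSeries.

(** * Analytic functions on q *)

Section AnalyticSeries.
Variable R : realType.
Local Notation poly := (Cpolyq R).
Local Notation nc := (@ComplexField.Normc.normc R).
Implicit Types (X Y : qspace R) (r s : R) (p : nat -> poly).

Lemma eq_cvg_seq (u v : nat -> R^o) (l : R^o) :
  u =1 v -> u @ \oo --> l -> v @ \oo --> l.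
Proof. by move=> /funext ->. Qed.

Definition coordC X : 'I_dimq -> R[i] := fun k => (qcoord X 0 k)%:C.

Lemma qcoordD X Y k : qcoord (X + Y) 0 k = qcoord X 0 k + qcoord Y 0 k.
Proof.
by rewrite /qcoord /= !linearD -add_row_mx mxE.
Qed.
Lemma qcoordZ (c : R) X k : qcoord (c *: X) 0 k = c * qcoord X 0 k.
Proof. by rewrite /qcoord /= !linearZ -scale_row_mx mxE. Qed.
Lemma qcoord0 k : qcoord (0 : qspace R) 0 k = 0.
Proof. by rewrite -(scale0r 0) qcoordZ mul0r. Qed.
Lemma qcoordB X Y k : qcoord (X - Y) 0 k = qcoord X 0 k - qcoord Y 0 k.
Proof. by rewrite qcoordD -scaleN1r qcoordZ mulN1r. Qed.

Lemma mmap1_coordC X m : mmap1 (coordC X) m = (mmap1 (qcoord X 0) m)%:C.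
Proof.
by rewrite /mmap1 rmorph_prod; apply: eq_bigr => k _; rewrite rmorphXn.
Qed.

Lemma psum_analytic p : (forall r, 0 <= r -> nsummable r p) ->
  analytic (fun X => psum p (coordC X)).
Proof.
move=> sp X0.
pose s := \sum_k `|qcoord X0 0 k|.
have s0 : 0 <= s by apply: sumr_ge0.
have cs k : nc (coordC X0 k) <= s.
  by rewrite normc_real /s (bigD1 k) //= lerDl sumr_ge0.
have [a [M [aM ac]]] := psum_expand ltr01 s0 cs (sp (1 + s) (addr_ge0 ler01 s0)).
have key X : (forall k, `|qcoord (X - X0) 0 k| < 1) ->
  cvgC (fun N => \sum_(m : bmultinom dimq N) a m * mmap1 (coordC (X - X0)) m) (psum p (coordC X)).
  move=> X1; rewrite (_ : coordC X = fun i => coordC (X - X0) i + coordC X0 i).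
    by apply: ac => i; rewrite normc_real ltW.
  by apply/funext => k; rewrite /coordC -rmorphD -qcoordD subrK.
have bnd X : (forall k, `|qcoord (X - X0) 0 k| < 1) -> forall m,
  `|mmap1 (qcoord (X - X0) 0) m| <= 1 ^+ mdeg m.
  move=> X1 m; rewrite -normc_real -mmap1_coordC; apply: normc_mmap1 => k.
  by rewrite normc_real ltW.
split.
- exists 1, (fun m => complex.Re (a m)); split=> // X X1; split.
    exists M => N; apply: le_trans (aM N); apply: ler_sum => m _.
    by rewrite normrM ler_pM // ?normc_Re // bnd.
  have [+ _] := (cvgC_ReIm _ _).1 (key X X1); apply: eq_cvg_seq => N; rewrite raddf_sum; apply: eq_bigr => m _.
  by rewrite mmap1_coordC; case: (a m) => x y /=; rewrite mulr0 subr0.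
- exists 1, (fun m => complex.Im (a m)); split=> // X X1; split.
    exists M => N; apply: le_trans (aM N); apply: ler_sum => m _.
    by rewrite normrM ler_pM // ?normc_Im // bnd.
  have [_ +] := (cvgC_ReIm _ _).1 (key X X1); apply: eq_cvg_seq => N; rewrite raddf_sum; apply: eq_bigr => m _.
  by rewrite mmap1_coordC; case: (a m) => x y /=; rewrite mulr0 add0r.
Qed.

Lemma sum_bmultinom_deg (V : nmodType) n (G : multinom n -> V) N :
  \sum_(m : bmultinom n N) G m =
  \sum_(d < N) \sum_(m : bmultinom n d.+1 | mdeg m == d) G m.
Proof.
rewrite (partition_big (fun m : bmultinom n N => Ordinal (bmdeg m)) xpredT) //=.
apply: eq_bigr => d _.
have dN (m : bmultinom n d.+1) : (mdeg m < N)%N.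
  by rewrite (leq_ltn_trans _ (ltn_ord d)) // -ltnS bmdeg.
pose w (m : bmultinom n d.+1) : bmultinom n N := BMultinom (dN m).
pose w' (m : bmultinom n N) : bmultinom n d.+1 := insubd (bm0 : bmultinom n d.+1) (m : multinom n).
rewrite (reindex_onto w w') /=; last first.
  by move=> m /eqP dm; apply/val_inj; rewrite /= val_insubd -dm /= ltnSn.
apply: eq_bigl => m; rewrite -val_eqE /=; case: eqP => //= dm.
by apply/eqP/val_inj; rewrite val_insubd /= bmdeg.
Qed.

Lemma analytic_expand (F : qspace R -> R[i]) X0 : analytic F ->
  exists r p, [/\ 0 < r, nsummable r p, forall d, {in msupp (p d), forall m, mdeg m = d} &
  forall X, (forall k, `|qcoord X 0 k| <= r) -> F (X0 + X) = psum p (coordC X)].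
Proof.
move=> /(_ X0) [[r1 [a1 [r10 h1]]] [r2 [a2 [r20 h2]]]].
pose r := Num.min r1 r2 / 2.
have r0 : 0 < r by rewrite divr_gt0 // lt_min r10.
have rr : r < Num.min r1 r2 by rewrite ltr_pdivrMr // ltr_pMr ?ltr1n // lt_min r10.
have [rr1 rr2] : r < r1 /\ r < r2 by move: rr; rewrite lt_min => /andP[].
pose a m := a1 m +i* a2 m.
pose p d : poly := \sum_(m : bmultinom dimq d.+1 | mdeg m == d) a m *: mpolyX R[i] m.
(* Absolute convergence at this single point, all of whose coordinates are r, bounds the norms
   [mnorm r (p d)]. It lies strictly inside both domains of convergence since r is half the smaller
   radius. *)
pose XR : qspace R := qpoint (const_mx r).
have XRE k : qcoord XR 0 k = r by rewrite /qcoord /XR /= !vec_mxK hsubmxK mxE.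
have XRm m : mmap1 (qcoord XR 0) m = r ^+ mdeg m.
  by rewrite -mmap1_prod_deg /mmap1; apply: eq_bigr => k _; rewrite XRE.
have [[M1 hM1] _] : _ := h1 (X0 + XR) ltac:(by move=> k; rewrite addrAC subrr add0r XRE gtr0_norm).
have [[M2 hM2] _] : _ := h2 (X0 + XR) ltac:(by move=> k; rewrite addrAC subrr add0r XRE gtr0_norm).
have pnorm d : mnorm r (p d) <= \sum_(m : bmultinom dimq d.+1 | mdeg m == d) nc (a m) * r ^+ mdeg m.
  rewrite /p -big_filter (le_trans (mnorm_sum _ _ (ltW r0))) // big_filter.
  by apply: ler_sum => m _; rewrite mnormZ mnormX.
exists r, p; split => //.
- exists (M1 + M2) => N.
  apply: (@le_trans _ _ (\sum_(m : bmultinom dimq N) nc (a m) * r ^+ mdeg m)).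
    rewrite (sum_bmultinom_deg (fun m => nc (a m) * r ^+ mdeg m)).
    by apply: ler_sum => d _; exact: pnorm.
  have := lerD (hM1 N) (hM2 N); apply: le_trans; rewrite -big_split /=.
  apply: ler_sum => m _; rewrite addrAC subrr add0r XRm !normrM.
  rewrite -mulrDl (ger0_norm (exprn_ge0 _ (ltW r0))) ler_wpM2r ?exprn_ge0 ?(ltW r0) //.
  exact: (normc_le_ReIm (a m)).
- move=> d m; rewrite /p -big_filter => /msupp_sum_le /flattenP[s].
  case/mapP=> m'; rewrite filter_predT mem_filter => /andP[/eqP dm' _] ->.
  by move/msuppZ_le; rewrite msuppX inE => /eqP ->.
move=> X Xr; apply/esym/cvgC_lim.
rewrite (_ : (fun N => _) = fun N => \sum_(m : bmultinom dimq N) a m * mmap1 (coordC X) m); last first.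
  apply/funext => N; rewrite (sum_bmultinom_deg (fun m => a m * mmap1 (coordC X) m)).
  apply: eq_bigr => d _.
  rewrite raddf_sum /=; apply: eq_bigr => m _.
  by rewrite mevalZ mevalX.
apply/cvgC_ReIm; split.
- have := h1 (X0 + X) ltac:(by move=> k; rewrite addrAC subrr add0r (le_lt_trans (Xr k))).
  move=> [_]; apply: eq_cvg_seq => N; rewrite raddf_sum.
  apply: eq_bigr => m _; rewrite addrAC subrr add0r mmap1_coordC /=.
  by rewrite mulr0 subr0.
- have := h2 (X0 + X) ltac:(by move=> k; rewrite addrAC subrr add0r (le_lt_trans (Xr k))).
  move=> [_]; apply: eq_cvg_seq => N; rewrite raddf_sum.
  apply: eq_bigr => m _; rewrite addrAC subrr add0r mmap1_coordC /=.
  by rewrite mulr0 add0r.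
Qed.

Lemma mnorm_polydir w r s (q : poly) : 0 <= r -> r < s ->
  mnorm r (polydir w q) <= (\sum_k `|qcoord w 0 k|) / (s - r) * mnorm s q.
Proof.
move=> r0 rs; rewrite (le_trans (mnorm_sum _ _ r0)) // !mulr_suml.
apply: ler_sum => k _; rewrite mnormZ normc_real -mulrA ler_wpM2l //.
by rewrite mulrC mnorm_mderiv.
Qed.

(** Each derivative uses up part of the gap between the radii ([mnorm_mderiv]), so the gap is halved
    at every step. *)
Lemma mnorm_polyderivs ws r s : 0 <= r -> r < s ->
  exists C, 0 <= C /\ forall q : poly, mnorm r (polyderivs ws q) <= C * mnorm s q.
Proof.
elim: ws r s => [|w ws IH] r s r0 rs.
  by exists 1; split=> // q; rewrite mul1r mnorm_le // ltW.
pose t := (r + s) / 2.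
have rt : r < t by rewrite midf_lt.
have ts : t < s by rewrite midf_lt.
have [C [C0 hC]] := IH t s (le_trans r0 (ltW rt)) ts.
exists ((\sum_k `|qcoord w 0 k|) / (t - r) * C); split.
  by rewrite !mulr_ge0 ?sumr_ge0 // invr_ge0 subr_ge0 ltW.
move=> q; rewrite /= (le_trans (mnorm_polydir _ _ r0 rt)) // -[leRHS]mulrA ler_wpM2l //.
by rewrite mulr_ge0 ?sumr_ge0 // invr_ge0 subr_ge0 ltW.
Qed.

Lemma mnorm_polyop P r s : 0 <= r -> r < s ->
  exists C, 0 <= C /\ forall q : poly, mnorm r (polyop P q) <= C * mnorm s q.
Proof.
move=> r0 rs; rewrite /polyop; elim: (msupp P) => [|m ms [C [C0 hC]]].
  by exists 0; split=> // q; rewrite big_nil mnorm0 mul0r.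
have [D [D0 hD]] := mnorm_polyderivs (mono_dirs R m) r0 rs.
exists (nc (mcoeff m P) * D + C); split.
  by rewrite addr_ge0 // mulr_ge0 // normc_ge0.
move=> q; rewrite big_cons (le_trans (mnormD _ _ r0)) // mulrDl lerD //.
by rewrite mnormZ -mulrA ler_wpM2l // normc_ge0.
Qed.

End AnalyticSeries.

(** * The function Fana *)

Section CauchyProduct.
Variable R : realType.
Local Notation nc := (@ComplexField.Normc.normc R).

Lemma triangular_sum (V : nmodType) (f : nat -> nat -> V) N :
  \sum_(d < N) \sum_(i < d.+1) f i (d - i)%N =
  \sum_(i < N) \sum_(j < N | (i + j < N)%N) f i j.
Proof.
case: N => [|N]; first by rewrite !big_ord0.
transitivity (\sum_(d < N.+1) \sum_(i < N.+1 | (i < d.+1)%N) f i (d - i)%N).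
  by apply: eq_bigr => d _; rewrite (big_ord_widen N.+1 (fun i => f i (d - i)%N)) ?ltn_ord.
rewrite (exchange_big_dep xpredT) //=; apply: eq_bigr => i _.
pose h (j : 'I_N.+1) : 'I_N.+1 := inord (i + j).
pose h' (d : 'I_N.+1) : 'I_N.+1 := inord (d - i).
rewrite (reindex_onto h h') /=; last first.
  move=> d; rewrite ltnS => id; rewrite /h /h' inordK ?subnKC ?inord_val //.
  by rewrite (leq_ltn_trans (leq_subr _ _)).
have hE (j : 'I_N.+1) : (i + j < N.+1)%N -> h j = (i + j)%N :> nat by exact: inordK.
have h'E (j : 'I_N.+1) : (i + j < N.+1)%N -> h' (h j) = j.
  by move=> ij; rewrite /h' hE // addKn inord_val.
rewrite (eq_bigl (fun j : 'I_N.+1 => (i + j < N.+1)%N)); last first.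
  move=> j; case: (boolP (i + j < N.+1)%N) => [ij|/negbTE ij].
    by rewrite h'E // hE // ltnS leq_addr eqxx.
  apply/negP => /andP[]; rewrite {1}/h /inord val_insubd ij /=.
  rewrite ltnS leqn0 => /eqP i0 _; move: ij; rewrite i0 add0n ltn_ord //.
by apply: eq_bigr => j ij; rewrite hE // addKn.
Qed.

Lemma tri_le_square (a b : nat -> R) N : (forall i, 0 <= a i) -> (forall i, 0 <= b i) ->
  \sum_(d < N) \sum_(i < d.+1) a i * b (d - i)%N <=
  (\sum_(i < N) a i) * (\sum_(j < N) b j).
Proof.
move=> a0 b0; rewrite (triangular_sum (fun i j => a i * b j)) mulr_suml.
apply: ler_sum => i _; rewrite mulr_sumr [leRHS](bigID (fun j : 'I_N => (i + j < N)%N)) /=.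
by rewrite lerDl sumr_ge0 // => j _; rewrite mulr_ge0.
Qed.

Lemma square_le_tri (a b : nat -> R) N : (forall i, 0 <= a i) -> (forall i, 0 <= b i) ->
  (\sum_(i < N) a i) * (\sum_(j < N) b j) <=
  \sum_(d < N + N) \sum_(i < d.+1) a i * b (d - i)%N.
Proof.
move=> a0 b0; rewrite (triangular_sum (fun i j => a i * b j)) mulr_suml.
rewrite big_split_ord /= -[leLHS]addr0 lerD //; last first.
  by apply: sumr_ge0 => i _; apply: sumr_ge0 => j _; rewrite mulr_ge0.
apply: ler_sum => i _; rewrite mulr_sumr big_split_ord /= -[leLHS]addr0 lerD //.
  rewrite [leRHS](eq_bigl xpredT) // => j.
  by rewrite -addSn leq_add // ltnW.
by apply: sumr_ge0 => j _; rewrite mulr_ge0.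
Qed.

(** For the moduli, triangle(N) <= square(N) <= triangle(2 N), so square minus triangle tends to 0;
    and this difference dominates the corresponding difference for x and y. *)
Lemma cauchy_product (x y : nat -> R[i]) (A B : R) (X Y : R[i]) :
  (forall N, \sum_(i < N) nc (x i) <= A) -> (forall N, \sum_(i < N) nc (y i) <= B) ->
  cvgC (fun N => \sum_(i < N) x i) X -> cvgC (fun N => \sum_(i < N) y i) Y ->
  cvgC (fun N => \sum_(d < N) \sum_(i < d.+1) x i * y (d - i)%N) (X * Y).
Proof.
move=> xA yB cx cy.
pose a i := nc (x i); pose b i := nc (y i).
have a0 i : 0 <= a i by exact: normc_ge0.
have b0 i : 0 <= b i by exact: normc_ge0.
pose c d := \sum_(i < d.+1) a i * b (d - i)%N.
have c0 d : 0 <= c d by apply: sumr_ge0 => i _; rewrite mulr_ge0.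
have cAB N : \sum_(d < N) c d <= A * B.
  by apply: le_trans (tri_le_square N a0 b0) _; apply: ler_pM => //; apply: sumr_ge0.
have [T [cT cc]] := bounded_sum_cvg c0 cAB.
have e0 : (fun N => (\sum_(i < N) a i) * (\sum_(j < N) b j) - \sum_(d < N) c d : R^o) @ \oo --> (0 : R^o).
  apply: (@squeeze_cvgr _ _ _ _ (fun=> 0) (fun N => T - \sum_(d < N) c d : R^o)).
  - near=> N; rewrite subr_ge0 tri_le_square //= lerD2r.
    by apply: le_trans (square_le_tri N a0 b0) _; exact: cT.
  - exact: cvg_cst.
  - exact: cvg_sub_lim.
have := cvgCM cx cy => cxy.
suff d0 : cvgC (fun N => (\sum_(i < N) x i) * (\sum_(j < N) y j) -
    \sum_(d < N) \sum_(i < d.+1) x i * y (d - i)%N) 0.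
  have := cvgCB cxy d0; rewrite subr0.
  by under eq_fun do rewrite subKr.
apply: (cvgC_squeeze _ e0) => N; rewrite subr0.
(* Square minus triangle is the sum over i, j < N with i + j >= N. It is needed both for x, y in C
   and for their moduli in R, hence the general ring. *)
have spl (V : comNzRingType) (f g : nat -> V) :
    (\sum_(i < N) f i) * (\sum_(j < N) g j) - \sum_(d < N) \sum_(i < d.+1) f i * g (d - i)%N =
    \sum_(i < N) \sum_(j < N | ~~ (i + j < N)%N) f i * g j.
  rewrite (triangular_sum (fun i j => f i * g j)) mulr_suml -sumrB.
  apply: eq_bigr => i _; rewrite mulr_sumr.
  by rewrite (bigID (fun j : 'I_N => (i + j < N)%N)) /= addrAC subrr add0r.
rewrite !spl (le_trans (normc_sum _ _)) //; apply: ler_sum => i _.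
rewrite -big_filter (le_trans (normc_sum _ _)) // big_filter.
by apply: ler_sum => j _; rewrite normcM.
Unshelve. all: by end_near. Qed.

End CauchyProduct.

(** * Normal convergence of the series and its value off S0 = 0 *)

Section Fana.
Variable R : realType.
Local Notation nc := (@ComplexField.Normc.normc R).
Variables lambda1 lambda2 : R[i].
Local Notation fpoly := (fpoly lambda1 lambda2).
Local Notation fsum := (fsum lambda1 lambda2).
Implicit Types (X : qspace R) (z : R[i]).

(** Since 4^i i!^2 >= i!, the exponential series at |l| K dominates. *)
Lemma bcoef_sum_bounded l (K : R) : 0 <= K ->
  exists A, forall N, \sum_(i < N) nc (bcoef l i) * K ^+ i <= A.
Proof.
move=> K0; pose x := nc l * K.
have x0 : 0 <= x by rewrite mulr_ge0 ?normc_ge0.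
exists (expR x) => N.
apply: (@le_trans _ _ (\sum_(i < N) exp_coeff x i)).
  apply: ler_sum => i _; rewrite /exp_coeff /= /x exprMn /bcoef normcM normcX.
  rewrite mulrAC ler_wpM2l ?mulr_ge0 ?exprn_ge0 ?normc_ge0 //.
  rewrite -natrX -natrX -natrM -(rmorph_nat (real_complex R)) -fmorphV normc_real.
  rewrite ger0_norm ?invr_ge0 // lef_pV2 ?posrE ?ltr0n ?muln_gt0 ?expn_gt0 ?fact_gt0 //.
  rewrite ler_nat -[leqLHS]mul1n leq_mul ?expn_gt0 //.
  by rewrite leq_pmulr ?expn_gt0 ?fact_gt0.
rewrite -(big_mkord xpredT (exp_coeff x)) /expR.
apply: (nondecreasing_cvgn_le _ (is_cvg_series_exp_coeff x)).
by apply: nondecreasing_series => n _ _; rewrite exp_coeff_ge0.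
Qed.

(** With K = |Q| + |S| + 1, the recursion for [hsym] closes up because (|Q| + |S|) K^(k+1) <=
    K^(k+2); the summand 1 makes the powers of K increasing. *)
Lemma mnorm_schurQS r : 0 <= r -> exists K, 0 <= K /\
  forall m n, mnorm r (schurQS R m n) <= K ^+ (m + n).
Proof.
move=> r0; pose K := mnorm r (Qpoly R) + mnorm r (Spoly R) + 1.
have Q0 : 0 <= mnorm r (Qpoly R) by exact: mnorm_ge0.
have S0 : 0 <= mnorm r (Spoly R) by exact: mnorm_ge0.
have K1 : 1 <= K by rewrite lerDr addr_ge0.
have K0 : 0 <= K by exact: le_trans K1.
have hK k : mnorm r (hsym (Qpoly R) (Spoly R) k) <= K ^+ k.
  elim/hsym_ind: k => [||k IH1 IH2].
  - by rewrite mnorm1 expr0.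
  - by rewrite expr1 /K -addrA lerDl addr_ge0.
  - rewrite hsymSS (le_trans (mnormD _ _ r0)) // mnormN.
    apply: (@le_trans _ _ (mnorm r (Qpoly R) * K ^+ k.+1 + mnorm r (Spoly R) * K ^+ k.+1)).
      apply: lerD; rewrite (le_trans (mnormM _ _ r0)) // ler_wpM2l //.
      by rewrite (le_trans IH1) // ler_weXn2l.
    by rewrite -mulrDl [leRHS]exprS ler_wpM2r ?exprn_ge0 // lerDl.
have hS k l : mnorm r (Spoly R ^+ k * hsym (Qpoly R) (Spoly R) l) <= K ^+ (k + l).
  rewrite exprD (le_trans (mnormM _ _ r0)) // ler_pM ?mnorm_ge0 //.
  rewrite (le_trans (mnormXn _ _ r0)) // lerXn2r ?nnegrE //.
  by rewrite /K addrAC lerDr addr_ge0.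
exists K; split=> // m n; rewrite schurQS.unlock /schur2.
case: ifP => nm.
  rewrite (le_trans (hS _ _)) // ler_weXn2l // addnC leq_add2r.
  by rewrite (leq_trans (leq_pred _)) // leq_subr.
case: ifP => mn; last by rewrite mnorm0 exprn_ge0.
rewrite mnormN (le_trans (hS _ _)) // ler_weXn2l // leq_add2l.
by rewrite (leq_trans (leq_pred _)) // leq_subr.
Qed.

Lemma fpoly_nsummable r : 0 <= r -> nsummable r fpoly.
Proof.
move=> r0; have [K [K0 hK]] := mnorm_schurQS r0.
have [A hA] := bcoef_sum_bounded lambda1 K0.
have [B hB] := bcoef_sum_bounded lambda2 K0.
pose a i := nc (bcoef lambda1 i) * K ^+ i; pose b i := nc (bcoef lambda2 i) * K ^+ i.
have a0 i : 0 <= a i by rewrite mulr_ge0 ?normc_ge0 ?exprn_ge0.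
have b0 i : 0 <= b i by rewrite mulr_ge0 ?normc_ge0 ?exprn_ge0.
exists (A * B) => N.
apply: le_trans (_ : (\sum_(i < N) a i) * (\sum_(j < N) b j) <= A * B); last first.
  by apply: ler_pM; [exact: sumr_ge0|exact: sumr_ge0|exact: hA|exact: hB].
apply: le_trans (tri_le_square N a0 b0); apply: ler_sum => d _.
rewrite /fpoly (le_trans (mnorm_sum _ _ r0)) //; apply: ler_sum => i _.
rewrite mnormZ normcM /a /b mulrACA -exprD ler_wpM2l ?mulr_ge0 ?normc_ge0 ?hK //.
Qed.

Definition Fana_fun X : R[i] := psum fpoly (coordC X).

Lemma Fana_analytic : analytic Fana_fun.
Proof. by apply: psum_analytic => r r0; exact: fpoly_nsummable. Qed.

Lemma Phi_cvg l z : cvgC (fun N => \sum_(i < N) bcoef l i * z ^+ i) (Phi l z).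
Proof.
have -> : (fun N => \sum_(i < N) bcoef l i * z ^+ i) = Phi_partial l z.
  apply/funext => N; apply: eq_bigr => i _.
  by rewrite /bcoef exprMn mulrAC.
have [A hA] := bcoef_sum_bounded l (normc_ge0 z).
have b0 i : 0 <= nc (bcoef l i) * nc z ^+ i by rewrite mulr_ge0 ?exprn_ge0 ?normc_ge0.
have [T [bT bc]] := bounded_sum_cvg b0 hA.
apply: (@mtest_cvg _ (fun i => nc (bcoef l i) * nc z ^+ i) T (fun i => (l * z) ^+ i / (4 ^+ i * (i`!)%:R ^+ 2))) => // i.
by rewrite exprMn mulrAC normcM normcX.
Qed.

Lemma ufun_add_vfun X : ufun X + vfun X = (Qfun X)%:C.
Proof. by rewrite /ufun /vfun; field. Qed.

Lemma deltafun_sqr X : deltafun X ^+ 2 = (S0fun X)%:C.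
Proof.
rewrite /deltafun; case: ifP => S0; first by rewrite -rmorphXn sqr_sqrtr.
rewrite expr2; apply/eqP; rewrite eq_complex /= !mul0r mulr0 addr0 sub0r eqxx andbT.
rewrite -expr2 sqr_sqrtr // ltr0_norm ?opprK // ltNge S0 //.
Qed.

Lemma ufun_mul_vfun X : ufun X * vfun X = (Sfun X)%:C.
Proof.
have -> : ufun X * vfun X = ((Qfun X)%:C ^+ 2 - deltafun X ^+ 2) / 4.
  by rewrite /ufun /vfun; field.
by rewrite deltafun_sqr /S0fun; field.
Qed.

Lemma ufun_sub_vfun X : ufun X - vfun X = deltafun X.
Proof. by rewrite /ufun /vfun; field. Qed.

Lemma evalq_schurQS m n X : evalq (schurQS R m n) X =
  schur2 (ufun X + vfun X) (ufun X * vfun X) m n.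
Proof.
rewrite schurQS.unlock ufun_add_vfun ufun_mul_vfun -evalq_Qpoly -evalq_Spoly.
exact: rmorph_schur2.
Qed.

(** After multiplication by u - v, [schur2E] turns the value of [fpoly d] into the difference of the
    d-th terms of the Cauchy products for Phi(u) Phi(v) and Phi(v) Phi(u). *)
Lemma Fana_quotientE X : S0fun X != 0 -> Fana_fun X = Fana_quotient lambda1 lambda2 X.
Proof.
move=> S0; have d0 : ufun X - vfun X != 0.
  apply: contraNneq S0; rewrite ufun_sub_vfun => d0.
  have := deltafun_sqr X; rewrite d0 expr0n /= => /eqP.
  by rewrite eq_sym fmorph_eq0.
apply: (mulIf d0); rewrite /Fana_quotient divfK //.
pose s := \sum_k `|qcoord X 0 k|.
have s0 : 0 <= s by apply: sumr_ge0.
have cs k : nc (coordC X k) <= s.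
  by rewrite normc_real /s (bigD1 k) //= lerDl sumr_ge0.
have := psum_cvg s0 (fpoly_nsummable s0) cs; rewrite -/(Fana_fun X) => /(cvgCZ (ufun X - vfun X)).
rewrite [_ * Fana_fun X]mulrC => FX; apply: (cvgC_unique FX).
have bnd l z : exists A, forall N, \sum_(i < N) nc (bcoef l i * z ^+ i) <= A.
  have [A hA] := bcoef_sum_bounded l (normc_ge0 z); exists A => N.
  by under eq_bigr do rewrite normcM normcX; exact: hA.
have [A1 hA1] := bnd lambda1 (ufun X); have [A2 hA2] := bnd lambda1 (vfun X).
have [B1 hB1] := bnd lambda2 (vfun X); have [B2 hB2] := bnd lambda2 (ufun X).
pose B l z i := bcoef l i * z ^+ i.
have c1 := @cauchy_product _ (B lambda1 (ufun X)) (B lambda2 (vfun X)) _ _ _ _ hA1 hB1 (Phi_cvg _ _) (Phi_cvg _ _).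
have c2 := @cauchy_product _ (B lambda1 (vfun X)) (B lambda2 (ufun X)) _ _ _ _ hA2 hB2 (Phi_cvg _ _) (Phi_cvg _ _).
have := cvgCB c1 c2; congr (cvgC _ _); apply/funext => N.
rewrite -sumrB mulr_sumr; apply: eq_bigr => d _.
rewrite -sumrB /fpoly raddf_sum mulr_sumr; apply: eq_bigr => i _ /=.
rewrite mevalZ (_ : meval _ _ = evalq (schurQS R i (d - i)) X) //.
rewrite evalq_schurQS [RHS]mulrCA schur2E /B.
by ring.
Qed.

End Fana.

(** * Integration on q *)

Section MeasurePreserving.
Local Open Scope ereal_scope.

Definition mpreserving d (T : measurableType d) (R : realType)
    (m : set T -> \bar R) (phi : T -> T) : Prop :=
  measurable_fun setT phi /\ forall A, measurable A -> m (phi @^-1` A) = m A.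

Lemma mpreserving_comp d (T : measurableType d) (R : realType)
    (m : set T -> \bar R) (phi psi : T -> T) :
  mpreserving m phi -> mpreserving m psi -> mpreserving m (phi \o psi).
Proof.
move=> [mphi ephi] [mpsi epsi]; split; first exact: measurableT_comp.
move=> A mA; rewrite comp_preimage epsi ?ephi //.
by rewrite -[X in measurable X]setTI; exact: mphi.
Qed.

Lemma mpreserving_Rintegral d (T : measurableType d) (R : realType)
    (m : {measure set T -> \bar R}) (phi : T -> T) (f : T -> R) :
  mpreserving m phi -> measurable_fun setT f ->
  m.-integrable setT (EFin \o (f \o phi)) ->
  (\int[m]_t f (phi t))%R = (\int[m]_t f t)%R.
Proof.
move=> [mphi ephi] mf intf.
pose mfm := isMeasurableFun.Build _ _ _ _ _ mphi.
pose p : {mfun T >-> T} := HB.pack phi mfm.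
congr fine; transitivity (\int[pushforward m p]_t (f t)%:E); last first.
  by apply: eq_measure_integral => //= A mA _; exact: ephi.
rewrite (integral_pushforward (phi := p)) //; exact/measurable_EFinP.
Qed.

Section Square.
Context d (T : measurableType d) (R : realType).
Variable m : {sigma_finite_measure set T -> \bar R}.

(** The product measure integrates the measures of the sections, and on each section the map is one
    of the [psi x]. For the other variable the order of integration is exchanged by
    [measure_square2E]. *)
Lemma mpreserving_fiber1 (psi : T -> T -> T) :
  measurable_fun setT (fun t : T * T => (t.1, psi t.1 t.2)) ->
  (forall x, mpreserving m (psi x)) ->
  mpreserving (measure_square m) (fun t : T * T => (t.1, psi t.1 t.2)).
Proof.
move=> mpsi psim; split=> // A mA.
apply: eq_integral => x _ /=.
rewrite -((psim x).2 (xsection A x)); last exact: measurable_xsection.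
by congr (m _); apply/seteqP; split=> y; rewrite /xsection /= !inE.
Qed.

Lemma measure_square2E (A : set (T * T)) : measurable A ->
  measure_square m A = (m \x^ m) A.
Proof.
move=> mA; apply: (product_measure_unique (m' := product_measure2 m m)) => // B C mB mC.
by rewrite /= product_measure2E.
Qed.

Lemma mpreserving_fiber2 (psi : T -> T -> T) :
  measurable_fun setT (fun t : T * T => (psi t.2 t.1, t.2)) ->
  (forall x, mpreserving m (psi x)) ->
  mpreserving (measure_square m) (fun t : T * T => (psi t.2 t.1, t.2)).
Proof.
move=> mpsi psim; split=> // A mA.
rewrite !measure_square2E //; last by rewrite -[X in measurable X]setTI; exact: mpsi.
apply: eq_integral => x _ /=.
rewrite -((psim x).2 (ysection A x)); last exact: measurable_ysection.
by congr (m _); apply/seteqP; split=> y; rewrite /ysection /= !inE.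
Qed.

Lemma mpreserving_prod (phi psi : T -> T) :
  mpreserving m phi -> mpreserving m psi ->
  mpreserving (measure_square m) (fun t : T * T => (phi t.1, psi t.2)).
Proof.
move=> hphi hpsi.
have h1 : mpreserving (measure_square m) (fun t : T * T => (t.1, psi t.2)).
  apply: (mpreserving_fiber1 (psi := fun _ => psi)) => //.
  by apply/measurable_fun_pair => //; exact: measurableT_comp hpsi.1 measurable_snd.
have h2 : mpreserving (measure_square m) (fun t : T * T => (phi t.1, t.2)).
  apply: (mpreserving_fiber2 (psi := fun _ => phi)) => //.
  by apply/measurable_fun_pair => //; exact: measurableT_comp hphi.1 measurable_fst.
exact: mpreserving_comp h2 h1.
Qed.

End Square.

Lemma lebesgue_translation (R : realType) (a : R) :
  mpreserving (@lebesgue_measure R) (fun x : measurableTypeR R => (x + a)%R).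
Proof.
have mf : measurable_fun setT (fun x : measurableTypeR R => (x + a)%R : measurableTypeR R).
  by apply: measurable_funD.
split=> // A mA.
pose mfm := isMeasurableFun.Build _ _ _ _ _ mf.
pose f : {mfun measurableTypeR R >-> measurableTypeR R} := HB.pack (fun x : measurableTypeR R => (x + a)%R : measurableTypeR R) mfm.
apply/esym; apply: (lebesgue_measure_unique (mu := pushforward (@lebesgue_measure R) f)) => // _ [[b c]] _ <-.
transitivity (lebesgue_measure (`](b - a)%R, (c - a)%R]%classic : set (measurableTypeR R))).
  by rewrite !lebesgue_measure_itv /= !lte_fin ltrD2r -!EFinB opprB addrA subrK.
congr lebesgue_measure.
by apply/seteqP; split=> x /=; rewrite !in_itv /= ltrBlDr lerBrDr.
Qed.

End MeasurePreserving.

(** * Measurability of continuous functions *)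

Section CountableBasis.

(* i identifies a measurable type with a topological space whose topology has
   a countable basis of measurable sets. *)
Definition measurable_basis d (T : measurableType d) (S : topologicalType)
    (i : T -> S) : Prop :=
  exists B : nat -> set T, (forall n, measurable (B n)) /\
  forall x (V : set S), nbhs (i x) V -> exists n, B n x /\ forall y, B n y -> V (i y).

Lemma measurable_basis_prod d1 (T1 : measurableType d1) (S1 : topologicalType)
    (i1 : T1 -> S1) d2 (T2 : measurableType d2) (S2 : topologicalType) (i2 : T2 -> S2) :
  measurable_basis i1 -> measurable_basis i2 ->
  measurable_basis (fun t : T1 * T2 => (i1 t.1, i2 t.2)).
Proof.
move=> [B1 [mB1 hB1]] [B2 [mB2 hB2]].
pose B (n : nat) := if unpickle n is Some (k, l) then B1 k `*` B2 l else set0.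
exists B; split.
  by move=> n; rewrite /B; case: unpickle => [[k l]|] //; exact: measurableX.
move=> [x1 x2] V [[V1 V2] /= [nV1 nV2] V12].
have [k [Bk1 Bk2]] := hB1 _ _ nV1; have [l [Bl1 Bl2]] := hB2 _ _ nV2.
exists (pickle (k, l)); rewrite /B pickleK; split=> // -[y1 y2] /= [By1 By2].
by apply: V12; split; [exact: Bk2|exact: Bl2].
Qed.

Lemma measurable_basis_comp d (T : measurableType d) (S S' : topologicalType)
    (i : T -> S) (h : S -> S') : continuous h -> measurable_basis i -> measurable_basis (h \o i).
Proof.
move=> ch [B [mB hB]]; exists B; split=> // x V /ch hV.
by have [n [Bx Bn]] := hB _ _ hV; exists n.
Qed.

Lemma measurable_basis_R (R : realType) :
  measurable_basis (fun x : measurableTypeR R => x : R^o).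
Proof.
pose B (n : nat) : set (measurableTypeR R) :=
  if unpickle n is Some (a, b) then `](ratr a : R), (ratr b : R)[%classic else set0.
exists B; split.
  by move=> n; rewrite /B; case: unpickle => [[a b]|].
move=> x V /nbhs_ballP[e /= e0 eV].
have [a _ /andP[xa ax]] : exists2 a : rat, True & x - e < ratr a < x.
  have /(@rat_in_itvoo R)[a] : x - e < x by rewrite gtrBl.
  by rewrite in_itv /= => h; exists a.
have [b _ /andP[xb bx]] : exists2 b : rat, True & x < ratr b < x + e.
  have /(@rat_in_itvoo R)[b] : x < x + e by rewrite ltrDl.
  by rewrite in_itv /= => h; exists b.
exists (pickle (a, b)); rewrite /B pickleK; split=> [|y] /=; rewrite in_itv /=.
  by rewrite ax xb.
move=> /andP[ay yb]; apply: eV; rewrite /ball /= distrC ltr_norml.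
by rewrite ltrBrDl (lt_trans xa ay) ltrBlDl (lt_trans yb bx).
Qed.

(** A set f > a is the union of the basis sets contained in it, a countable union of measurable
    sets. This connects the topology of q with the product sigma-algebra of R^8. *)
Lemma measurable_basis_fun d (T : measurableType d) (S : topologicalType)
    (R : realType) (i : T -> S) (f : S -> R^o) :
  measurable_basis i -> continuous f -> measurable_fun setT (f \o i : T -> R).
Proof.
move=> [B [mB hB]] cf.
apply: (measurability _ (RGenOInfty.measurableE R)) => //= _ [_ [a ->] <-].
rewrite setTI.
rewrite (_ : _ @^-1` _ = \bigcup_(n in [set n | B n `<=` (f \o i) @^-1` `]a, +oo[%classic]) B n).
  by apply: bigcup_measurable => n _; exact: mB.
apply/seteqP; split=> [x /= ax|x [n /= Bn Bnx]]; last exact: Bn.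
have [n [Bx Bn]] : exists n, B n x /\ forall y, B n y -> (f @^-1` `]a, +oo[%classic) (i y).
  apply: hB; apply: cf.
  have : nbhs (f (i x)) [set y : R | a < y].
    apply: open_nbhs_nbhs; split; first exact: open_gt.
    by move: ax; rewrite /= in_itv /= andbT.
  by apply: filterS => y /=; rewrite in_itv /= andbT.
by exists n.
Qed.

End CountableBasis.

Lemma measure_square_fin d (T : measurableType d) (R : realType)
    (m : {sigma_finite_measure set T -> \bar R}) (A : set T) :
  measurable A -> (m A < +oo)%E -> (measure_square m (A `*` A) < +oo)%E.
Proof.
move=> mA fA; rewrite /measure_square product_measure1E //.
by rewrite lte_mul_pinfty // ge0_fin_numE.
Qed.

(** * The identification of R^8 with q *)

Section Coordinates.
Variable R : realType.

Local Notation M1 := (measurableTypeR R).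
Local Notation M4 := ((M1 * M1) * (M1 * M1))%type.
Local Notation M8 := (M4 * M4)%type.

Lemma mx2E (p : (R * R) * (R * R)) :
  [/\ mx2 p 0 0 = p.1.1, mx2 p 0 1 = p.1.2, mx2 p 1 0 = p.2.1 & mx2 p 1 1 = p.2.2].
Proof.
have e0 : 0 = lshift 1 (0 : 'I_1) :> 'I_(1 + 1) by apply/val_inj.
have e1 : 1 = rshift 1 (0 : 'I_1) :> 'I_(1 + 1) by apply/val_inj.
have sc (a : R) : (a%:M : 'M[R]_1) 0 0 = a by rewrite mxE eqxx mulr1n.
rewrite /mx2 e0 e1; split.
- exact: (etrans (block_mxEul _ _ _ _ _ _) (sc _)).
- exact: (etrans (block_mxEur _ _ _ _ _ _) (sc _)).
- exact: (etrans (block_mxEdl _ _ _ _ _ _) (sc _)).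
- exact: (etrans (block_mxEdr _ _ _ _ _ _) (sc _)).
Qed.

Definition coords4 (M : 'M[R]_2) : (R * R) * (R * R) :=
  ((M 0 0, M 0 1), (M 1 0, M 1 1)).

Lemma coords4K : cancel coords4 (@mx2 R).
Proof.
move=> M; have [h1 h2 h3 h4] := mx2E (coords4 M).
by apply: matrix2P; rewrite ?h1 ?h2 ?h3 ?h4.
Qed.

Lemma mx2K : cancel (@mx2 R) coords4.
Proof.
move=> p; have [h1 h2 h3 h4] := mx2E p.
by rewrite /coords4 h1 h2 h3 h4; case: p {h1 h2 h3 h4} => [[a b] [c e]].
Qed.

Lemma mx2D (p q : (R * R) * (R * R)) : mx2 (p + q) = mx2 p + mx2 q.
Proof.
have [h1 h2 h3 h4] := mx2E (p + q).
have [a1 a2 a3 a4] := mx2E p; have [b1 b2 b3 b4] := mx2E q.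
by apply: matrix2P; rewrite [RHS]mxE ?h1 ?h2 ?h3 ?h4 ?a1 ?a2 ?a3 ?a4 ?b1 ?b2 ?b3 ?b4.
Qed.

Lemma ord2P (k : 'I_2) : k = 0 \/ k = 1.
Proof. by case: k => [[|[]]] // ?; [left|right]; exact/val_inj. Qed.

Lemma mx2_continuous : continuous (@mx2 R : _ -> 'M[R]_2).
Proof.
move=> p; apply/cvg_ballP => e e0.
have : nbhs p (ball p e) by exact: nbhsx_ballx.
apply: filterS => q [[q1 q2] [q3 q4]]; split=> // i j.
have [h1 h2 h3 h4] := mx2E p; have [g1 g2 g3 g4] := mx2E q.
by case: (ord2P i) (ord2P j) => -> [] ->; rewrite ?h1 ?h2 ?h3 ?h4 ?g1 ?g2 ?g3 ?g4.
Qed.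

Definition qmap (t : ((R * R) * (R * R)) * ((R * R) * (R * R))) : qspace R :=
  (mx2 t.1, mx2 t.2).

Lemma qmap_continuous : continuous qmap.
Proof.
move=> t; have h1 : {for t, continuous (@mx2 R \o fst)}.
  by apply: continuous_comp; [exact: cvg_fst|exact: mx2_continuous].
have h2 : {for t, continuous (@mx2 R \o snd)}.
  by apply: continuous_comp; [exact: cvg_snd|exact: mx2_continuous].
exact: (cvg_pair h1 h2).
Qed.

Lemma mx2_basis : measurable_basis (@mx2 R : M4 -> 'M[R]_2).
Proof.
have h := measurable_basis_R R.
have h2 := measurable_basis_prod h h.
have h4 := measurable_basis_prod h2 h2.
have := measurable_basis_comp mx2_continuous h4.
by congr (measurable_basis _); apply/funext => -[[a b] [c e]].
Qed.

Lemma qmap_basis : measurable_basis (qmap : M8 -> qspace R).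
Proof. exact: (measurable_basis_prod mx2_basis mx2_basis). Qed.

(** These compact boxes of finite measure exhaust q; supports are located in them throughout, and
    they are also the balls in which power series are evaluated. *)
Definition qbox (r : R) : set (qspace R) := [set X | forall k, `|qcoord X 0 k| <= r].

Lemma qbox_entries r (X : qspace R) : qbox r X <->
  (forall i j, `|X.1 i j| <= r) /\ (forall i j, `|X.2 i j| <= r).
Proof.
split=> [Xr|[X1 X2] k].
  split=> i j.
    by have := Xr (lshift 4 (mxvec_index i j)); rewrite /qcoord row_mxEl mxvecE.
  by have := Xr (rshift 4 (mxvec_index i j)); rewrite /qcoord row_mxEr mxvecE.
case: (split_ordP k) => j ->; rewrite /qcoord ?row_mxEl ?row_mxEr;
  by case/mxvec_indexP: j => i j; rewrite mxvecE.
Qed.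

Definition cube8 (r : R) : set M8 :=
  let c := `[- r, r]%classic in
  ((c `*` c) `*` (c `*` c)) `*` ((c `*` c) `*` (c `*` c)).

Lemma qbox_qmap r t : qbox r (qmap t) <-> cube8 r t.
Proof.
case: t => [[[a b] [c e]] [[a' b'] [c' e']]].
have [h1 h2 h3 h4] := mx2E ((a, b), (c, e)).
have [g1 g2 g3 g4] := mx2E ((a', b'), (c', e')).
rewrite qbox_entries /qmap /cube8 /= !in_itv /= -!ler_norml; split.
  move=> [H G].
  have := (H 0 0, H 0 1, H 1 0, H 1 1); rewrite h1 h2 h3 h4 => -[[[? ?] ?] ?].
  by have := (G 0 0, G 0 1, G 1 0, G 1 1); rewrite g1 g2 g3 g4 => -[[[? ?] ?] ?].
move=> [[[? ?] [? ?]] [[? ?] [? ?]]].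
by split=> i j; case: (ord2P i) (ord2P j) => -> [] ->;
  rewrite ?h1 ?h2 ?h3 ?h4 ?g1 ?g2 ?g3 ?g4.
Qed.

Lemma qmap_surj X : exists t, qmap t = X.
Proof. by exists (coords4 X.1, coords4 X.2); rewrite /qmap /= !coords4K; case: X. Qed.

Lemma qbox_compact r : compact (qbox r).
Proof.
have cc : compact (`[- r, r]%classic : set R^o) by exact: segment_compact.
have c2 := compact_setX cc cc; have c4 := compact_setX c2 c2.
have c8 := compact_setX c4 c4.
rewrite (_ : qbox r = qmap @` cube8 r).
  apply: continuous_compact c8; apply: continuous_subspaceT.
  exact: qmap_continuous.
apply/seteqP; split=> [X Xr|_ [t tr <-]]; last exact/qbox_qmap.
by have [t tX] := qmap_surj X; exists t => //; apply/qbox_qmap; rewrite tX.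
Qed.

Lemma cube8_measurable r : measurable (cube8 r).
Proof. by rewrite /cube8; do ?apply: measurableX. Qed.

Lemma cube8_fin r : (lebesgue8 (cube8 r) < +oo)%E.
Proof.
rewrite /lebesgue8 /cube8.
apply: measure_square_fin; first by do ?apply: measurableX.
apply: measure_square_fin; first by do ?apply: measurableX.
apply: measure_square_fin => //.
suff : (lebesgue_measure (`[(- r)%R, r]%classic : set M1) < +oo)%E by [].
by rewrite lebesgue_measure_itv /=; case: ifP => _; rewrite ?ltry // -EFinB ltry.
Qed.

End Coordinates.

(** * The integral of continuous functions with compact support *)

Section IntegralQ.
Variable R : realType.
Local Notation M1 := (measurableTypeR R).
Local Notation M4 := ((M1 * M1) * (M1 * M1))%type.
Local Notation M8 := (M4 * M4)%type.
Local Notation mu4 := (measure_square (measure_square (@lebesgue_measure R))).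
Local Notation mu := (measure_square mu4).
Implicit Types (X Y : qspace R) (g h : qspace R -> R^o) (r M : R).

Lemma matrix_continuous (S : topologicalType) m n (f : S -> 'M[R]_(m.+1, n.+1)) :
  (forall i j, continuous (fun x => f x i j : R^o)) -> continuous f.
Proof.
move=> fc x; apply/cvg_ballP => e e0.
have : \forall y \near x, forall i j, ball (f x i j : R^o) e (f y i j).
  apply: filter_forall => i; apply: filter_forall => j.
  by have /cvg_ballP/(_ e e0) := fc i j x.
by apply: filterS => y fy; split.
Qed.

Lemma qpair_continuous (S : topologicalType) (f1 f2 : S -> 'M[R]_2) :
  continuous f1 -> continuous f2 -> continuous (fun x => (f1 x, f2 x) : qspace R).
Proof. by move=> c1 c2 x; exact: (cvg_pair (c1 x) (c2 x)). Qed.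

Lemma fst_entry_continuous i j : continuous (fun X => X.1 i j : R^o).
Proof.
move=> X; apply: (@continuous_comp _ _ _ fst (fun M : 'M[R]_2 => M i j : R^o)).
  exact: cvg_fst.
exact: coord_continuous.
Qed.
Lemma snd_entry_continuous i j : continuous (fun X => X.2 i j : R^o).
Proof.
move=> X; apply: (@continuous_comp _ _ _ snd (fun M : 'M[R]_2 => M i j : R^o)).
  exact: cvg_snd.
exact: coord_continuous.
Qed.

Lemma qcoord_continuous k : continuous (fun X => qcoord X 0 k : R^o).
Proof.
case: (split_ordP k) => j ->; case/mxvec_indexP: j => i j X.
  rewrite (_ : (fun X : qspace R => _) = fun X => X.1 i j : R^o).
    exact: fst_entry_continuous.
  by apply/funext => Y; rewrite /qcoord row_mxEl mxvecE.
rewrite (_ : (fun X : qspace R => _) = fun X => X.2 i j : R^o).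
  exact: snd_entry_continuous.
by apply/funext => Y; rewrite /qcoord row_mxEr mxvecE.
Qed.

Definition Cc g : Prop := continuous g /\ exists r, forall X, ~ qbox r X -> g X = 0.

Lemma compact_bound (K : set (qspace R)) g : compact K -> continuous g ->
  exists M, forall X, K X -> `|g X| <= M.
Proof.
move=> cK cg.
have : compact (g @` K) by apply: continuous_compact => //; exact: continuous_subspaceT.
move=> /compact_bounded[M [_ hM]]; exists (M + 1) => X KX.
by apply: (hM (M + 1)); [rewrite ltrDl|exists X].
Qed.

Lemma compact_qbox (K : set (qspace R)) : compact K -> exists r, K `<=` qbox r.
Proof.
move=> cK.
have h k : exists r, forall X, K X -> `|qcoord X 0 k| <= r.
  by apply: compact_bound cK _; exact: qcoord_continuous.
have [f hf] := choice h; exists (\sum_k `|f k|) => X KX k.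
rewrite (le_trans (hf k X KX)) // (le_trans (ler_norm _)) //.
by rewrite (bigD1 k) //= lerDl sumr_ge0.
Qed.

Lemma Cc_bounded g : Cc g -> exists M, forall X, `|g X| <= M.
Proof.
move=> [cg [r hr]]; have [M hM] := compact_bound (@qbox_compact R r) cg.
exists `|M| => X; have [Xr|Xr] := pselect (qbox r X).
  by rewrite (le_trans (hM _ Xr)) // ler_norm.
by rewrite (hr _ Xr) normr0.
Qed.

Lemma CcD g h : Cc g -> Cc h -> Cc (fun X => g X + h X).
Proof.
move=> [cg [r hr]] [ch [s hs]]; split.
  by move=> X; apply: cvgD; [exact: cg|exact: ch].
exists (Num.max r s) => X Xrs.
rewrite hr ?hs ?addr0 // => Xr; apply: Xrs => k.
  by rewrite le_max Xr orbT.
by rewrite le_max Xr.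
Qed.

Lemma Cc_mull g h : continuous h -> Cc g -> Cc (fun X => h X * g X).
Proof.
move=> ch [cg [r hr]]; split; first by move=> X; apply: cvgM; [exact: ch|exact: cg].
by exists r => X Xr; rewrite hr // mulr0.
Qed.

Lemma CcZ (c : R) g : Cc g -> Cc (fun X => c * g X).
Proof. by move=> hg; apply: (@Cc_mull g (fun=> c)) => // X; exact: cvg_cst. Qed.

Lemma Cc_comp g (phi psi : qspace R -> qspace R) : continuous phi -> continuous psi ->
  cancel phi psi -> Cc g -> Cc (g \o phi).
Proof.
move=> cphi cpsi phiK [cg [r hr]]; split.
  by move=> X; apply: continuous_comp; [exact: cphi|exact: cg].
have : compact (psi @` qbox r).
  by apply: continuous_compact (@qbox_compact R r); exact: continuous_subspaceT.
move=> /compact_qbox[s hs]; exists s => X Xs; apply: hr => Xr; apply: Xs.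
by apply: hs; exists (phi X).
Qed.

Definition Iq g : R := (\int[mu]_t g (qmap t))%R.

Lemma Cc_measurable g : continuous g -> measurable_fun setT (g \o @qmap R : M8 -> R).
Proof. exact: measurable_basis_fun (qmap_basis R). Qed.

Lemma Cc_integrable g : Cc g -> mu.-integrable setT (EFin \o (g \o @qmap R : M8 -> R)).
Proof.
move=> hg; have [M hM] := Cc_bounded hg; case: hg => cg [r hr].
rewrite (_ : EFin \o _ = (EFin \o (g \o @qmap R : M8 -> R)) \_ (cube8 r)).
  apply/(integrable_mkcond _ (@cube8_measurable R r)).
  apply: measurable_bounded_integrable.
  - exact: (@cube8_measurable R r).
  - exact: (@cube8_fin R r).
  - exact: measurable_funTS (Cc_measurable cg).
  - exists M; split; first exact: num_real.
    by move=> x Mx t _ /=; rewrite (le_trans (hM _)) // ltW.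
apply/funext => t; rewrite patchE; case: ifPn => // /negP tr.
by rewrite /= hr // => /qbox_qmap tc; apply: tr; rewrite inE.
Qed.

Lemma IqD g h : Cc g -> Cc h -> Iq (fun X => g X + h X) = Iq g + Iq h.
Proof. by move=> hg hh; apply: RintegralD => //; exact: Cc_integrable. Qed.

Lemma IqZ (c : R) g : Cc g -> Iq (fun X => c * g X) = c * Iq g.
Proof. by move=> hg; apply: RintegralZl => //; exact: Cc_integrable. Qed.

Definition cube_vol r : R := fine (mu (cube8 r)).

Lemma Iq_bound g r M : Cc g -> (forall X, ~ qbox r X -> g X = 0) ->
  (forall X, qbox r X -> `|g X| <= M) -> `|Iq g| <= M * cube_vol r.
Proof.
move=> hg gr gM.
have E : Iq g = (\int[mu]_(t in cube8 r) g (qmap t))%R.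
  rewrite [RHS]Rintegral_mkcond; apply: eq_Rintegral => t _.
  rewrite patchE; case: ifPn => // /negP tr.
  by rewrite gr // => /qbox_qmap tc; apply: tr; rewrite inE.
have ig : mu.-integrable (cube8 r) (EFin \o (g \o @qmap R : M8 -> R)).
  apply: integrableS (Cc_integrable hg) => //; exact: cube8_measurable.
have mc := @cube8_measurable R r.
rewrite E (le_trans (le_normr_Rintegral mc ig)) //.
have -> : M * cube_vol r = (\int[mu]_(t in cube8 r) M)%R by rewrite Rintegral_cst.
apply: (le_Rintegral mc).
- have hn : Cc (fun X => `|g X| : R^o).
    case: hg => cg [s hs]; split; last by exists s => X Xs; rewrite hs ?normr0.
    by move=> X; apply: cvg_norm; exact: cg.
  apply: integrableS (Cc_integrable hn) => //; exact: measurableT.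
- apply: measurable_bounded_integrable => //; first exact: (@cube8_fin R r).
  exists `|M|; split; first exact: num_real.
  by move=> x Mx t _ /=; exact: ltW.
- by move=> t tr; apply: gM; exact/qbox_qmap.
Qed.

Lemma Iq_invariant (phi : M8 -> M8) (Phi : qspace R -> qspace R) g :
  mpreserving mu phi -> (forall t, qmap (phi t) = Phi (qmap t)) ->
  Cc g -> Cc (g \o Phi) -> Iq (g \o Phi) = Iq g.
Proof.
move=> hphi phiE hg hgP; have cg : continuous g by case: hg.
rewrite /Iq -(mpreserving_Rintegral hphi (Cc_measurable cg)) //.
  by apply: eq_Rintegral => t _; rewrite /= phiE.
rewrite (_ : _ \o _ = EFin \o ((g \o Phi) \o @qmap R : M8 -> R)).
  exact: Cc_integrable.
by apply/funext => t /=; rewrite phiE.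
Qed.

End IntegralQ.

(** * Invariance of the integral under translations, shears and H *)

Section Invariance.
Variable R : realType.
Local Notation M1 := (measurableTypeR R).
Local Notation M4 := ((M1 * M1) * (M1 * M1))%type.
Local Notation M8 := (M4 * M4)%type.
Local Notation mu4 := (measure_square (measure_square (@lebesgue_measure R))).
Local Notation mu := (measure_square mu4).
Implicit Types (X Y : qspace R) (g : qspace R -> R^o).

Definition trans4 (c p : (R * R) * (R * R)) : (R * R) * (R * R) :=
  ((p.1.1 + c.1.1, p.1.2 + c.1.2), (p.2.1 + c.2.1, p.2.2 + c.2.2)).

Lemma mx2_trans4 c p : mx2 (trans4 c p) = mx2 p + mx2 c :> 'M[R]_2.
Proof. by rewrite -mx2D. Qed.

Lemma trans4_mpreserving c : mpreserving mu4 (trans4 c : M4 -> M4).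
Proof.
have h (a b : R) : mpreserving (measure_square (@lebesgue_measure R))
    (fun p : M1 * M1 => (p.1 + a, p.2 + b) : M1 * M1).
  exact: (mpreserving_prod (lebesgue_translation a) (lebesgue_translation b)).
exact: (mpreserving_prod (h c.1.1 c.1.2) (h c.2.1 c.2.2)).
Qed.

Lemma addw_continuous (w : qspace R) : continuous (fun X => X + w).
Proof. by move=> X; apply: cvgD; [exact: cvg_id|exact: cvg_cst]. Qed.

Lemma Cc_translate w g : Cc g -> Cc (fun X => g (X + w)).
Proof.
move=> hg; apply: (Cc_comp (psi := fun X => X - w)) hg.
- exact: addw_continuous.
- exact: addw_continuous.
- by move=> X; rewrite addrK.
Qed.

Lemma Iq_translate w g : Cc g -> Iq (fun X => g (X + w)) = Iq g.
Proof.
move=> hg.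
pose phi (t : M8) : M8 := (trans4 (coords4 w.1) t.1, trans4 (coords4 w.2) t.2).
have h1 : mpreserving mu phi.
  exact: (mpreserving_prod (m := mu4) (trans4_mpreserving (coords4 w.1)) (trans4_mpreserving (coords4 w.2))).
have h2 t : qmap (phi t) = qmap t + w.
  by rewrite /qmap /phi /= !mx2_trans4 !coords4K.
exact: (Iq_invariant (Phi := fun X => X + w) h1 h2 hg (Cc_translate w hg)).
Qed.

Lemma entry_measurable (h : qspace R -> R^o) : continuous h ->
  measurable_fun setT ((fun t => h (qmap t)) : M8 -> M1).
Proof. exact: Cc_measurable. Qed.

Section Shear.
Variable F : 'M[R]_2 -> 'M[R]_2.
Hypothesis cF : continuous F.

Let cFst : continuous (fun X : qspace R => F X.1).
Proof. by move=> X; apply: (@continuous_comp _ _ _ fst F); [exact: cvg_fst|exact: cF]. Qed.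
Let cFsnd : continuous (fun X : qspace R => F X.2).
Proof. by move=> X; apply: (@continuous_comp _ _ _ snd F); [exact: cvg_snd|exact: cF]. Qed.

Let entry_cont (G : qspace R -> 'M[R]_2) i j : continuous G -> continuous (fun X => G X i j : R^o).
Proof.
move=> cG X; apply: (@continuous_comp _ _ _ G (fun M : 'M[R]_2 => M i j : R^o)).
  exact: cG.
exact: coord_continuous.
Qed.

Lemma measurable_trans4 (G H : qspace R -> 'M[R]_2) : continuous G -> continuous H ->
  measurable_fun setT ((fun t => trans4 (coords4 (G (qmap t))) (coords4 (H (qmap t)))) : M8 -> M4).
Proof.
move=> cG cH.
have h i j : measurable_fun setT ((fun t => H (qmap t) i j + G (qmap t) i j) : M8 -> M1).
  apply: (entry_measurable (h := fun X => H X i j + G X i j : R^o)) => X.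
  by apply: cvgD; apply: entry_cont.
by apply/measurable_fun_pair; apply/measurable_fun_pair; exact: h.
Qed.

Lemma Cc_shear1 g : Cc g -> Cc (fun X => g (X.1 + F X.2, X.2)).
Proof.
apply: (Cc_comp (psi := fun X => (X.1 - F X.2, X.2))).
- apply: qpair_continuous => X; last exact: cvg_snd.
  by apply: cvgD; [exact: cvg_fst|exact: cFsnd].
- apply: qpair_continuous => X; last exact: cvg_snd.
  by apply: cvgB; [exact: cvg_fst|exact: cFsnd].
- by case=> U V; rewrite /= addrK.
Qed.

Lemma Cc_shear2 g : Cc g -> Cc (fun X => g (X.1, X.2 + F X.1)).
Proof.
apply: (Cc_comp (psi := fun X => (X.1, X.2 - F X.1))).
- apply: qpair_continuous => X; first exact: cvg_fst.
  by apply: cvgD; [exact: cvg_snd|exact: cFst].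
- apply: qpair_continuous => X; first exact: cvg_fst.
  by apply: cvgB; [exact: cvg_snd|exact: cFst].
- by case=> U V; rewrite /= addrK.
Qed.

(** For fixed V the shear is the translation of U by F V, so [mpreserving_fiber2] applies to any
    continuous F. *)
Lemma Iq_shear1 g : Cc g -> Iq (fun X => g (X.1 + F X.2, X.2)) = Iq g.
Proof.
move=> hg.
pose psi (v u : M4) : M4 := trans4 (coords4 (F (mx2 v))) u.
pose phi (t : M8) : M8 := (psi t.2 t.1, t.2).
have mpsi : measurable_fun setT ((fun t : M8 => psi t.2 t.1) : M8 -> M4).
  rewrite (_ : (fun t : M8 => _) = fun t => trans4 (coords4 (F (qmap t).2)) (coords4 (qmap t).1)).
    exact: (measurable_trans4 cFsnd (fun X => cvg_fst)).
  by apply/funext => t; rewrite /qmap /= mx2K.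
have mphi : measurable_fun setT phi.
  by apply/measurable_fun_pair => //; exact: measurable_snd.
have h1 : mpreserving mu phi.
  by apply: (mpreserving_fiber2 (m := mu4) mphi) => v; exact: trans4_mpreserving.
have h2 t : qmap (phi t) = ((qmap t).1 + F (qmap t).2, (qmap t).2).
  by rewrite /qmap /phi /psi /= mx2_trans4 coords4K.
exact: (Iq_invariant (Phi := fun X => (X.1 + F X.2, X.2)) h1 h2 hg (Cc_shear1 hg)).
Qed.

Lemma Iq_shear2 g : Cc g -> Iq (fun X => g (X.1, X.2 + F X.1)) = Iq g.
Proof.
move=> hg.
pose psi (u v : M4) : M4 := trans4 (coords4 (F (mx2 u))) v.
pose phi (t : M8) : M8 := (t.1, psi t.1 t.2).
have mpsi : measurable_fun setT ((fun t : M8 => psi t.1 t.2) : M8 -> M4).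
  rewrite (_ : (fun t : M8 => _) = fun t => trans4 (coords4 (F (qmap t).1)) (coords4 (qmap t).2)).
    exact: (measurable_trans4 cFst (fun X => cvg_snd)).
  by apply/funext => t; rewrite /qmap /= mx2K.
have mphi : measurable_fun setT phi.
  by apply/measurable_fun_pair => //; exact: measurable_fst.
have h1 : mpreserving mu phi.
  by apply: (mpreserving_fiber1 (m := mu4) mphi) => v; exact: trans4_mpreserving.
have h2 t : qmap (phi t) = ((qmap t).1, (qmap t).2 + F (qmap t).1).
  by rewrite /qmap /phi /psi /= mx2_trans4 coords4K.
exact: (Iq_invariant (Phi := fun X => (X.1, X.2 + F X.1)) h1 h2 hg (Cc_shear2 hg)).
Qed.

End Shear.

Lemma mx_continuousN (F : 'M[R]_2 -> 'M[R]_2) :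
  continuous F -> continuous (fun x => - F x).
Proof.
by move=> cF x; apply: (continuous_comp (f := F) (g := -%R)); [exact: cF|exact: opp_continuous].
Qed.

(* The matrix identity (0 F; -F^-1 0) = (1 F; 0 1) (1 0; -F^-1 1) (1 F; 0 1). *)
Lemma Iq_rot (F G : 'M[R]_2 -> 'M[R]_2) g : continuous F -> continuous G ->
  (forall x, F (- x) = - F x) -> {morph G : x y / x + y >-> x + y} ->
  cancel F G -> cancel G F -> Cc g ->
  Cc (fun X => g (F X.2, - G X.1)) /\ Iq (fun X => g (F X.2, - G X.1)) = Iq g.
Proof.
move=> cF cG FN GD FK GK hg.
have cNG : continuous (fun x => - G x) by exact: mx_continuousN.
have E : (fun X => g (F X.2, - G X.1)) =
    fun X => (fun Y => (fun Z => g (Z.1 + F Z.2, Z.2)) (Y.1, Y.2 - G Y.1)) (X.1 + F X.2, X.2).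
  apply/funext => -[U V] /=.
  have e : V - G (U + F V) = - G U by rewrite GD FK opprD addrC -addrA addNr addr0.
  by rewrite e FN GK addrC addKr.
have h1 := Cc_shear1 cF hg; have h2 := Cc_shear2 cNG h1.
rewrite E; split; first exact: (Cc_shear1 cF h2).
by rewrite (Iq_shear1 cF h2) (Iq_shear2 cNG h1) (Iq_shear1 cF hg).
Qed.

Lemma trmx_continuous : continuous (fun M : 'M[R]_2 => M^T).
Proof.
apply: matrix_continuous => i j M.
rewrite (_ : (fun M : 'M[R]_2 => _) = fun M : 'M[R]_2 => M j i : R^o).
  exact: coord_continuous.
by apply/funext => N; rewrite mxE.
Qed.

(** The Jacobians of L on U and of L^-1 on V cancel. In terms of shears, the map is the composite of
    two maps of the shape of [Iq_rot], one built from transposition and one from F(V) = - L(V^T). *)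
Lemma Iq_contragredient (L L' : {additive 'M[R]_2 -> 'M[R]_2}) g :
  continuous L -> continuous L' -> cancel L L' -> cancel L' L -> Cc g ->
  Cc (fun X => g (L X.1, (L' X.2^T)^T)) /\ Iq (fun X => g (L X.1, (L' X.2^T)^T)) = Iq g.
Proof.
move=> cL cL' LK LK' hg; have ct := trmx_continuous.
pose F (V : 'M[R]_2) := - L V^T; pose G U := - (L' U)^T.
have cF : continuous F.
  apply: mx_continuousN => V.
  by apply: (continuous_comp (f := trmx) (g := L)); [exact: ct|exact: cL].
have cG : continuous G.
  apply: mx_continuousN => V.
  by apply: (continuous_comp (f := L') (g := trmx)); [exact: cL'|exact: ct].
have [||||h1 h1'] := @Iq_rot F G g cF cG _ _ _ _ hg.
- by move=> x; rewrite /F !raddfN.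
- by move=> x y; rewrite /G !raddfD.
- by move=> x; rewrite /F /G !raddfN /= LK trmxK opprK.
- by move=> x; rewrite /F /G !raddfN /= trmxK LK' opprK.
have [||||h2 h2'] := @Iq_rot trmx trmx (fun X => g (F X.2, - G X.1)) ct ct _ _ _ _ h1.
- by move=> x; rewrite raddfN.
- by move=> x y; rewrite raddfD.
- exact: trmxK.
- exact: trmxK.
have E : (fun X => g (L X.1, (L' X.2^T)^T)) =
    fun X => (fun X => g (F X.2, - G X.1)) (X.2^T, - X.1^T).
  by apply/funext => X; rewrite /F /G /= !raddfN /= trmxK !opprK.
by rewrite E; split; [exact: h2|exact: (etrans h2' h1')].
Qed.

Lemma mulmx_continuous (A : 'M[R]_2) : continuous (mulmx A : 'M[R]_2 -> 'M[R]_2).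
Proof.
apply: matrix_continuous => i j M.
have h k : (fun N : 'M[R]_2 => A i k * N k j : R^o) @ M --> (A i k * M k j : R^o).
  exact: (cvgM (cvg_cst (A i k : R^o)) (@coord_continuous R^o 2 2 k j M)).
rewrite (_ : (fun N : 'M[R]_2 => _) = fun N : 'M[R]_2 => (A i 0 * N 0 j : R^o) + (A i 1 * N 1 j : R^o)).
  by rewrite /continuous_at; exact: (cvgD (h 0) (h 1)).
by apply/funext => N; rewrite mulmx2E.
Qed.

Lemma mulmxr_continuous (A : 'M[R]_2) : continuous (mulmxr A : 'M[R]_2 -> 'M[R]_2).
Proof.
apply: matrix_continuous => i j M.
have h k : (fun N : 'M[R]_2 => N i k * A k j : R^o) @ M --> (M i k * A k j : R^o).
  exact: (cvgM (@coord_continuous R^o 2 2 i k M) (cvg_cst (A k j : R^o))).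
rewrite (_ : (fun N : 'M[R]_2 => _) = fun N : 'M[R]_2 => (N i 0 * A 0 j : R^o) + (N i 1 * A 1 j : R^o)).
  by rewrite /continuous_at; exact: (cvgD (h 0) (h 1)).
by apply/funext => N; rewrite /mulmxr /= mulmx2E.
Qed.

(** [Iq_contragredient] produces (A^-1 V^T)^T, which equals V A^-1 when A is symmetric;
    [symmetrizer] then reaches arbitrary A. *)
Lemma Iq_act_sym1 (A : 'M[R]_2) g : A \in unitmx -> A^T = A -> Cc g ->
  Cc (fun X => g (act A 1%:M X)) /\ Iq (fun X => g (act A 1%:M X)) = Iq g.
Proof.
move=> uA sA hg.
have := Iq_contragredient (L := mulmx A) (L' := mulmx (invmx A)) (@mulmx_continuous A)
  (@mulmx_continuous (invmx A)) (mulKmx uA) (mulKVmx uA) hg.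
rewrite (_ : (fun X => g (act A 1%:M X)) = fun X => g (A *m X.1, (invmx A *m X.2^T)^T)) //.
by apply/funext => X; rewrite /act invmx1 mulmx1 mul1mx trmx_mul trmxK trmx_inv sA.
Qed.

Lemma Iq_act_sym2 (B : 'M[R]_2) g : B \in unitmx -> B^T = B -> Cc g ->
  Cc (fun X => g (act 1%:M B X)) /\ Iq (fun X => g (act 1%:M B X)) = Iq g.
Proof.
move=> uB sB hg.
have := Iq_contragredient (L := mulmxr (invmx B)) (L' := mulmxr B)
  (@mulmxr_continuous _) (@mulmxr_continuous _) (mulmxKV uB) (mulmxK uB) hg.
rewrite (_ : (fun X => g (act 1%:M B X)) = fun X => g (X.1 *m invmx B, (X.2^T *m B)^T)) //.
by apply/funext => X; rewrite /act invmx1 mulmx1 mul1mx trmx_mul trmxK sB.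
Qed.

(* Hence A = (A P) P^-1 is a product of two symmetric matrices. *)
Lemma symmetrizer (A : 'M[R]_2) :
  exists P : 'M[R]_2, [/\ P \in unitmx, P^T = P & (A *m P)^T = A *m P].
Proof.
have [ad|ad] := eqVneq (A 0 0) (A 1 1).
  exists (\matrix_(i, j) (i != j)%:R); split.
  - by rewrite unitmxE det2E !mxE /= mulr0 mulr1 sub0r unitrN1.
  - by apply/matrixP => i j; rewrite !mxE eq_sym.
  - by apply: matrix2P; rewrite ![_^T _ _]mxE !mulmx2E !mxE /= ?mulr0 ?mulr1 ?addr0 ?add0r.
(* With P = (1 y; y -1), the product A P is symmetric if and only if y (A00 - A11) = A01 + A10, and
   det P = - 1 - y^2 is never 0. *)
pose y := (A 0 1 + A 1 0) / (A 0 0 - A 1 1).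
have hy : y * (A 0 0 - A 1 1) = A 0 1 + A 1 0 by rewrite mulfVK // subr_eq0.
exists (\matrix_(i, j) (if i != j then y else (-1) ^+ (i : nat))); split.
- rewrite unitmxE det2E !mxE /= expr0 expr1 unitfE mulrN1 -opprD oppr_eq0.
  by rewrite -expr2 lt0r_neq0 // ltr_pwDl // sqr_ge0.
- by apply/matrixP => i j; rewrite !mxE eq_sym; case: eqVneq => // ->.
- by apply: matrix2P; rewrite ![_^T _ _]mxE !mulmx2E !mxE /= ?expr0 ?expr1 //; lra.
Qed.

Lemma actM (A B A' B' : 'M[R]_2) X : A \in unitmx -> B \in unitmx ->
  A' \in unitmx -> B' \in unitmx ->
  act (A *m A') (B *m B') X = act A B (act A' B' X).
Proof.
have iM (C D : 'M[R]_2) : C \in unitmx -> D \in unitmx -> invmx (C *m D) = invmx D *m invmx C.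
  move=> uC uD; have uCD : C *m D \in unitmx by rewrite unitmx_mul uC.
  have e : C *m D *m (invmx D *m invmx C) = 1%:M.
    by rewrite !mulmxA (mulmxK uD) mulmxV.
  by rewrite -[RHS](mulKmx uCD) e mulmx1.
by move=> uA uB uA' uB'; rewrite /act /= !iM // !mulmxA.
Qed.

Lemma Iq_act (A B : 'M[R]_2) g : A \in unitmx -> B \in unitmx -> Cc g ->
  Cc (fun X => g (act A B X)) /\ Iq (fun X => g (act A B X)) = Iq g.
Proof.
have u1 := unitmx1 R 2.
have fact (C : 'M[R]_2) : C \in unitmx -> exists S S' : 'M[R]_2,
    [/\ C = S *m S', S \in unitmx, S' \in unitmx, S^T = S & S'^T = S'].
  move=> uC; have [P [uP sP sCP]] := symmetrizer C.
  exists (C *m P), (invmx P); rewrite mulmxK // unitmx_mul uC uP unitmx_inv uP.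
  by rewrite trmx_inv sP.
move=> uA uB hg.
have [S [S' [AE uS uS' sS sS']]] := fact A uA.
have [T [T' [BE uT uT' sT sT']]] := fact B uB.
have [c1 e1] := Iq_act_sym1 uS sS hg; have [c2 e2] := Iq_act_sym1 uS' sS' c1.
have [c3 e3] := Iq_act_sym2 uT sT c2; have [c4 e4] := Iq_act_sym2 uT' sT' c3.
have E X : act A B X = act S 1%:M (act S' 1%:M (act 1%:M T (act 1%:M T' X))).
  have a1 : act A B X = act A 1%:M (act 1%:M B X) by rewrite -(actM _ uA u1 u1 uB) mulmx1 mul1mx.
  have a2 Y : act A 1%:M Y = act S 1%:M (act S' 1%:M Y).
    by rewrite -(actM _ uS u1 uS' u1) mulmx1 -AE.
  have a3 : act 1%:M B X = act 1%:M T (act 1%:M T' X).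
    by rewrite -(actM _ u1 uT u1 uT') mulmx1 -BE.
  by rewrite a1 a2 a3.
have -> : (fun X => g (act A B X)) =
    fun X => g (act S 1%:M (act S' 1%:M (act 1%:M T (act 1%:M T' X)))).
  by apply/funext => X; congr g; exact: E.
by split; [exact: c4|exact: (etrans e4 (etrans e3 (etrans e2 e1)))].
Qed.

End Invariance.

(** * Positivity of the integral *)

Section Positivity.
Variable R : realType.
Local Notation M1 := (measurableTypeR R).
Local Notation M4 := ((M1 * M1) * (M1 * M1))%type.
Local Notation M8 := (M4 * M4)%type.
Local Notation mu4 := (measure_square (measure_square (@lebesgue_measure R))).
Local Notation mu := (measure_square mu4).
Implicit Types (X Y : qspace R) (g h : qspace R -> R^o) (r M : R).

Lemma qbox_nbhs X0 r : 0 < r -> \forall X \near X0, qbox r (X - X0).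
Proof.
move=> r0.
have h k : \forall X \near X0, `|qcoord (X - X0) 0 k| <= r.
  have /cvg_ballP/(_ r r0) := @qcoord_continuous R k X0.
  apply: filterS => X; rewrite /ball /= distrC => h; rewrite ltW //.
  by move: h; rewrite qcoordB 2!mxE.
have FF : Filter (nbhs X0) by exact: nbhs_filter.
exact: (@filter_forall _ _ (fun k X => is_true (`|qcoord (X - X0) 0 k| <= r)) (nbhs X0) FF h).
Qed.

Lemma nbhs_qbox X0 (V : set (qspace R)) : nbhs X0 V ->
  exists r, 0 < r /\ forall X, qbox r (X - X0) -> V X.
Proof.
move=> /nbhs_ballP[e /= e0 eV]; exists (e / 2); split=> [|X]; first by rewrite divr_gt0.
have e2 : e / 2 < e by rewrite gtr_pMr // invf_lt1 // ltr1n.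
move=> /qbox_entries[h1 h2]; apply: eV; split; split=> // i j.
  by rewrite /ball /= distrC (le_lt_trans _ e2) //; have := h1 i j; rewrite !mxE.
by rewrite /ball /= distrC (le_lt_trans _ e2) //; have := h2 i j; rewrite !mxE.
Qed.

Lemma Iq_le g h : Cc g -> Cc h -> (forall X, g X <= h X) -> Iq g <= Iq h.
Proof.
by move=> hg hh gh; apply: le_Rintegral => //; exact: Cc_integrable.
Qed.

Lemma Iq_le_norm g h : Cc g -> Cc h -> (forall X, `|g X| <= h X) -> `|Iq g| <= Iq h.
Proof.
move=> hg hh gh; rewrite ler_norml; apply/andP; split; last first.
  by apply: Iq_le => // X; rewrite (le_trans (ler_norm _)).
rewrite lerNl -mulN1r -IqZ //; apply: Iq_le => //; first exact: CcZ.
by move=> X; rewrite mulN1r (le_trans (ler_norm _)) // normrN.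
Qed.

Lemma cube_vol_gt0 r : 0 < r -> 0 < cube_vol r.
Proof.
move=> r0; apply: fine_gt0; apply/andP; split; last exact: (@cube8_fin R r).
have sq d (T : measurableType d) (m : {sigma_finite_measure set T -> \bar R}) (A : set T) :
    measurable A -> (0 < m A)%E -> (0 < measure_square m (A `*` A))%E.
  by move=> mA A0; rewrite /measure_square product_measure1E // mule_gt0.
apply: (sq _ _ mu4); first by do ?apply: measurableX.
apply: (sq); first by do ?apply: measurableX.
apply: (sq) => //.
suff : (0 < lebesgue_measure (`[(- r)%R, r]%classic : set M1))%E by [].
rewrite lebesgue_measure_itv /= lte_fin gtrN // -EFinD lte_fin.
by rewrite opprK addr_gt0.
Qed.

Lemma Iq_gt0_at0 g : Cc g -> (forall X, 0 <= g X) -> 0 < g 0 -> 0 < Iq g.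
Proof.
move=> hg g0 gX; have cg : continuous g by case: hg.
have [r [r0 hr]] : exists r, 0 < r /\ forall X, qbox r (X - 0) -> g 0 / 2 <= g X.
  apply: nbhs_qbox.
  have /cvg_ballP/(_ (g 0 / 2)) := cg 0.
  move=> /(_ (divr_gt0 gX (ltr0Sn _ _))); apply: filterS => X.
  rewrite /ball /= ltr_norml => /andP[_]; lra.
apply: (@lt_le_trans _ _ (g 0 / 2 * cube_vol r)).
  by rewrite mulr_gt0 ?divr_gt0 ?cube_vol_gt0.
have mc := @cube8_measurable R r.
have igc : mu.-integrable (cube8 r) (EFin \o (g \o @qmap R : M8 -> R)).
  apply: integrableS (Cc_integrable hg) => //; exact: measurableT.
rewrite /cube_vol -Rintegral_cst //.
apply: (@le_trans _ _ (\int[mu]_(t in cube8 r) g (qmap t))%R).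
  apply: le_Rintegral => //.
  - apply: measurable_bounded_integrable => //; first exact: (@cube8_fin R r).
    by exists `|g 0 / 2|; split; [exact: num_real|move=> x Mx t _ /=; exact: ltW].
  - move=> t tr; apply: hr; rewrite subr0; exact/qbox_qmap.
rewrite [leLHS]Rintegral_mkcond /Iq; apply: le_Rintegral => //.
- have -> : EFin \o ((fun t => g (qmap t)) \_ (cube8 r)) =
      (EFin \o (g \o @qmap R : M8 -> R)) \_ (cube8 r).
    by apply/funext => t; rewrite /= !patchE; case: ifP.
  exact/(integrable_mkcond _ mc).
- exact: Cc_integrable.
- by move=> t _; rewrite patchE; case: ifP => // _; exact: g0.
Qed.

Lemma Iq_gt0 g X0 : Cc g -> (forall X, 0 <= g X) -> 0 < g X0 -> 0 < Iq g.
Proof.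
move=> hg g0 gX; rewrite -(Iq_translate X0 hg); apply: Iq_gt0_at0.
- exact: Cc_translate.
- by move=> X; exact: g0.
- by rewrite add0r.
Qed.

End Positivity.

(** * Smooth functions *)

Section SmoothFunctions.
Variables (R : realType) (V : normedModType R).
Implicit Types (g h : V -> R^o) (w X : V) (s : seq V).

Definition rderivs s g : V -> R^o := foldr (fun w h X => 'D_w h X) g s.

Definition rsmooth g : Prop := forall s X, differentiable (rderivs s g) X.

Lemma rsmooth_coind (P : (V -> R^o) -> Prop) :
  (forall g, P g -> forall X, differentiable g X) ->
  (forall g w, P g -> P (fun X => 'D_w g X)) ->
  forall g, P g -> rsmooth g.
Proof.
move=> Pd PD g Pg s; apply: Pd.
by elim: s => [//|w s IH] /=; exact: PD.
Qed.

Lemma rsmooth_differentiable g : rsmooth g -> forall X, differentiable g X.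
Proof. by move=> sg; exact: (sg [::]). Qed.

Lemma rsmooth_continuous g : rsmooth g -> continuous g.
Proof. by move=> sg X; apply: differentiable_continuous; exact: rsmooth_differentiable. Qed.

Lemma rderivs_cat s t g : rderivs (s ++ t) g = rderivs s (rderivs t g).
Proof. exact: foldr_cat. Qed.

Lemma rsmooth_derivs s g : rsmooth g -> rsmooth (rderivs s g).
Proof. by move=> sg t X; rewrite -rderivs_cat. Qed.

Lemma rsmooth_derive w g : rsmooth g -> rsmooth (fun X => 'D_w g X).
Proof. exact: (@rsmooth_derivs [:: w]). Qed.

(** The algebra of functions generated by B. If the derivatives of the generators stay in it, then
    all of its members are smooth; sums, products and bump functions are treated uniformly in this
    way. *)
Inductive ralg (B : (V -> R^o) -> Prop) : (V -> R^o) -> Prop :=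
| ralg_base g : B g -> ralg B g
| ralg_cst c : ralg B (fun=> c)
| ralg_add g h : ralg B g -> ralg B h -> ralg B (fun X => g X + h X)
| ralg_mul g h : ralg B g -> ralg B h -> ralg B (fun X => g X * h X).

Lemma deriveD_fun w g h X : differentiable g X -> differentiable h X ->
  'D_w (fun X => g X + h X) X = 'D_w g X + 'D_w h X.
Proof. by move=> dg dh; apply: deriveD; exact: diff_derivable. Qed.

Lemma deriveM_fun w g h X : differentiable g X -> differentiable h X ->
  'D_w (fun X => g X * h X) X = g X * 'D_w h X + h X * 'D_w g X.
Proof. by move=> dg dh; apply: deriveM; exact: diff_derivable. Qed.

Lemma ralg_smooth (B : (V -> R^o) -> Prop) :
  (forall g, B g -> (forall X, differentiable g X) /\
                    forall w, ralg B (fun X => 'D_w g X)) ->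
  forall g, ralg B g -> rsmooth g.
Proof.
move=> hB.
have h g : ralg B g -> (forall X, differentiable g X) /\
                       forall w, ralg B (fun X => 'D_w g X).
  elim=> {g} [g /hB //|c|g h _ [dg Dg] _ [dh Dh]|g h Rg [dg Dg] Rh [dh Dh]].
  - split=> [X|w]; first exact: differentiable_cst.
    rewrite (_ : (fun X => _) = (fun _ : V => 0 : R^o)); first exact: ralg_cst.
    by apply/funext => X; exact: derive_cst.
  - split=> [X|w]; first exact: differentiableD.
    rewrite (_ : (fun X => _) = (fun X => 'D_w g X + 'D_w h X)); first exact: ralg_add.
    by apply/funext => X; exact: deriveD_fun.
  - split=> [X|w]; first exact: differentiableM.
    rewrite (_ : (fun X => _) = (fun X => g X * 'D_w h X + h X * 'D_w g X)).
      by apply: ralg_add; apply: ralg_mul.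
    by apply/funext => X; exact: deriveM_fun.
by apply: rsmooth_coind => g => [/h[]|w /h[_]].
Qed.

Lemma ralg_rsmooth g : ralg rsmooth g -> rsmooth g.
Proof.
apply: ralg_smooth => {}g sg; split; first exact: rsmooth_differentiable.
by move=> w; apply: ralg_base; exact: rsmooth_derive.
Qed.

Lemma rsmooth_cst c : rsmooth (fun=> c).
Proof. by apply: ralg_rsmooth; exact: ralg_cst. Qed.

Lemma rsmoothD g h : rsmooth g -> rsmooth h -> rsmooth (fun X => g X + h X).
Proof. by move=> sg sh; apply: ralg_rsmooth; apply: ralg_add; exact: ralg_base. Qed.

Lemma rsmoothM g h : rsmooth g -> rsmooth h -> rsmooth (fun X => g X * h X).
Proof. by move=> sg sh; apply: ralg_rsmooth; apply: ralg_mul; exact: ralg_base. Qed.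

Lemma rsmoothZ c g : rsmooth g -> rsmooth (fun X => c * g X).
Proof. exact/rsmoothM/rsmooth_cst. Qed.

Lemma rsmooth_prod (I : finType) (g : I -> V -> R^o) :
  (forall i, rsmooth (g i)) -> rsmooth (fun X => \prod_i g i X).
Proof.
move=> sg; elim: (index_enum I) => [|i r IH].
  by under eq_fun => X do rewrite big_nil; exact: rsmooth_cst.
by under eq_fun => X do rewrite big_cons; exact: rsmoothM.
Qed.

Lemma derive_compl (L : {linear V -> V}) w g X :
  'D_w (g \o L) X = 'D_(L w) g (L X).
Proof.
rewrite /derive.
rewrite (_ : (fun e : R => _) = (fun e : R => e^-1 *: (g (e *: L w + L X) - g (L X) : R^o))) //.
by apply/funext => e; rewrite /= linearP.
Qed.

Lemma rsmooth_compl (L : {linear V -> V}) g :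
  continuous L -> rsmooth g -> rsmooth (g \o L).
Proof.
move=> cL sg.
apply: (@rsmooth_coind (fun h => exists2 g, rsmooth g & h = g \o L)); last by exists g.
- move=> _ [h sh ->] X; apply: differentiable_comp; last exact: rsmooth_differentiable.
  exact: linear_differentiable.
- move=> _ w [h sh ->]; exists (fun X => 'D_(L w) h X); first exact: rsmooth_derive.
  by apply/funext => X; rewrite derive_compl.
Qed.

Lemma is_derive_line g w X (t : R) : differentiable g (X + t *: w) ->
  is_derive t 1 (fun t : R => g (X + t *: w) : R) ('D_w g (X + t *: w)).
Proof.
move=> dg; have dgw := @diff_derivable _ _ _ _ _ w dg.
have E : (fun e : R => e^-1 *: (g (X + (e *: (1 : R) + t) *: w) - g (X + t *: w) : R^o)) =
         (fun e : R => e^-1 *: (g (e *: w + (X + t *: w)) - g (X + t *: w) : R^o)).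
  apply/funext => e; congr (_ *: (g _ - _)).
  by rewrite [e *: (1 : R)]mulr1 scalerDl addrCA.
split; first by rewrite /derivable; rewrite /derivable in dgw; rewrite E.
by rewrite /derive E.
Qed.

Lemma mean_value g w X (t : R) : (forall Y, differentiable g Y) -> 0 < t ->
  exists2 c, 0 < c < t & g (X + t *: w) - g X = 'D_w g (X + c *: w) * t.
Proof.
move=> dg t0.
have [||c c0 e] := @MVT R (fun t : R => g (X + t *: w)) (fun t : R => 'D_w g (X + t *: w)) 0 t t0.
- by move=> x _; exact: is_derive_line.
- apply: derivable_within_continuous => x _.
  by have [] := is_derive_line (dg (X + x *: w)).
exists c; first by move: c0; rewrite in_itv.
by move: e; rewrite scale0r addr0 subr0.
Qed.

(** The mean value theorem is applied twice; the bound is uniform in X, as is required for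
    integrating it. *)
Lemma difference_quotient_bound g w M (t : R) : rsmooth g -> 0 < t ->
  (forall X, `|rderivs [:: w; w] g X| <= M) ->
  forall X, `|t^-1 * (g (X + t *: w) - g X) - 'D_w g X| <= M * t.
Proof.
move=> sg t0 hM X.
have [c /andP[c0 ct] ->] := mean_value w X (rsmooth_differentiable sg) t0.
have [b _ e] := mean_value w X (rsmooth_differentiable (rsmooth_derive w sg)) c0.
rewrite mulrCA mulVf ?gt_eqF // mulr1 e normrM (gtr0_norm c0).
by apply: ler_pM; rewrite ?normr_ge0 ?(ltW c0) ?(ltW ct) //; exact: hM.
Qed.

End SmoothFunctions.

(** * The flat function exp(-1/t) and its derivatives *)

Section FlatExponential.
Variable R : realType.
Implicit Types (t : R) (j : nat).

(** The powers of 1/t are included so that the span of the family is stable under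
    differentiation. *)
Definition flatexp j t : R := if 0 < t then t^-1 ^+ j * expR (- t^-1) else 0.

Lemma flatexp_ge0 j t : 0 <= flatexp j t.
Proof. by rewrite /flatexp; case: ifP => // t0; rewrite mulr_ge0 ?expR_ge0 // exprn_ge0 // invr_ge0 ltW. Qed.

Lemma flatexp_gt0 j t : 0 < t -> 0 < flatexp j t.
Proof. by move=> t0; rewrite /flatexp t0 mulr_gt0 ?expR_gt0 // exprn_gt0 // invr_gt0. Qed.

Lemma flatexp_neg j t : t <= 0 -> flatexp j t = 0.
Proof. by rewrite /flatexp leNgt => /negbTE ->. Qed.

(** From s^(j+2) / (j+2)! <= exp(s) at s = 1/t. The exponent 2 makes the derivative at 0 vanish. *)
Lemma flatexp_le j t : flatexp j t <= (j.+2)`!%:R * t ^+ 2.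
Proof.
rewrite /flatexp; case: ifP => t0; last by rewrite mulr_ge0 ?sqr_ge0.
set s := t^-1; have s0 : 0 < s by rewrite invr_gt0.
have f0 : 0 < (j.+2)`!%:R :> R by rewrite ltr0n fact_gt0.
have h : s ^+ j.+2 / (j.+2)`!%:R <= expR s.
  by apply: le_trans (expR_ge1Dxn j.+1 (ltW s0)); rewrite lerDr.
rewrite expRN ler_pdivrMr ?expR_gt0 //.
have -> : s ^+ j = (j.+2)`!%:R * t ^+ 2 * (s ^+ j.+2 / (j.+2)`!%:R).
  move: f0; rewrite /s; move: (_%:R : R) => c c0.
  by rewrite !exprS; field; rewrite !gt_eqF.
by rewrite ler_pM2l // mulr_gt0 ?exprn_gt0.
Qed.

Lemma is_derive_flatexp j t :
  is_derive t 1 (flatexp j : R -> R) (- j%:R * flatexp j.+1 t + flatexp j.+2 t).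
Proof.
have [t0|t0|->] := ltgtP t 0.
- rewrite (flatexp_neg _ (ltW t0)) (flatexp_neg _ (ltW t0)) mulr0 addr0.
  have hc : is_derive t (1 : R) (fun _ : R => 0 : R) 0 by exact: is_derive_cst.
  apply: near_eq_is_derive hc.
  by near=> x; rewrite flatexp_neg // ltW //; near: x; exact: lt_nbhsl.
- have tn0 : t != 0 by rewrite gt_eqF.
  have h1 := is_deriveV tn0 (is_derive_id t 1).
  have h2 := is_deriveX j h1; pose n (y : R) : R := - y^-1.
  have h3 : is_derive t (1 : R) n (- (- t ^- 2)%:A) by exact: is_deriveN h1.
  have h4 := is_derive1_comp (f := @expR R) (g := n) (is_derive_expR (n t)) h3.
  have h5 := is_deriveM h2 h4.
  apply: (near_eq_is_derive (f := (fun y : R => y^-1) ^+ j * (expR \o n))).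
    have : \forall x \near t, 0 < x by exact: lt_nbhsr.
    by apply: filterS => x x0; rewrite /flatexp x0 !fctE.
  apply: is_derive_eq h5 _.
  rewrite /flatexp t0 !fctE /= /n -!exprVn /GRing.scale /=; set s := t^-1.
  case: (j) => [|k]; first by rewrite !exprS expr0; ring.
  by rewrite /= !exprS; ring.
- rewrite !flatexp_neg // mulr0 addr0.
  have hl : (fun h : R => h^-1 *: (flatexp j (h *: (1 : R) + 0) - flatexp j 0 : R^o)) @ 0^' --> (0 : R^o).
    apply/cvgr0Pnorm_le => e e0; near=> h.
    have f0 : 0 < (j.+2)`!%:R :> R by rewrite ltr0n fact_gt0.
    have hn0 : h != 0 by near: h; exact: nbhs_dnbhs_neq.
    rewrite (flatexp_neg j (lexx 0)) subr0 addr0 [h *: (1 : R)]mulr1 normrM.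
    rewrite normfV ler_pdivrMl ?normr_gt0 // ger0_norm ?flatexp_ge0 //.
    rewrite (le_trans (flatexp_le _ _)) // -real_normK ?num_real // expr2 mulrA mulrC.
    rewrite ler_wpM2l // -ler_pdivlMl // mulrC.
    by apply: ltW; near: h; apply: dnbhs0_lt; rewrite divr_gt0.
  by apply: DeriveDef; [exact: cvgP hl|exact: cvg_lim hl].
Unshelve. all: by end_near.
Qed.

Lemma flatexp_differentiable j t : differentiable (flatexp j : R^o -> R^o) t.
Proof. by apply/derivable1_diffP; have [] := is_derive_flatexp j t. Qed.

Lemma derive_flatexp j t (b : R) : 'D_b (flatexp j : R^o -> R^o) t =
  b * (- j%:R * flatexp j.+1 t + flatexp j.+2 t).
Proof.
have d := flatexp_differentiable j t.
have [_ <-] := is_derive_flatexp j t.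
by rewrite !deriveE // -[X in 'd _ _ X]mulr1 linearZ.
Qed.

End FlatExponential.

(** * Test functions *)

Section TestFunctions.
Variable R : realType.
Implicit Types (X Y w : qspace R) (f g : qspace R -> R[i]) (h : qspace R -> R^o) (r : R).

Lemma qcoord_is_linear k : linear (fun X => qcoord X 0 k : R^o).
Proof. by move=> c X Y; rewrite qcoordD qcoordZ. Qed.

Lemma derive_qcoord k w X : 'D_w (fun X => qcoord X 0 k : R^o) X = qcoord w 0 k.
Proof.
pose l : {linear qspace R -> R^o} :=
  HB.pack (fun X => qcoord X 0 k : R^o) (GRing.isLinear.Build _ _ _ _ _ (qcoord_is_linear k)).
have lc : continuous l by exact: qcoord_continuous.
rewrite (deriveE _ (linear_differentiable X lc)).
by rewrite (diff_lin X lc).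
Qed.

Lemma qcoord_differentiable k X : differentiable (fun X => qcoord X 0 k : R^o) X.
Proof.
pose l : {linear qspace R -> R^o} :=
  HB.pack (fun X => qcoord X 0 k : R^o) (GRing.isLinear.Build _ _ _ _ _ (qcoord_is_linear k)).
by apply: (linear_differentiable (f := l)); exact: qcoord_continuous.
Qed.

Lemma rsmooth_qcoord k : rsmooth (fun X => qcoord X 0 k : R^o).
Proof.
pose B h := h = (fun X => qcoord X 0 k : R^o).
apply: (@ralg_smooth R _ B); last exact: ralg_base.
move=> _ ->; split=> [X|w]; first exact: qcoord_differentiable.
have -> : (fun X => 'D_w (fun X => qcoord X 0 k : R^o) X) = (fun _ => qcoord w 0 k : R^o).
  by apply/funext => X; exact: derive_qcoord.
exact: (@ralg_cst R _ B (qcoord w 0 k)).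
Qed.

Definition flatcoord j (a : R) k c : qspace R -> R^o :=
  fun X => flatexp j (a * qcoord X 0 k + c).

Lemma derive_flatcoord j a k c w X : 'D_w (flatcoord j a k c) X =
  a * qcoord w 0 k * (- j%:R * flatcoord j.+1 a k c X + flatcoord j.+2 a k c X).
Proof.
rewrite -[RHS]derive_flatexp /derive.
rewrite (_ : (fun e : R => _) = (fun e : R => e^-1 *: (flatexp j (e * (a * qcoord w 0 k) +
    (a * qcoord X 0 k + c)) - flatexp j (a * qcoord X 0 k + c) : R^o))) //.
apply/funext => e; rewrite /flatcoord /= qcoordD qcoordZ.
by rewrite mulrDr addrA mulrCA.
Qed.

Lemma rsmooth_flatcoord j a k c : rsmooth (flatcoord j a k c).
Proof.
pose B h := exists j, h = flatcoord j a k c.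
apply: (@ralg_smooth R _ B); last by apply: ralg_base; exists j.
move=> _ [i ->]; split=> [X|w].
  apply: (@differentiable_comp R (qspace R) R^o R^o (fun X => a * qcoord X 0 k + c : R^o) (flatexp i)).
    apply: differentiableD; last exact: differentiable_cst.
    by apply: differentiableM; [exact: differentiable_cst|exact: qcoord_differentiable].
  exact: flatexp_differentiable.
rewrite (_ : (fun X => _) = (fun X => (a * qcoord w 0 k) *
    (- i%:R * flatcoord i.+1 a k c X + flatcoord i.+2 a k c X))); last first.
  by apply/funext => X; exact: derive_flatcoord.
apply: ralg_mul; first exact: ralg_cst.
apply: ralg_add; last by apply: ralg_base; exists i.+2.
by apply: ralg_mul; [exact: ralg_cst|apply: ralg_base; exists i.+1].
Qed.

(** The two factors for the coordinate k are both positive exactly when |x_k - x0_k| < r. *)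
Definition qbump X0 r : qspace R -> R^o := fun X =>
  \prod_k (flatcoord 0 1 k (r - qcoord X0 0 k) X * flatcoord 0 (-1) k (r + qcoord X0 0 k) X).

Lemma rsmooth_qbump X0 r : rsmooth (qbump X0 r).
Proof. by apply: rsmooth_prod => k; apply: rsmoothM; exact: rsmooth_flatcoord. Qed.

Lemma qbump_ge0 X0 r X : 0 <= qbump X0 r X.
Proof. by apply: prodr_ge0 => k _; rewrite mulr_ge0 // flatexp_ge0. Qed.

Lemma qbump_gt0 X0 r : 0 < r -> 0 < qbump X0 r X0.
Proof.
move=> r0; apply: prodr_gt0 => k _; rewrite mulr_gt0 //; apply: flatexp_gt0; lra.
Qed.

Lemma qbump_out X0 r X : ~ qbox r (X - X0) -> qbump X0 r X = 0.
Proof.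
move=> hX; apply/eqP; rewrite prodf_seq_eq0; apply/hasP.
have [k hk] : exists k, r < `|qcoord (X - X0) 0 k|.
  apply: contrapT => h; apply: hX => k; rewrite leNgt; apply/negP => hk.
  by apply: h; exists k.
exists k; rewrite ?mem_index_enum //= mulf_eq0; apply/orP.
move: hk; rewrite qcoordB; case: (lerP 0 (qcoord X 0 k - qcoord X0 0 k)) => s.
  by rewrite ger0_norm // => hk; right; apply/eqP; apply: flatexp_neg; lra.
by rewrite ltr0_norm // => hk; left; apply/eqP; apply: flatexp_neg; lra.
Qed.

Lemma rpart_derivs s f : rpart (derivs s f) = rderivs s (rpart f).
Proof. by elim: s => //= w s <-. Qed.

Lemma ipart_derivs s f : ipart (derivs s f) = rderivs s (ipart f).
Proof. by elim: s => //= w s <-. Qed.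

Lemma smoothE f : smooth f <-> rsmooth (rpart f) /\ rsmooth (ipart f).
Proof.
split=> [sf|[sr si] s X]; last by rewrite rpart_derivs ipart_derivs.
by split=> s X; rewrite -?rpart_derivs -?ipart_derivs; have [] := sf s X.
Qed.

Lemma rpartD f g : rpart (fun X => f X + g X) = fun X => rpart f X + rpart g X.
Proof. by apply/funext => X; rewrite /rpart; case: (f X) => a b; case: (g X). Qed.
Lemma ipartD f g : ipart (fun X => f X + g X) = fun X => ipart f X + ipart g X.
Proof. by apply/funext => X; rewrite /ipart; case: (f X) => a b; case: (g X). Qed.
Lemma rpartM f g : rpart (fun X => f X * g X) =
  fun X => rpart f X * rpart g X + - 1 * (ipart f X * ipart g X).
Proof. by apply/funext => X; rewrite /rpart /ipart mulN1r; case: (f X) => a b; case: (g X). Qed.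
Lemma ipartM f g : ipart (fun X => f X * g X) =
  fun X => rpart f X * ipart g X + ipart f X * rpart g X.
Proof. by apply/funext => X; rewrite /rpart /ipart; case: (f X) => a b; case: (g X). Qed.

Lemma smooth_cst c : smooth (fun _ : qspace R => c).
Proof. by apply/smoothE; split; exact: rsmooth_cst. Qed.

Lemma smoothD f g : smooth f -> smooth g -> smooth (fun X => f X + g X).
Proof.
move=> /smoothE[fr fi] /smoothE[gr gi]; apply/smoothE.
by rewrite rpartD ipartD; split; exact: rsmoothD.
Qed.

Lemma smoothM f g : smooth f -> smooth g -> smooth (fun X => f X * g X).
Proof.
move=> /smoothE[fr fi] /smoothE[gr gi]; apply/smoothE.
rewrite rpartM ipartM; split; last by apply: rsmoothD; exact: rsmoothM.
by apply: rsmoothD; [|apply: rsmoothZ]; exact: rsmoothM.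
Qed.

Lemma smooth_dderiv w f : smooth f -> smooth (dderiv w f).
Proof. by move=> sf s X; rewrite /derivs -foldr_rcons; exact: sf. Qed.

Definition qsupp r f := forall X, ~ qbox r X -> f X = 0.

Lemma qbox_closed r : closed (@qbox R r).
Proof. by apply: compact_closed; [exact: norm_hausdorff|exact: (@qbox_compact R r)]. Qed.

Lemma qsuppP f r : qsupp r f <-> Defs.support f `<=` qbox r.
Proof.
split=> [fr|fr X Xr]; last first.
  by apply/eqP/negPn/negP => fX; apply: Xr; apply: fr; exact: subset_closure.
rewrite /Defs.support ((closure_id (qbox r)).1 (@qbox_closed r)).
apply: closure_subset => X /= fX; apply: contrapT => Xr.
by move: fX; rewrite fr // eqxx.
Qed.

Lemma test_functionP f : test_function f <-> smooth f /\ exists r, qsupp r f.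
Proof.
split=> [[sf cf]|[sf [r fr]]].
  by split=> //; have [r hr] := compact_qbox cf; exists r; apply/qsuppP.
split=> //; apply: subclosed_compact (@qbox_compact R r) _; first exact: closed_closure.
exact/qsuppP.
Qed.

Lemma qsupp_dderiv w f r : qsupp r f -> qsupp r (dderiv w f).
Proof.
move=> fr X Xr; have nX : \forall Y \near X, ~ qbox r Y.
  by apply: open_nbhs_nbhs; split=> //; apply: closed_openC; exact: qbox_closed.
rewrite /dderiv; congr (_ +i* _).
  rewrite (@near_eq_derive _ _ _ _ (cst (0 : R^o))); first exact: derive_cst.
  by apply: filterS nX => Y /fr; rewrite /rpart => ->.
rewrite (@near_eq_derive _ _ _ _ (cst (0 : R^o))); first exact: derive_cst.
by apply: filterS nX => Y /fr; rewrite /ipart => ->.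
Qed.

Lemma qsupp_derivs s f r : qsupp r f -> qsupp r (derivs s f).
Proof. by move=> fr; elim: s => //= w s IH; exact: qsupp_dderiv. Qed.

Lemma smooth_derivs s f : smooth f -> smooth (derivs s f).
Proof. by move=> sf; elim: s => //= w s IH; exact: smooth_dderiv. Qed.

Lemma smooth_sum (I : Type) (t : seq I) (F : I -> qspace R -> R[i]) :
  (forall i, smooth (F i)) -> smooth (fun X => \sum_(i <- t) F i X).
Proof.
move=> sF; elim: t => [|i t IH].
  by under eq_fun => X do rewrite big_nil; exact: smooth_cst.
by under eq_fun => X do rewrite big_cons; exact: smoothD.
Qed.

Lemma smooth_partialT P f : smooth f -> smooth (partialT P f).
Proof.
move=> sf; apply: smooth_sum => m; apply: smoothM; first exact: smooth_cst.
exact: smooth_derivs.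
Qed.

Lemma qsupp_partialT P f r : qsupp r f -> qsupp r (partialT P f).
Proof. by move=> fr X Xr; rewrite /partialT big1 // => m _; rewrite (qsupp_derivs _ fr) // mulr0. Qed.

Lemma act_is_linear (A B : 'M[R]_2) : linear (act A B).
Proof.
by move=> c X Y; rewrite /act; congr (_, _);
  rewrite /= mulmxDr mulmxDl -scalemxAr -scalemxAl.
Qed.

Lemma act_continuous (A B : 'M[R]_2) : continuous (act A B).
Proof.
apply: qpair_continuous => X.
  apply: (continuous_comp (f := fun X => A *m X.1) (g := mulmxr (invmx B))).
    by apply: (continuous_comp (f := fst) (g := mulmx A)); [exact: cvg_fst|exact: mulmx_continuous].
  exact: mulmxr_continuous.
apply: (continuous_comp (f := fun X => B *m X.2) (g := mulmxr (invmx A))).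
  by apply: (continuous_comp (f := snd) (g := mulmx B)); [exact: cvg_snd|exact: mulmx_continuous].
exact: mulmxr_continuous.
Qed.

Lemma smooth_act (A B : 'M[R]_2) f : smooth f -> smooth (fun X => f (act A B X)).
Proof.
pose L : {linear qspace R -> qspace R} :=
  HB.pack (act A B) (GRing.isLinear.Build _ _ _ _ _ (act_is_linear A B)).
have cL : continuous L by exact: act_continuous.
move=> /smoothE[fr fi]; apply/smoothE; split.
  exact: (@rsmooth_compl R _ L (rpart f) cL fr).
exact: (@rsmooth_compl R _ L (ipart f) cL fi).
Qed.

Lemma test_function_act (A B : 'M[R]_2) f : A \in unitmx -> B \in unitmx ->
  test_function f -> test_function (fun X => f (act A B X)).
Proof.
move=> uA uB /test_functionP[sf [r fr]]; apply/test_functionP; split; first exact: smooth_act.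
have : compact (act (invmx A) (invmx B) @` qbox r).
  by apply: continuous_compact (@qbox_compact R r); apply: continuous_subspaceT; exact: act_continuous.
move=> /compact_qbox[s hs]; exists s => X Xs; apply: fr => Xr; apply: Xs.
apply: hs; exists (act A B X) => //.
rewrite -actM ?unitmx_inv // !mulVmx // /act invmx1 !mul1mx !mulmx1.
by case: (X).
Qed.

End TestFunctions.

(** * The complex integral and integrals of derivatives *)

Section IntegrationByParts.
Variable R : realType.
Local Notation nc := (@ComplexField.Normc.normc R).
Implicit Types (X Y w : qspace R) (f g : qspace R -> R[i]) (h : qspace R -> R^o) (r : R).
Implicit Types (p q P : Cpolyq R).

Lemma Cc_smooth h r : rsmooth h -> (forall X, ~ qbox r X -> h X = 0) -> Cc h.
Proof. by move=> sh hr; split; [exact: rsmooth_continuous|exists r]. Qed.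

(** By translation invariance the difference quotients of h have integral 0, and they converge
    uniformly to the derivative, with supports in a common box. *)
Lemma Iq_derive0 w h r : rsmooth h -> (forall X, ~ qbox r X -> h X = 0) ->
  Iq (fun X => 'D_w h X) = 0.
Proof.
move=> sh hr.
have hf : qsupp r (fun X => (h X)%:C) by move=> X /hr ->.
have out w' (k : qspace R -> R^o) : (forall X, ~ qbox r X -> k X = 0) ->
    forall X, ~ qbox r X -> 'D_w' k X = 0.
  move=> kr X Xr; have kf : qsupp r (fun X => (k X)%:C) by move=> Y /kr ->.
  by have := qsupp_dderiv w' kf Xr => -[].
(* The box of radius s contains the supports of all translates of h by t w with 0 <= t <= 1. *)
pose s := r + \sum_k `|qcoord w 0 k|.
have rs (t : R) X : 0 <= t <= 1 -> ~ qbox s X -> ~ qbox r (X + t *: w).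
  move=> /andP[t0 t1] Xs Xr; apply: Xs => k.
  have -> : X = (X + t *: w) - t *: w by rewrite addrK.
  rewrite qcoordB (le_trans (ler_normB _ _)) // lerD //.
  rewrite qcoordZ normrM ger0_norm // (@le_trans _ _ `|qcoord w 0 k|) //.
    by rewrite ler_piMl.
  by rewrite (bigD1 k) //= lerDl sumr_ge0.
have rs0 X : ~ qbox s X -> ~ qbox r X.
  by move=> /(rs 0); rewrite scale0r addr0; apply; rewrite lexx ler01.
have ch := Cc_smooth sh hr.
have c1 : Cc (fun X => 'D_w h X) := Cc_smooth (rsmooth_derive w sh) (out w h hr).
have c2 : Cc (rderivs [:: w; w] h) :=
  Cc_smooth (rsmooth_derivs [:: w; w] sh) (out w _ (out w h hr)).
have [M hM] := Cc_bounded c2.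
have bnd (t : R) : 0 < t <= 1 -> `|Iq (fun X => 'D_w h X)| <= M * cube_vol s * t.
  move=> /andP[t0 t1].
  have cT := Cc_translate (t *: w) ch.
  have cN : Cc (fun X => -1 * h X) := CcZ (-1) ch.
  have cQ : Cc (fun X => t^-1 * (h (X + t *: w) + -1 * h X)) := CcZ t^-1 (CcD cT cN).
  have cN1 : Cc (fun X => -1 * 'D_w h X) := CcZ (-1) c1.
  have E : Iq (fun X => t^-1 * (h (X + t *: w) + -1 * h X) + -1 * 'D_w h X) =
           - Iq (fun X => 'D_w h X).
    by rewrite (IqD cQ cN1) (IqZ _ (CcD cT cN)) (IqD cT cN) (Iq_translate _ ch)
      (IqZ _ ch) (IqZ _ c1) !mulN1r subrr mulr0 add0r.
  rewrite -normrN -E mulrAC; apply: Iq_bound => [|X Xs|X _]; first exact: CcD.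
    rewrite (hr _ (rs0 _ Xs)) (out _ _ hr _ (rs0 _ Xs)) hr ?mulr0 ?addr0 ?mulr0 //.
    by apply: rs Xs; rewrite ltW.
  rewrite !mulN1r; exact: difference_quotient_bound.
apply/eqP/negPn/negP => I0.
have a0 : 0 < `|Iq (fun X => 'D_w h X)| by rewrite normr_gt0.
have := bnd 1; rewrite ltr01 lexx mulr1 => /(_ isT) b1.
move: a0 b1 bnd; move: (`|_|) (M * cube_vol s) => a C a0 aC bnd.
have C0 : 0 < C := lt_le_trans a0 aC.
(* At t = a / (2 C) the bound reads a <= a / 2, which contradicts a > 0. *)
have /bnd : 0 < a / (2 * C) <= 1.
  by rewrite divr_gt0 ?mulr_gt0 //= ler_pdivrMr ?mulr_gt0 //; lra.
rewrite (_ : C * _ = a / 2); last by field; rewrite gt_eqF.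
lra.
Qed.

Definition CC f := Cc (rpart f) /\ Cc (ipart f).

Lemma integralqE f : integralq f = Iq (rpart f) +i* Iq (ipart f).
Proof. by []. Qed.

Lemma CC_smooth f r : smooth f -> qsupp r f -> CC f.
Proof.
move=> /smoothE[sr si] fr; split.
  by apply: (Cc_smooth (r := r)) => // X Xr; rewrite /rpart fr.
by apply: (Cc_smooth (r := r)) => // X Xr; rewrite /ipart fr.
Qed.

Lemma CC_test f : test_function f -> CC f.
Proof. by move=> /test_functionP[sf [r fr]]; exact: CC_smooth fr. Qed.

Definition Ccont f := continuous (rpart f) /\ continuous (ipart f).

Lemma Ccont_smooth f : smooth f -> Ccont f.
Proof. by move=> /smoothE[sr si]; split; exact: rsmooth_continuous. Qed.

Lemma CCD f g : CC f -> CC g -> CC (fun X => f X + g X).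
Proof. by move=> [fr fi] [gr gi]; rewrite /CC rpartD ipartD; split; exact: CcD. Qed.

Lemma CCM f g : Ccont f -> CC g -> CC (fun X => f X * g X).
Proof.
move=> [fr fi] [gr gi]; rewrite /CC rpartM ipartM; split.
  by apply: CcD; [|apply: CcZ]; exact: Cc_mull.
by apply: CcD; exact: Cc_mull.
Qed.

Lemma Ccont_cst c : Ccont (fun _ : qspace R => c).
Proof. by split=> X; exact: cvg_cst. Qed.

Lemma CCZ c f : CC f -> CC (fun X => c * f X).
Proof. exact/CCM/Ccont_cst. Qed.

Lemma integralqD f g : CC f -> CC g ->
  integralq (fun X => f X + g X) = integralq f + integralq g.
Proof.
by move=> [fr fi] [gr gi]; rewrite !integralqE rpartD ipartD !IqD.
Qed.

Lemma integralqZ c f : CC f -> integralq (fun X => c * f X) = c * integralq f.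
Proof.
move=> [fr fi]; rewrite !integralqE (rpartM (fun=> c)) (ipartM (fun=> c)).
have h (a : R) (k : qspace R -> R^o) : Cc k -> Cc (fun X => a * k X) by exact: CcZ.
case: c => a b; rewrite /rpart /ipart /= in fr fi *.
rewrite !IqD ?IqZ ?(h _ _ fr) ?(h _ _ fi) //; try exact/h/h; try exact: h.
by apply/eqP; rewrite eq_complex /= mulN1r !eqxx.
Qed.

Lemma integralq_sum (I : Type) (t : seq I) (F : I -> qspace R -> R[i]) :
  (forall i, CC (F i)) ->
  CC (fun X => \sum_(i <- t) F i X) /\
  integralq (fun X => \sum_(i <- t) F i X) = \sum_(i <- t) integralq (F i).
Proof.
move=> cF; elim: t => [|i t [IH1 IH2]].
  have -> : (fun X => \sum_(i <- [::]) F i X) = (fun _ => 0).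
    by apply/funext => X; rewrite big_nil.
  have c0 : CC (fun _ : qspace R => 0).
    by apply: (CC_smooth (r := 0)); [exact: smooth_cst|].
  split=> //; rewrite big_nil.
  have := integralqZ 0 c0.
  have -> : (fun _ : qspace R => 0 * 0 : R[i]) = (fun _ => 0) by apply/funext => X; rewrite mul0r.
  by rewrite mul0r.
have -> : (fun X => \sum_(j <- i :: t) F j X) = (fun X => F i X + \sum_(j <- t) F j X).
  by apply/funext => X; rewrite big_cons.
by rewrite big_cons; split; [exact: CCD|rewrite integralqD // IH2].
Qed.

Lemma integralq_bound f r M : CC f -> qsupp r f ->
  (forall X, qbox r X -> nc (f X) <= M) -> nc (integralq f) <= 2 * M * cube_vol r.
Proof.
move=> [fr fi] fs fM; rewrite (le_trans (normc_le_ReIm _)) //.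
rewrite mulrAC mulr2n mulrDl mul1r mulrDl; apply: lerD => /=.
  rewrite mulrC; apply: Iq_bound => // X Xr; first by rewrite /rpart fs.
  by rewrite (le_trans (normc_Re _)) ?fM.
rewrite mulrC; apply: Iq_bound => // X Xr; first by rewrite /ipart fs.
by rewrite (le_trans (normc_Im _)) ?fM.
Qed.

Lemma integralq_act (A B : 'M[R]_2) f : A \in unitmx -> B \in unitmx -> CC f ->
  CC (fun X => f (act A B X)) /\ integralq (fun X => f (act A B X)) = integralq f.
Proof.
move=> uA uB [fr fi].
have [c1 e1] := Iq_act uA uB fr; have [c2 e2] := Iq_act uA uB fi.
by split=> //; rewrite !integralqE; congr (_ +i* _).
Qed.

Lemma dderivD w f g : smooth f -> smooth g ->
  dderiv w (fun X => f X + g X) = fun X => dderiv w f X + dderiv w g X.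
Proof.
move=> /smoothE[fr fi] /smoothE[gr gi]; apply/funext => X.
by rewrite /dderiv rpartD ipartD !deriveD_fun //; exact: rsmooth_differentiable.
Qed.

Lemma dderiv_cst w c : dderiv w (fun _ => c) = fun _ => 0.
Proof. by apply/funext => X; rewrite /dderiv !derive_cst. Qed.

Lemma dderivM w f g : smooth f -> smooth g ->
  dderiv w (fun X => f X * g X) = fun X => f X * dderiv w g X + dderiv w f X * g X.
Proof.
move=> /smoothE[fr fi] /smoothE[gr gi]; apply/funext => X.
have d k : rsmooth k -> differentiable k X by move=> ?; exact: rsmooth_differentiable.
have sM k l : rsmooth k -> rsmooth l -> rsmooth (fun X : qspace R => k X * l X) by exact: rsmoothM.
have sN k : rsmooth k -> rsmooth (fun X : qspace R => -1 * k X) by exact: rsmoothZ.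
rewrite /dderiv rpartM ipartM !deriveD_fun ?deriveM_fun ?derive_cst;
  try (apply: (d); do ?[apply: (sM)|apply: (sN)|exact: rsmooth_cst|by []]).
rewrite /rpart /ipart; case: (f X) => a b; case: (g X) => a' b'.
by apply/eqP; rewrite eq_complex /=; apply/andP; split; apply/eqP; ring.
Qed.

Lemma integralq_dderiv w f r : smooth f -> qsupp r f -> integralq (dderiv w f) = 0.
Proof.
move=> /smoothE[sr si] fr; rewrite integralqE.
have e1 : Iq (rpart (dderiv w f)) = 0.
  by apply: (@Iq_derive0 w (rpart f) r sr) => X Xr; rewrite /rpart fr.
have e2 : Iq (ipart (dderiv w f)) = 0.
  by apply: (@Iq_derive0 w (ipart f) r si) => X Xr; rewrite /ipart fr.
by rewrite e1 e2.
Qed.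

End IntegrationByParts.

(** * Integration by parts against polynomials *)

Section PolynomialIBP.
Variable R : realType.
Local Notation nc := (@ComplexField.Normc.normc R).
Implicit Types (X Y w : qspace R) (f g : qspace R -> R[i]) (r : R).
Implicit Types (p q P : Cpolyq R).

Lemma smooth_qcoordC k : smooth (fun X : qspace R => (qcoord X 0 k)%:C).
Proof. by apply/smoothE; split; [exact: rsmooth_qcoord|exact: rsmooth_cst]. Qed.

Lemma dderiv_qcoordC w k :
  dderiv w (fun X : qspace R => (qcoord X 0 k)%:C) = fun=> (qcoord w 0 k)%:C.
Proof.
by apply/funext => X; rewrite /dderiv; congr (_ +i* _); [exact: derive_qcoord|exact: derive_cst].
Qed.

Lemma polydirM w p q : polydir w (p * q) = p * polydir w q + polydir w p * q.
Proof.
rewrite /polydir mulr_sumr mulr_suml -big_split; apply: eq_bigr => k _ /=.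
by rewrite mderivM scalerDr scalerAl scalerAr addrC.
Qed.

Lemma evalq_smooth_dderiv (p0 : Cpolyq R) : smooth (evalq p0) /\
  forall w, dderiv w (evalq p0) = evalq (polydir w p0).
Proof.
pose Q p := smooth (evalq p) /\ forall w, dderiv w (evalq p) = evalq (polydir w p).
have QE p q : p = q -> Q p -> Q q by move=> ->.
have QD p q : Q p -> Q q -> Q (p + q).
  move=> [sp dp] [sq dq]; rewrite /Q.
  have -> : evalq (p + q) = fun X => evalq p X + evalq q X.
    by apply/funext => X; rewrite evalqD.
  split=> [|w]; first exact: smoothD.
  by rewrite dderivD // dp dq; apply/funext => X; rewrite linearD evalqD.
have QM p q : Q p -> Q q -> Q (p * q).
  move=> [sp dp] [sq dq]; rewrite /Q.
  have -> : evalq (p * q) = fun X => evalq p X * evalq q X.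
    by apply/funext => X; rewrite evalqM.
  split=> [|w]; first exact: smoothM.
  by rewrite dderivM // dp dq; apply/funext => X; rewrite polydirM evalqD !evalqM.
have QC c : Q (mpolyC dimq c).
  have E : evalq (mpolyC dimq c) = fun _ => c by apply/funext => X; rewrite /evalq mevalC.
  rewrite /Q E; split=> [|w]; first exact: smooth_cst.
  rewrite dderiv_cst; apply/funext => X.
  by rewrite /polydir big1 ?/evalq ?meval0 // => k _; rewrite mderivC scaler0.
have QX k : Q (mpolyX R[i] (mnm1 k)).
  have E : evalq (mpolyX R[i] (mnm1 k)) = fun X => (qcoord X 0 k)%:C.
    by apply/funext => X; rewrite /evalq mevalXU.
  rewrite /Q E; split=> [|w]; first exact: smooth_qcoordC.
  rewrite dderiv_qcoordC; apply/funext => X.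
  rewrite /polydir (bigD1 k) //= big1 ?addr0 => [|l lk]; rewrite mderivXU.
    by rewrite eqxx /= evalqZ /evalq meval1 mulr1.
  by rewrite eq_sym (negbTE lk) scaler0.
have Q1 : Q 1 by apply: QE (QC 1); rewrite mpolyC1.
have QXn m : Q (mpolyX R[i] m).
  rewrite mpolyXE_id; elim: (index_enum _) => [|k t IH]; first by rewrite big_nil.
  rewrite big_cons; apply: (QM _ _ _ IH); elim: (m k) => [|n {}IH]; first by rewrite expr0.
  by rewrite exprS; exact: (QM _ _ (QX k) IH).
elim/mpolyind: p0 => [|c m p _ _ IH]; first by apply: QE (QC 0); rewrite mpolyC0.
by rewrite -mul_mpolyC; exact: (QD _ _ (QM _ _ (QC c) (QXn m)) IH).
Qed.

Lemma smooth_evalq p : smooth (evalq p).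
Proof. by have [] := evalq_smooth_dderiv p. Qed.

Lemma qsuppM f g r : qsupp r g -> qsupp r (fun X => f X * g X).
Proof. by move=> gr X Xr; rewrite gr ?mulr0. Qed.

Lemma integralq_ibp w p f r : smooth f -> qsupp r f ->
  integralq (fun X => evalq p X * dderiv w f X) =
  - integralq (fun X => evalq (polydir w p) X * f X).
Proof.
move=> sf fr; have [sp dp] := evalq_smooth_dderiv p.
have := integralq_dderiv w (smoothM sp sf) (qsuppM (evalq p) fr).
rewrite dderivM // dp integralqD; last 2 first.
- by apply: (CC_smooth (r := r)); [exact: smoothM (smooth_dderiv w sf)|exact/qsuppM/qsupp_dderiv].
- by apply: (CC_smooth (r := r)); [exact: smoothM (smooth_evalq _) sf|exact: qsuppM].
by move=> /eqP; rewrite addr_eq0 => /eqP.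
Qed.

Lemma integralq_derivs s p f r : smooth f -> qsupp r f ->
  integralq (fun X => evalq p X * derivs s f X) =
  (-1) ^+ size s * integralq (fun X => evalq (polyderivs s p) X * f X).
Proof.
move=> sf fr; elim: s p => [|w s IH] p /=; first by rewrite mul1r.
rewrite (integralq_ibp w p (smooth_derivs s sf) (qsupp_derivs s fr)) IH.
rewrite exprS mulN1r mulNr; congr (- (_ * integralq _)); apply/funext => X.
rewrite -[polyderivs s (polydir w p)](polyderivs_cat s [:: w]) -/(polyderivs (w :: s) p).
by rewrite (@polyderivs_perm _ (s ++ [:: w]) (w :: s)) // cats1 perm_rcons.
Qed.

(** The signs of the formal transpose cancel those of the integrations by parts. *)
Lemma integralq_partialT P p f : test_function f ->
  integralq (fun X => evalq p X * partialT P f X) =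
  integralq (fun X => evalq (polyop P p) X * f X).
Proof.
move=> /test_functionP[sf [r fr]].
have cD s : CC (fun X => evalq p X * derivs s f X).
  apply: (CC_smooth (r := r)); first exact: smoothM (smooth_evalq p) (smooth_derivs s sf).
  exact/qsuppM/qsupp_derivs.
have cP q : CC (fun X => evalq q X * f X).
  by apply: (CC_smooth (r := r)); [exact: smoothM (smooth_evalq q) sf|exact: qsuppM].
pose F m X := (-1) ^+ mdeg m * mcoeff m P * (evalq p X * derivs (mono_dirs R m) f X).
pose G m X := mcoeff m P * (evalq (polyderivs (mono_dirs R m) p) X * f X).
have -> : (fun X => evalq p X * partialT P f X) = fun X => \sum_(m <- msupp P) F m X.
  by apply/funext => X; rewrite mulr_sumr; apply: eq_bigr => m _; rewrite /F mulrCA.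
have -> : (fun X => evalq (polyop P p) X * f X) = fun X => \sum_(m <- msupp P) G m X.
  apply/funext => X; rewrite /polyop /evalq raddf_sum mulr_suml; apply: eq_bigr => m _.
  by rewrite /= mevalZ -mulrA.
have cF m : CC (F m) by exact: CCZ.
have cG m : CC (G m) by exact: CCZ.
rewrite (integralq_sum _ cF).2 (integralq_sum _ cG).2.
apply: eq_bigr => m _; rewrite /F /G !integralqZ // (integralq_derivs _ _ sf fr).
by rewrite size_mono_dirs mulrCA !mulrA -exprMn mulrNN mulr1 expr1n mul1r.
Qed.

End PolynomialIBP.

(** * Approximate delta functions and continuous densities *)

Section DeltaSequences.
Variable R : realType.
Local Notation nc := (@ComplexField.Normc.normc R).
Implicit Types (X Y w : qspace R) (f g F G : qspace R -> R[i]) (r e : R).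

Lemma Ccont_modulus F X0 e : Ccont F -> 0 < e ->
  exists2 r, 0 < r & forall X, qbox r (X - X0) -> nc (F X - F X0) <= e.
Proof.
move=> [cr ci] e0; have e2 : 0 < e / 2 by rewrite divr_gt0.
have /cvg_ballP/(_ _ e2) h1 := cr X0; have /cvg_ballP/(_ _ e2) h2 := ci X0.
have [r [r0 hr]] := nbhs_qbox (filterI h1 h2).
exists r => // X /hr [/= b1 b2].
rewrite (le_trans (normc_le_ReIm _)) // [e]splitr.
move: b1 b2; rewrite /ball /= /rpart /ipart distrC [X in _ -> X < _ -> _]distrC.
by case: (F X) => a b; case: (F X0) => a' b' /= h h'; rewrite lerD ?ltW.
Qed.

Lemma modulus_Ccont F :
  (forall X0 e, 0 < e ->
    exists2 r, 0 < r & forall X, qbox r (X - X0) -> nc (F X - F X0) <= e) -> Ccont F.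
Proof.
move=> hF; split=> X0; apply/cvg_ballP => e e0;
  have e2 : 0 < e / 2 by rewrite divr_gt0.
  have [r r0 hr] := hF X0 _ e2.
  apply: filterS (qbox_nbhs X0 r0) => X /hr h; rewrite /ball /= distrC.
  rewrite (@le_lt_trans _ _ (e / 2)) //; last by rewrite gtr_pMr // invf_lt1 // ltr1n.
  apply: le_trans h; apply: le_trans (normc_Re _).
  by rewrite /rpart; case: (F X) => a b; case: (F X0).
have [r r0 hr] := hF X0 _ e2.
apply: filterS (qbox_nbhs X0 r0) => X /hr h; rewrite /ball /= distrC.
rewrite (@le_lt_trans _ _ (e / 2)) //; last by rewrite gtr_pMr // invf_lt1 // ltr1n.
apply: le_trans h; apply: le_trans (normc_Im _).
by rewrite /ipart; case: (F X) => a b; case: (F X0).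
Qed.

Lemma analytic_Ccont F : analytic F -> Ccont F.
Proof.
move=> aF; apply: modulus_Ccont => X0 e e0.
have [r [p [r0 sp _ hp]]] := analytic_expand X0 aF.
have [C hC] := psum_near0 r0 sp.
pose D := `|C| + 1; have D0 : 0 < D by rewrite ltr_wpDl.
pose t := Num.min 1 (e / D).
have t0 : 0 < t by rewrite lt_min ltr01 divr_gt0.
have t1 : t <= 1 by rewrite ge_min lexx.
exists (t * r) => [|X hX]; first exact: mulr_gt0.
have -> : F X = psum p (coordC (X - X0)).
  rewrite -hp ?subrKC // => k; apply: le_trans (hX k) _.
  by rewrite ler_piMl // ltW.
have -> : F X0 = psum p (fun=> 0).
  rewrite -{1}[X0]addr0 hp => [|k]; last by rewrite qcoord0 normr0 ltW.
  by congr psum; apply/funext => k; rewrite /coordC qcoord0.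
have h : nc (psum p (coordC (X - X0)) - psum p (fun=> 0)) <= t * C.
  by apply: hC => [||k]; rewrite ?(ltW t0) // normc_real; exact: hX.
apply: le_trans h _; apply: (@le_trans _ _ (t * D)).
  by rewrite ler_wpM2l ?(ltW t0) // (le_trans (ler_norm _)) // lerDl.
by rewrite -ler_pdivlMr // ge_min lexx orbT.
Qed.

Lemma delta_test X0 r : 0 < r -> exists b : qspace R -> R^o,
  [/\ test_function (fun X => (b X)%:C), forall X, 0 <= b X,
      forall X, ~ qbox r (X - X0) -> b X = 0, Cc b & Iq b = 1].
Proof.
move=> r0.
pose s := r + \sum_k `|qcoord X0 0 k|.
have out X : ~ qbox s X -> ~ qbox r (X - X0).
  move=> Xs Xr; apply: Xs => k.
  rewrite -[X](subrK X0) qcoordD (le_trans (ler_normD _ _)) // lerD //.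
  by rewrite (bigD1 k) //= lerDl sumr_ge0.
have cb : Cc (qbump X0 r).
  by apply: (@Cc_smooth _ _ s (rsmooth_qbump X0 r)) => X /out; exact: qbump_out.
have I0 : 0 < Iq (qbump X0 r) := Iq_gt0 cb (qbump_ge0 X0 r) (qbump_gt0 X0 r0).
exists (fun X => (Iq (qbump X0 r))^-1 * qbump X0 r X); split.
- apply/test_functionP; split.
    apply/smoothE; split; last exact: rsmooth_cst.
    exact: (rsmoothZ (Iq (qbump X0 r))^-1 (rsmooth_qbump X0 r)).
  by exists s => X /out /qbump_out ->; rewrite mulr0.
- by move=> X; rewrite mulr_ge0 ?qbump_ge0 // invr_ge0 ltW.
- by move=> X /qbump_out ->; rewrite mulr0.
- exact: CcZ.
- by rewrite IqZ // mulVf // gt_eqF.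
Qed.

(** The factor 2 comes from estimating real and imaginary parts separately. *)
Lemma delta_approx F X0 r e (b : qspace R -> R^o) : Ccont F ->
  (forall X, qbox r (X - X0) -> nc (F X - F X0) <= e) ->
  (forall X, 0 <= b X) -> (forall X, ~ qbox r (X - X0) -> b X = 0) -> Cc b -> Iq b = 1 ->
  nc (integralq (fun X => F X * (b X)%:C) - F X0) <= 2 * e.
Proof.
move=> cF hF b0 bout cb b1.
have cB : CC (fun X => (b X)%:C) by split=> //; split; [move=> X; exact: cvg_cst|exists 0].
have cFb : CC (fun X => F X * (b X)%:C) := CCM cF cB.
have ib : integralq (fun X => (b X)%:C) = 1.
  rewrite integralqE (_ : Iq (rpart _) = 1) // (_ : Iq (ipart _) = 0) //.
  by rewrite -(mul0r (Iq b)) -IqZ //; congr Iq; apply/funext => X; rewrite mul0r.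
have cN : CC (fun X => - F X0 * (b X)%:C) := CCZ _ cB.
have -> : integralq (fun X => F X * (b X)%:C) - F X0 =
    integralq (fun X => F X * (b X)%:C + - F X0 * (b X)%:C).
  by rewrite integralqD // integralqZ // ib mulr1.
have bnd X : nc (F X * (b X)%:C + - F X0 * (b X)%:C) <= e * b X.
  rewrite -mulrDl normcM normc_real ger0_norm //.
  have [h|h] := pselect (qbox r (X - X0)); first by rewrite ler_wpM2r ?b0 //; exact: hF.
  by rewrite bout // !mulr0.
have [c1 c2] := CCD cFb cN.
have ce : Cc (fun X => e * b X) := CcZ e cb.
rewrite integralqE (le_trans (normc_le_ReIm _)) //= mulr2n mulrDl mul1r.
have -> : e = Iq (fun X => e * b X) by rewrite IqZ // b1 mulr1.
apply: lerD; apply: Iq_le_norm => // X; apply: le_trans (bnd X).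
  exact: normc_Re.
exact: normc_Im.
Qed.

(** Testing both densities with one bump concentrated at X0 recovers both values there up to an
    arbitrary error. *)
Lemma Ccont_determined F G : Ccont F -> Ccont G ->
  (forall f, test_function f ->
    integralq (fun X => F X * f X) = integralq (fun X => G X * f X)) -> F = G.
Proof.
move=> cF cG FG; apply/funext => X0; apply/eqP; rewrite -subr_eq0; apply/eqP/normc_eq0.
apply/eqP; rewrite eq_le normc_ge0 andbT; apply/ler_addgt0Pr => e e0; rewrite add0r.
have e4 : 0 < e / 4 by rewrite divr_gt0.
have [r r0 hr] := Ccont_modulus X0 cF e4; have [s s0 hs] := Ccont_modulus X0 cG e4.
pose u := Num.min r s; have u0 : 0 < u by rewrite lt_min r0.
have [b [tb b0 bo cb b1]] := delta_test X0 u0.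
have h1 : nc (integralq (fun X => F X * (b X)%:C) - F X0) <= 2 * (e / 4).
  apply: (delta_approx (r := u)) => // X hX; apply: hr => k.
  by apply: le_trans (hX k) _; rewrite ge_min lexx.
have h2 : nc (integralq (fun X => G X * (b X)%:C) - G X0) <= 2 * (e / 4).
  apply: (delta_approx (r := u)) => // X hX; apply: hs => k.
  by apply: le_trans (hX k) _; rewrite ge_min lexx orbT.
rewrite (FG _ tb) in h1.
have -> : F X0 - G X0 = (integralq (fun X => G X * (b X)%:C) - G X0) -
  (integralq (fun X => G X * (b X)%:C) - F X0) by ring.
rewrite (le_trans (normcD _ _)) // normcN.
by apply: le_trans (lerD h2 h1) _; lra.
Qed.

End DeltaSequences.

(** * The distribution defined by the analytic solution *)

Section SeriesIntegral.
Variable R : realType.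
Local Notation nc := (@ComplexField.Normc.normc R).
Implicit Types (X Y w : qspace R) (f g F : qspace R -> R[i]) (r e : R).
Implicit Types (p : nat -> Cpolyq R).

Lemma Ccont_evalq (q : Cpolyq R) : Ccont (evalq q).
Proof. exact/Ccont_smooth/smooth_evalq. Qed.

(** The series converges uniformly on the box that carries f. The radius is kept general: it is
    arbitrary for Fana, but fixed for the local expansion of an arbitrary analytic solution. *)
Lemma integralq_psum r p F f : 0 <= r -> nsummable r p -> Ccont F ->
  (forall X, qbox r X -> F X = psum p (coordC X)) -> CC f -> qsupp r f ->
  cvgC (fun N => integralq (fun X => evalq (\sum_(d < N) p d) X * f X))
       (integralq (fun X => F X * f X)).
Proof.
move=> r0 sp cF FE cf fr; have [e [e0 he]] := psum_rate r0 sp.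
have [M hM] : exists M, forall X, nc (f X) <= M.
  have [M1 h1] := Cc_bounded cf.1; have [M2 h2] := Cc_bounded cf.2.
  by exists (M1 + M2) => X; apply: le_trans (normc_le_ReIm _) (lerD (h1 X) (h2 X)).
have M0 : 0 <= M by apply: le_trans (hM 0); exact: normc_ge0.
pose C := 2 * M * cube_vol r.
apply: (@cvgC_squeeze _ _ _ (fun N => C * e N : R^o)); last first.
  rewrite -(mulr0 C); apply: (cvgM (f := fun _ => C : R^o)); [exact: cvg_cst|exact: e0].
move=> N; set q := \sum_(d < N) p d.
have cq : CC (fun X => evalq q X * f X) by apply: CCM => //; exact: Ccont_evalq.
have cFf : CC (fun X => F X * f X) by exact: CCM.
have cN : CC (fun X => -1 * (F X * f X)) by exact: CCZ.
have -> : integralq (fun X => evalq q X * f X) - integralq (fun X => F X * f X) =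
    integralq (fun X => evalq q X * f X + -1 * (F X * f X)).
  by rewrite integralqD // integralqZ // mulN1r.
have -> : C * e N = 2 * (e N * M) * cube_vol r by rewrite /C; ring.
apply: integralq_bound => [||X Xr]; first exact: CCD.
  by move=> X Xr; rewrite fr // !mulr0 addr0.
have -> : evalq q X * f X + -1 * (F X * f X) = - (F X - evalq q X) * f X by ring.
rewrite normcM normcN; apply: ler_pM; rewrite ?normc_ge0 //.
have -> : evalq q X = \sum_(d < N) meval (coordC X) (p d) by rewrite /q /evalq raddf_sum.
by rewrite FE //; apply: he => k; rewrite normc_real; exact: Xr.
Qed.

End SeriesIntegral.

(** * The multiples of Fana are invariant eigendistributions *)

Section Existence.
Variable R : realType.
Local Notation nc := (@ComplexField.Normc.normc R).
Implicit Types (X Y : qspace R) (f g F : qspace R -> R[i]) (r e : R).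
Variables lambda1 lambda2 : R[i].
Local Notation Fana := (Fana_fun lambda1 lambda2).

Lemma Qfun_act A B X : A \in unitmx -> B \in unitmx -> Qfun (act A B X) = Qfun X.
Proof.
by move=> uA uB; have := invariant_Qpoly uA uB X; rewrite !evalq_Qpoly => /complexI.
Qed.

Lemma Sfun_act A B X : A \in unitmx -> B \in unitmx -> Sfun (act A B X) = Sfun X.
Proof.
by move=> uA uB; have := invariant_Spoly uA uB X; rewrite !evalq_Spoly => /complexI.
Qed.

Lemma invariant_fpoly d : invariant_poly (fpoly lambda1 lambda2 d).
Proof.
move=> A B uA uB X; rewrite /fpoly /evalq !raddf_sum; apply: eq_bigr => i _ /=.
rewrite !mevalZ -!/(evalq _ _) !evalq_schurQS !ufun_add_vfun !ufun_mul_vfun.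
by rewrite Qfun_act ?Sfun_act.
Qed.

Lemma Fana_act A B X : A \in unitmx -> B \in unitmx -> Fana (act A B X) = Fana X.
Proof.
move=> uA uB; congr limC; apply/funext => N; apply: eq_bigr => d _.
exact: invariant_fpoly.
Qed.

Lemma Ccont_Fana : Ccont Fana.
Proof. exact/analytic_Ccont/Fana_analytic. Qed.

Lemma integralq_Fana f : test_function f ->
  cvgC (fun N => integralq (fun X => evalq (fsum lambda1 lambda2 N) X * f X))
       (integralq (fun X => Fana X * f X)).
Proof.
move=> tf; have /test_functionP[sf [r fr]] := tf.
(* The radius r may be negative, in which case its box is empty. *)
have fs : qsupp `|r| f.
  by move=> X Xr; apply: fr => Xr'; apply: Xr => k; rewrite (le_trans (Xr' k)) // ler_norm.
apply: (integralq_psum (r := `|r|)) => //.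
- exact: fpoly_nsummable.
- exact: Ccont_Fana.
- exact: CC_test.
Qed.

Lemma test_function_partialT P f : test_function f -> test_function (partialT P f).
Proof.
move=> /test_functionP[sf [r fr]]; apply/test_functionP; split; first exact: smooth_partialT.
by exists r; exact: qsupp_partialT.
Qed.

Lemma test_function_linear c f g : test_function f -> test_function g ->
  test_function (fun X => c * f X + g X).
Proof.
move=> /test_functionP[sf [r fr]] /test_functionP[sg [s gs]]; apply/test_functionP; split.
  by apply: smoothD => //; apply: smoothM => //; exact: smooth_cst.
exists (Num.max r s) => X Xrs; rewrite fr ?gs ?mulr0 ?addr0 // => h; apply: Xrs => k;
  by rewrite le_max h ?orbT.
Qed.

(** Both sides are limits of one sequence: for each partial sum the operator is moved from f to the
    polynomial by [integralq_partialT], and [polyop_fsum_cvg] evaluates the result. *)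
Lemma integralq_Fana_partialT (chi : Cpolyq R -> R[i]) : is_character chi ->
  chi (Qpoly R) = lambda1 + lambda2 -> chi (Spoly R) = lambda1 * lambda2 ->
  forall P, invariant_poly P -> forall f, test_function f ->
  integralq (fun X => Fana X * partialT P f X) = chi P * integralq (fun X => Fana X * f X).
Proof.
move=> hchi chiQ chiS P iP f tf.
pose phi q := integralq (fun X => evalq q X * f X).
have cphi q : CC (fun X => evalq q X * f X) by apply: CCM; [exact: Ccont_evalq|exact: CC_test].
have phil c q q' : phi (c *: q + q') = c * phi q + phi q'.
  rewrite /phi -integralqZ // -integralqD //; last exact: CCZ.
  by congr integralq; apply/funext => X; rewrite evalqD evalqZ mulrDl mulrA.
have := polyop_fsum_cvg hchi chiQ chiS phil (integralq_Fana tf) iP.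
apply: cvgC_unique.
have <- : (fun N => integralq (fun X => evalq (fsum lambda1 lambda2 N) X * partialT P f X)) =
    fun N => phi (polyop P (fsum lambda1 lambda2 N)).
  by apply/funext => N; rewrite integralq_partialT.
exact: (integralq_Fana (test_function_partialT P tf)).
Qed.

Lemma distribution_Fana_eigen (chi : Cpolyq R -> R[i]) (T : functional R) c :
  is_character chi ->
  chi (Qpoly R) = lambda1 + lambda2 -> chi (Spoly R) = lambda1 * lambda2 ->
  (forall f, test_function f -> T f = c * distribution_of Fana f) ->
  is_invariant_eigendistribution chi T.
Proof.
move=> hchi chiQ chiS hT.
have cFf f : test_function f -> CC (fun X => Fana X * f X).
  by move=> tf; apply: CCM; [exact: Ccont_Fana|exact: CC_test].
split; first split.
- move=> a f g tf tg; rewrite (hT _ (test_function_linear a tf tg)) (hT _ tf) (hT _ tg).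
  rewrite /distribution_of.
  have -> : (fun X => Fana X * (a * f X + g X)) = fun X => a * (Fana X * f X) + Fana X * g X.
    by apply/funext => X; rewrite mulrDr mulrCA.
  rewrite integralqD ?integralqZ //; try exact: cFf; last by apply: CCZ; exact: cFf.
  by rewrite mulrDr mulrCA.
- move=> K cK; have [r Kr] := compact_qbox cK.
  have [B hB] : exists B, forall X, qbox r X -> nc (Fana X) <= B.
    have [B1 h1] := compact_bound (@qbox_compact R r) Ccont_Fana.1.
    have [B2 h2] := compact_bound (@qbox_compact R r) Ccont_Fana.2.
    by exists (B1 + B2) => X Xr; apply: le_trans (normc_le_ReIm _) (lerD (h1 X Xr) (h2 X Xr)).
  (* A locally bounded density defines a distribution of order 0, so the empty list of derivatives
     is all that is bounded. *)
  exists 0, (nc c * (2 * B * cube_vol r)) => f tf fK M hM.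
  have fr : qsupp r f by apply/qsuppP => X /fK /Kr.
  have fM X : nc (f X) <= M by have := hM [::] X isT; rewrite /= lecR.
  have key : nc (distribution_of Fana f) <= 2 * (B * M) * cube_vol r.
    apply: integralq_bound => [||X Xr]; first exact: cFf.
      by move=> X Xr; rewrite fr ?mulr0.
    by rewrite normcM; apply: ler_pM; rewrite ?normc_ge0 ?hB.
  rewrite hT // normr_normc lecR normcM (le_trans (ler_wpM2l (normc_ge0 c) key)) //.
  by rewrite [leLHS](_ : _ = nc c * (2 * B * cube_vol r) * M) //; ring.
- move=> A B uA uB f tf.
  rewrite (hT _ (test_function_act uA uB tf)) (hT _ tf) /distribution_of; congr (c * _).
  have -> : (fun X => Fana X * f (act A B X)) =
      fun X => (fun Y => Fana Y * f Y) (act A B X).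
    apply/funext => X.
    exact: (congr1 (fun z => z * f (act A B X)) (esym (Fana_act X uA uB))).
  exact: (integralq_act uA uB (cFf f tf)).2.
- move=> P iP f tf; rewrite /partialD (hT _ (test_function_partialT P tf)) (hT _ tf).
  by rewrite /distribution_of (integralq_Fana_partialT hchi chiQ chiS iP tf) mulrCA.
Qed.

End Existence.

(** * Uniqueness *)

Section PowerSeries.
Variable R : realType.
Local Notation nc := (@ComplexField.Normc.normc R).

Lemma le_small (a M t0 : R) : 0 < t0 -> 0 <= a ->
  (forall t, 0 < t -> t <= t0 -> a <= t * M) -> a = 0.
Proof.
move=> t00 a0 h; apply/eqP/negPn/negP => an0.
have {an0 a0}a0 : 0 < a by rewrite lt_def an0.
have hM := h t0 t00 (lexx _); have M0 : 0 < M by rewrite -(pmulr_rgt0 _ t00) (lt_le_trans a0).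
pose t := Num.min t0 (a / (2 * M)).
have t1 : 0 < t by rewrite lt_min t00 divr_gt0 // mulr_gt0.
have := h t t1; rewrite ge_min lexx => /(_ isT).
have : t * M <= a / 2.
  apply: (@le_trans _ _ (a / (2 * M) * M)); first by rewrite ler_wpM2r ?(ltW M0) // ge_min lexx orbT.
  by rewrite (_ : _ * M = a / 2) //; field; rewrite gt_eqF.
lra.
Qed.

(** If the coefficients before k vanish, division by t^k bounds |c_k| by t M / t0^(k+1), which tends
    to 0 with t. Vanishing on one side of 0 suffices, and only one side is available along a ray. *)
Lemma power_series_eq0 (c : nat -> R[i]) (t0 M : R) : 0 < t0 ->
  (forall N, \sum_(d < N) nc (c d) * t0 ^+ d <= M) ->
  (forall t, 0 < t -> t <= t0 -> cvgC (fun N => \sum_(d < N) c d * (t%:C) ^+ d) 0) ->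
  forall d, c d = 0.
Proof.
move=> t00 hM hc d; elim/ltn_ind: d => k IH; apply: normc_eq0.
apply: (le_small (M := M / t0 ^+ k.+1) t00 (normc_ge0 _)) => t tp tt0.
have tn0 : t != 0 by rewrite gt_eqF.
rewrite -(ler_pM2r (exprn_gt0 k tp)).
suff bnd e : 0 < e -> nc (c k) * t ^+ k <= t * (M / t0 ^+ k.+1) * t ^+ k + e.
  by apply/ler_addgt0Pr => e /bnd.
move=> e0; have /cvgrPdist_le/(_ e e0)[K _ hK] := hc t tp tt0.
have := hK (K + k.+1)%N (leq_addr _ _); rewrite sub0r normrN ger0_norm ?normc_ge0 // subr0 => h.
have E : \sum_(j < K + k.+1) c j * (t%:C) ^+ j =
    c k * t%:C ^+ k + \sum_(j < K) c (k.+1 + j)%N * t%:C ^+ (k.+1 + j).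
  rewrite addnC big_split_ord /= big_ord_recr /= big1 ?add0r // => j _.
  by rewrite IH ?mul0r.
set S := \sum_(j < K) _ in E.
have -> : nc (c k) * t ^+ k = nc (c k * t%:C ^+ k).
  by rewrite normcM -rmorphXn normc_real ger0_norm // exprn_ge0 // ltW.
have -> : c k * t%:C ^+ k = - S + \sum_(j < K + k.+1) c j * (t%:C) ^+ j by rewrite E; ring.
rewrite (le_trans (normcD _ _)) // normcN lerD //.
rewrite (le_trans (normc_sum _ _)) //.
have -> : t * (M / t0 ^+ k.+1) * t ^+ k = M * (t ^+ k.+1 / t0 ^+ k.+1).
  by rewrite [t ^+ k.+1]exprS; ring.
have r0 : 0 <= t ^+ k.+1 / t0 ^+ k.+1 by rewrite divr_ge0 // exprn_ge0 // ltW.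
apply: le_trans (ler_wpM2r r0 (hM (k.+1 + K)%N)).
rewrite mulr_suml big_split_ord /=; apply: ler_wpDl.
  by apply: sumr_ge0 => j _; rewrite mulr_ge0 // mulr_ge0 ?normc_ge0 // exprn_ge0 // (ltW t00).
apply: ler_sum => j _.
rewrite normcM -rmorphXn normc_real ger0_norm ?exprn_ge0 ?(ltW tp) //.
rewrite -mulrA ler_wpM2l ?normc_ge0 // !exprD mulrCA -mulrA.
rewrite [t0 ^+ k.+1 * _]mulrCA mulfV ?expf_neq0 ?gt_eqF // mulr1.
by rewrite ler_wpM2l ?exprn_ge0 ?(ltW tp) // lerXn2r // nnegrE ltW.
Qed.

End PowerSeries.

(** * Local expansions into homogeneous polynomials *)

Section Expansions.
Variable R : realType.
Local Notation nc := (@ComplexField.Normc.normc R).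
Local Notation poly := (Cpolyq R).
Implicit Types (X Y : qspace R) (F G : qspace R -> R[i]) (p q : nat -> poly).

Definition homog d (q : poly) := {in msupp q, forall m, mdeg m = d}.

Definition expands F X0 r p := [/\ 0 < r, nsummable r p, forall d, homog d (p d) &
  forall X, (forall k, `|qcoord X 0 k| <= r) -> F (X0 + X) = psum p (coordC X)].

Definition expandable F := forall X0, exists r p, expands F X0 r p.

Lemma evalq_scale d (q : poly) (t : R) X : homog d q ->
  evalq q (t *: X) = (t%:C) ^+ d * evalq q X.
Proof.
move=> hq; rewrite /evalq /meval /mmap mulr_sumr; apply: eq_big_seq => m /hq md /=.
rewrite mulrCA; congr (_ * _); rewrite -md.
rewrite (mdegE m) expr_sum /mmap1 -big_split; apply: eq_bigr => k _ /=.
by rewrite -exprMn -rmorphM qcoordZ.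
Qed.

Lemma homogB d (q q' : poly) c : homog d q -> homog d q' -> homog d (q - c *: q').
Proof.
move=> hq hq' m /(msuppB_le) ; rewrite mem_cat => /orP[/hq //|/msuppZ_le/hq' //].
Qed.

Lemma expandsB F F' (c : R[i]) : expandable F -> expandable F' ->
  expandable (fun X => F X - c * F' X).
Proof.
move=> hF hF' X0; have [r [p [r0 sp dp Fp]]] := hF X0; have [s [q [s0 sq dq Fq]]] := hF' X0.
have m0 : 0 < Num.min r s by rewrite lt_min r0.
have lr : Num.min r s <= r by rewrite ge_min lexx.
have ls : Num.min r s <= s by rewrite ge_min lexx orbT.
have sp' := nsummable_le (ltW m0) lr sp.
have sq' := nsummable_le (ltW m0) ls sq.
exists (Num.min r s), (fun d => p d - c *: q d); split=> //.
- have [M hM] := sp'; have [M' hM'] := sq'; exists (M + nc c * M') => N.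
  apply: le_trans (lerD (hM N) (ler_wpM2l (normc_ge0 c) (hM' N))).
  rewrite mulr_sumr -big_split; apply: ler_sum => d _ /=.
  by rewrite (le_trans (mnormD _ _ (ltW m0))) // mnormN mnormZ.
- by move=> d; exact: homogB.
- move=> X hX.
  have hr k : `|qcoord X 0 k| <= r by apply: le_trans (hX k) lr.
  have hs k : `|qcoord X 0 k| <= s by apply: le_trans (hX k) ls.
  have hv k : nc (coordC X k) <= Num.min r s by rewrite normc_real; exact: hX.
  rewrite Fp // Fq //; apply/esym; rewrite /psum; apply: cvgC_lim.
  have := cvgCB (psum_cvg (ltW m0) sp' hv) (cvgCZ c (psum_cvg (ltW m0) sq' hv)).
  rewrite (_ : (fun N => _ - _) = fun N => \sum_(d < N) meval (coordC X) (p d - c *: q d)) //.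
  apply/funext => N; rewrite mulr_sumr -sumrB; apply: eq_bigr => d _.
  by rewrite mevalB mevalZ.
Qed.

Lemma expands_line F X0 r p X : expands F X0 r p -> (forall k, `|qcoord X 0 k| <= r) ->
  (exists M, forall N, \sum_(d < N) nc (evalq (p d) X) * 1 ^+ d <= M) /\
  forall t : R, `|t| <= 1 ->
  cvgC (fun N => \sum_(d < N) evalq (p d) X * (t%:C) ^+ d) (F (X0 + t *: X)).
Proof.
move=> [r0 sp hp Fp] Xr; split.
  have [M hM] := sp; exists M => N; apply: le_trans (hM N); apply: ler_sum => d _.
  rewrite expr1n mulr1; apply: normc_meval => k; rewrite normc_real; exact: Xr.
move=> t t1.
have tr k : `|qcoord (t *: X) 0 k| <= r.
  rewrite qcoordZ normrM (le_trans _ (Xr k)) //; exact: ler_piMl.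
rewrite Fp //.
have tv k : nc (coordC (t *: X) k) <= r by rewrite normc_real.
have := psum_cvg (ltW r0) sp tv.
rewrite (_ : (fun N => _) = fun N => \sum_(d < N) evalq (p d) X * (t%:C) ^+ d) //.
apply/funext => N; apply: eq_bigr => d _.
by rewrite -[meval _ _]/(evalq (p d) (t *: X)) (evalq_scale _ _ (hp d)) mulrC.
Qed.

End Expansions.

(** * The identity theorem along rays *)

Section IdentityTheorem.
Variable R : realType.
Implicit Types (X Y : qspace R) (G : qspace R -> R[i]) (r t : R).

Lemma small_scale X r : 0 < r -> exists2 e, 0 < e &
  forall t, `|t| <= e -> forall k, `|qcoord (t *: X) 0 k| <= r.
Proof.
move=> r0; pose s := \sum_k `|qcoord X 0 k|.
have s0 : 0 < s + 1 by rewrite ltr_wpDl // sumr_ge0.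
exists (r / (s + 1)) => [|t te k]; first exact: divr_gt0.
rewrite qcoordZ normrM; apply: (@le_trans _ _ (r / (s + 1) * (s + 1))); last by rewrite divfK ?gt_eqF.
apply: ler_pM => //; rewrite /s (bigD1 k) //= -addrA lerDl addr_ge0 // sumr_ge0 //.
Qed.

(** The zeros are continued along the segment from 0 to X. With t0 the supremum of the parameters
    reached, the expansion at t0 X vanishes on the part already covered, hence identically on the
    line, hence also past t0. *)
Lemma expandable_eq0 G r : expandable G -> 0 < r ->
  (forall X, (forall k, `|qcoord X 0 k| <= r) -> G X = 0) -> forall X, G X = 0.
Proof.
move=> eG r0 G0 X.
pose S : set R := [set t | t <= 1 /\ forall s, 0 <= s -> s <= t -> G (s *: X) = 0].
have [e1 e10 he1] := small_scale X r0.
have Se : S (Num.min 1 e1).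
  split=> [|s s0 se]; first by rewrite ge_min lexx.
  apply: G0; apply: he1; rewrite ger0_norm // (le_trans se) // ge_min lexx orbT //.
have hS : has_sup S.
  by split; [exists (Num.min 1 e1)|exists 1 => t [t1 _]].
pose t0 := sup S.
have t00 : 0 < t0.
  apply: lt_le_trans (sup_upper_bound hS Se).
  by rewrite lt_min ltr01.
have Gt s : 0 <= s -> s < t0 -> G (s *: X) = 0.
  move=> s0 st0; have [|t [t1 St] st] := sup_gt (S := S) _ st0; first by exists (Num.min 1 e1).
  by apply: St => //; exact: ltW.
have [rho [p ep]] := eG (t0 *: X); have [rho0 sp hp _] := ep.
have [e e0 he] := small_scale X rho0.
have eX : forall k, `|qcoord (e *: X) 0 k| <= rho by apply: he; rewrite gtr0_norm.
have [[M hM] hc] := expands_line ep eX.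
have line (tau : R) : t0 *: X + tau *: (e *: X) = (t0 + tau * e) *: X.
  by rewrite scalerA scalerDl.
(* The known zeros lie before t0, at negative parameters - t of the expansion, whence the signs. *)
have cz d : (-1) ^+ d * evalq (p d) (e *: X) = 0.
  move: d; apply: (@power_series_eq0 R _ (Num.min 1 (t0 / e)) M).
  - by rewrite lt_min ltr01 divr_gt0.
  - move=> N; apply: le_trans (hM N); apply: ler_sum => d _.
    rewrite normcM normcX normcN (normc_real 1) normr1 expr1n mul1r ler_wpM2l ?normc_ge0 //.
    by rewrite exprn_ile1 ?le_min ?ler01 ?divr_ge0 ?(ltW t00) ?(ltW e0) // ge_min lexx.
  - move=> t tp; rewrite le_min => /andP[t1]; rewrite ler_pdivlMr // => te.
    have := hc (- t); rewrite normrN gtr0_norm // => /(_ t1).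
    rewrite line mulNr Gt; last 2 first.
    - by rewrite subr_ge0.
    - by rewrite gtrBl mulr_gt0.
    rewrite (_ : (fun N => _) = fun N => \sum_(d < N) (-1) ^+ d * evalq (p d) (e *: X) * t%:C ^+ d) //.
    apply/funext => N; apply: eq_bigr => d _.
    by rewrite rmorphN [(- t%:C) ^+ d]exprNn mulrCA !mulrA.
have cz' d : evalq (p d) (e *: X) = 0.
  by apply/eqP; have /eqP := cz d; rewrite mulf_eq0 signr_eq0.
have Ge tau : 0 <= tau -> tau <= 1 -> G ((t0 + tau * e) *: X) = 0.
  move=> tau0 tau1; rewrite -line; have := hc tau; rewrite ger0_norm // => /(_ tau1).
  rewrite (_ : (fun N => _) = fun N => 0); last first.
    by apply/funext => N; rewrite big1 // => d _; rewrite cz' mul0r.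
  by move/cvgC_unique => /(_ _ (cvgC_cst 0)).
have S1 : S (Num.min 1 (t0 + e)).
  split=> [|s s0]; first by rewrite ge_min lexx.
  rewrite le_min => /andP[_ se]; have [st|ts] := ltP s t0; first exact: Gt.
  have -> : s = t0 + (s - t0) / e * e by rewrite divfK ?gt_eqF // subrKC.
  apply: Ge; first by rewrite divr_ge0 ?subr_ge0 // ltW.
  by rewrite ler_pdivrMr // mul1r lerBlDl.
(* As t0 + e <= t0 is impossible, 1 <= t0, and then [S1] contains the parameter 1, that is, X
   itself. *)
have := sup_upper_bound hS S1; rewrite -/t0 ge_min => /orP[t1|]; last first.
  by rewrite gerDl leNgt e0.
have -> : X = 1 *: X by rewrite scale1r.
case: S1 => _; apply; first exact: ler01.
by rewrite le_min lexx (le_trans t1) // lerDl ltW.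
Qed.

End IdentityTheorem.

(** * The Fischer pairing *)

Section FischerPairing.
Variable R : realType.
Local Notation nc := (@ComplexField.Normc.normc R).
Local Notation poly := (Cpolyq R).
Implicit Types (X Y : qspace R) (p q : poly) (m : multinom dimq).

(** The k-th coordinate composed with the Cartan involution. Since [omega] pairs the entry (i, j) of
    U with the entry (j, i) of V, the attached operator differentiates with respect to the k-th
    coordinate itself. *)
Definition svar k : poly :=
  qcoord (\matrix_(i, j) Vvar R j i, \matrix_(i, j) Uvar R j i) 0 k.

Lemma polyop_svar k q : polyop (svar k) q = 2 *: mderiv k q.
Proof.
rewrite /svar /qcoord; case: (split_ordP k) => l ->; case/mxvec_indexP: l => i j.
  by rewrite row_mxEl mxvecE mxE polyop_Vvar.
by rewrite row_mxEr mxvecE mxE polyop_Uvar.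
Qed.

Lemma evalq_svar k X : evalq (svar k) X = (qcoord (X.2^T, X.1^T) 0 k)%:C.
Proof.
rewrite /svar /qcoord; case: (split_ordP k) => l ->; case/mxvec_indexP: l => i j.
  by rewrite !row_mxEl !mxvecE !mxE evalq_Vvar.
by rewrite !row_mxEr !mxvecE !mxE evalq_Uvar.
Qed.

(* Conjugate coefficients together with the Cartan involution
   (U, V) -> (V^T, U^T), which makes the pairing below positive. *)
Definition star q : poly :=
  \sum_(m <- msupp q) conjc (mcoeff m q) *: \prod_k svar k ^+ m k.

Lemma evalq_star q X : evalq (star q) X = conjc (evalq q (X.2^T, X.1^T)).
Proof.
rewrite /star /evalq raddf_sum [meval _ q]/meval /mmap (raddf_sum conjc).
apply: eq_bigr => m _ /=; rewrite mevalZ rmorphM; congr (_ * _).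
rewrite !rmorph_prod; apply: eq_bigr => k _; rewrite !rmorphXn /=; congr (_ ^+ _).
by rewrite oppr0 -[LHS]/(evalq (svar k) X) evalq_svar.
Qed.

(** The Cartan involution exchanges the action of (A, B) with that of the inverse transposes of A
    and B, which again lie in H. *)
Lemma invariant_star q : invariant_poly q -> invariant_poly (star q).
Proof.
move=> iq A B uA uB X; rewrite !evalq_star; congr conjc.
have uA' : (invmx A)^T \in unitmx by rewrite unitmx_tr unitmx_inv.
have uB' : (invmx B)^T \in unitmx by rewrite unitmx_tr unitmx_inv.
rewrite -[RHS](iq _ _ uA' uB'); congr evalq.
by rewrite /act /= !trmx_mul !trmx_inv !invmxK -!mulmxA.
Qed.

Lemma polyop_prod_svar (s : seq 'I_dimq) q :
  polyop (\prod_(k <- s) svar k) q = 2 ^+ size s *: foldr (@mderiv _ _) q s.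
Proof.
elim: s => [|k s IH]; first by rewrite big_nil polyop1 scale1r.
by rewrite big_cons polyopM IH polyopZr polyop_svar scalerA -exprSr.
Qed.

Lemma polyop_monomial_svar m q :
  polyop (\prod_k svar k ^+ m k) q = 2 ^+ mdeg m *: mderivm m q.
Proof.
rewrite mderivm_foldr; set s := flatten _.
have -> : \prod_k svar k ^+ m k = \prod_(k <- s) svar k.
  rewrite big_flatten big_map big_enum; apply: eq_bigr => k _.
  by rewrite big_nseq iter_mulr_1.
rewrite polyop_prod_svar; congr (_ ^+ _ *: _).
rewrite size_flatten /shape -map_comp sumnE big_map big_enum mdegE.
by apply: eq_bigr => k _; rewrite /= size_nseq.
Qed.

Lemma evalq0 q : evalq q 0 = mcoeff (@mnm0 dimq) q.
Proof.
rewrite /evalq /meval [q in mcoeff _ q]mpolyE raddf_sum /mmap; apply: eq_bigr => m _.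
rewrite /= mcoeffZ mcoeffX; congr (_ * _).
have -> : (fun k => (qcoord (0 : qspace R) 0 k)%:C) = fun=> 0.
  by apply/funext => k; rewrite qcoord0.
by rewrite mmap1_prod_deg expr0n mdeg_eq0.
Qed.

(** This is the multi-index factorial m!, written with the falling factorials that [mcoeff_mderivm]
    produces. *)
Definition mfact m : nat := \prod_(i < dimq) (m i) ^_ (m i).

Lemma mfact_gt0 m : (0 < mfact m)%N.
Proof. by apply: prodn_gt0 => i; rewrite ffactnn fact_gt0. Qed.

Lemma polyop_suml (I : Type) (s : seq I) (P : I -> poly) q :
  polyop (\sum_(i <- s) P i) q = \sum_(i <- s) polyop (P i) q.
Proof.
elim: s => [|i s IH]; first by rewrite !big_nil polyop0.
by rewrite !big_cons polyopD IH.
Qed.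

Lemma pairing q p : evalq (polyop (star q) p) 0 =
  \sum_(m <- msupp q) conjc (mcoeff m q) * mcoeff m p * (2 ^+ mdeg m * (mfact m)%:R).
Proof.
rewrite /star polyop_suml evalq0 (raddf_sum (mcoeff (@mnm0 dimq))); apply: eq_bigr => m _.
rewrite polyopZ /= polyop_monomial_svar !mcoeffZ mcoeff_mderivm addm0 -mulr_natr.
by rewrite /mfact; ring.
Qed.

Lemma pairing_homog d e q p : homog d q -> homog e p -> d != e ->
  evalq (polyop (star q) p) 0 = 0.
Proof.
move=> hq hp de; rewrite pairing big_seq big1 // => m mq.
rewrite (memN_msupp_eq0 (p := p)) ?mulr0 ?mul0r //; apply: contra de => mp.
by rewrite -(hq _ mq) -(hp _ mp).
Qed.

(** The pairing of q with itself is the sum of |q_m|^2 with positive weights 2^|m| m!. *)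
Lemma pairing_definite q : evalq (polyop (star q) q) 0 = 0 -> q = 0.
Proof.
rewrite pairing => h.
pose w m : R := nc (mcoeff m q) ^+ 2 * (2 ^+ mdeg m * (mfact m)%:R).
have w0 m : 0 <= w m by rewrite mulr_ge0 ?sqr_ge0 // mulr_ge0 // exprn_ge0.
have E : \sum_(m <- msupp q) w m = 0.
  apply: complexI; rewrite raddf0 -h raddf_sum; apply: eq_bigr => m _ /=.
  have c2 (z : R[i]) : conjc z * z = (nc z ^+ 2)%:C.
    case: z => a b; rewrite /= sqr_sqrtr ?addr_ge0 ?sqr_ge0 //.
    by apply/eqP; rewrite eq_complex /=; apply/andP; split; apply/eqP; ring.
  rewrite c2 /w (rmorphM (real_complex R)); congr (_ * _).
  by rewrite (rmorphM (real_complex R)) (rmorphXn (real_complex R)) !(rmorph_nat (real_complex R)).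
have := @psumr_eq0 _ _ (msupp q) xpredT w (fun m _ => w0 m).
rewrite E eqxx => /esym/allP w_eq0.
apply/mpolyP => m; rewrite mcoeff0; have [mq|] := boolP (m \in msupp q); last exact: memN_msupp_eq0.
apply: normc_eq0; apply/eqP; rewrite -sqrf_eq0.
have := w_eq0 m mq; rewrite /w mulf_eq0 => /orP[//|].
have fm : (mfact m)%:R != 0 :> R by rewrite pnatr_eq0 -lt0n mfact_gt0.
by rewrite (negbTE (mulf_neq0 (expf_neq0 _ _) fm)) // pnatr_eq0.
Qed.

End FischerPairing.

(** * Vanishing of a solution that is zero at the origin *)

Section Uniqueness.
Variable R : realType.
Local Notation nc := (@ComplexField.Normc.normc R).
Implicit Types (X Y : qspace R) (f g F G : qspace R -> R[i]) (r e : R).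

Lemma hsym00 (A : comNzRingType) k : hsym (0 : A) 0 k.+1 = 0.
Proof. by case: k => [//|k]; rewrite hsymSS !mul0r subr0. Qed.

Lemma schur2_00 (A : comNzRingType) m n : schur2 (0 : A) 0 m n =
  ((m == 1) && (n == 0))%N%:R - ((m == 0) && (n == 1))%N%:R.
Proof.
have h k : hsym (0 : A) 0 k.+1 = 0 := hsym00 A k.
rewrite /schur2; case: m n => [|[|m]] [|[|n]]; rewrite ?ltnn ?ltnS ?leq0n ?ltn0 ?subn0 ?subn1 /=
  ?eqSS ?expr0 ?mul1r ?subr0 ?sub0r ?oppr0 //.
- by rewrite -[LHS]/(- hsym (0 : A) 0 n.+1) h oppr0.
- by rewrite expr1 mul0r oppr0.
- exact: h.
- by rewrite expr1 mul0r.
- by do 2?case: ifP => _; rewrite ?exprS ?mul0r ?oppr0.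
Qed.

(** At u = v = 0 only the quotients with exponents (1, 0) and (0, 1) survive, with values 1 and -1;
    this leaves (lambda1 - lambda2) / 4, coming from d = 1. *)
Lemma evalq_fpoly0 (lambda1 lambda2 : R[i]) d : evalq (fpoly lambda1 lambda2 d) 0 =
  (d == 1)%:R * (lambda1 - lambda2) / 4.
Proof.
have e i j : evalq (schurQS R i j) (0 : qspace R) = schur2 0 0 i j.
  rewrite evalq_schurQS ufun_add_vfun ufun_mul_vfun.
  have -> : Qfun (0 : qspace R) = 0 by rewrite QfunE /= mul0mx mxtrace0.
  by have -> : Sfun (0 : qspace R) = 0 by rewrite SfunE /= det0 mul0r.
have -> : evalq (fpoly lambda1 lambda2 d) 0 =
    \sum_(i < d.+1) bcoef lambda1 i * bcoef lambda2 (d - i) * schur2 0 0 i (d - i)%N.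
  by rewrite /fpoly /evalq raddf_sum; apply: eq_bigr => i _; rewrite /= mevalZ -e.
have b0 l : bcoef l 0 = 1 :> R[i] by rewrite /bcoef !expr0 fact0 expr1n mulr1 divr1.
have b1 l : bcoef l 1 = l / 4 :> R[i] by rewrite /bcoef !expr1 factS fact0 expr1n mulr1.
case: d => [|[|d]].
- by rewrite big_ord1 schur2_00 /= subr0 mulr0 !mul0r.
- rewrite big_ord_recl big_ord1 !schur2_00 /= !b0 !b1 /bump /=.
  by field.
- rewrite !mul0r big1 // => i _; rewrite schur2_00.
  case: (nat_of_ord i) => [|[|k]]; rewrite ?subn0 ?subn1 /= ?andbF ?subr0 ?mulr0 //.
Qed.

Lemma Fana_at0 (lambda1 lambda2 : R[i]) :
  Fana_fun lambda1 lambda2 0 = (lambda1 - lambda2) / 4.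
Proof.
rewrite /Fana_fun /psum; apply: cvgC_lim; apply/(cvgC_shift 2).
rewrite (_ : (fun n => _) = fun _ => (lambda1 - lambda2) / 4); first exact: cvgC_cst.
apply/funext => n; rewrite addn2 !big_ord_recl big1 => [|i _].
  by rewrite -!/(evalq _ _) !evalq_fpoly0 /= /bump /= mul0r mul0r add0r mul1r addr0.
by rewrite -!/(evalq _ _) evalq_fpoly0 /bump /= !mul0r.
Qed.

Variable chi : Cpolyq R -> R[i].

Lemma analytic_expandable F : analytic F -> expandable F.
Proof.
move=> aF X0; have [r [p [r0 sp hp Fp]]] := analytic_expand X0 aF.
by exists r, p; split.
Qed.

(** G agrees on the rays through X and through [act A B X], and the coefficients of t^j are
    compared. The scaling by e brings both points into the domain of the expansion and is removed by
    homogeneity. *)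
Lemma homog_components_invariant G r p : expands G 0 r p ->
  (forall A B X, A \in unitmx -> B \in unitmx -> G (act A B X) = G X) ->
  forall d, invariant_poly (p d).
Proof.
move=> ep Gact d A B uA uB X; have [r0 sp hp _] := ep.
have [e1 e10 h1] := small_scale X r0; have [e2 e20 h2] := small_scale (act A B X) r0.
pose e := Num.min e1 e2; have e0 : 0 < e by rewrite lt_min e10.
have b1 : forall k, `|qcoord (e *: X) 0 k| <= r by apply: h1; rewrite gtr0_norm // ge_min lexx.
have b2 : forall k, `|qcoord (e *: act A B X) 0 k| <= r.
  by apply: h2; rewrite gtr0_norm // ge_min lexx orbT.
have [[M1 hM1] c1] := expands_line ep b1; have [[M2 hM2] c2] := expands_line ep b2.
have key j : evalq (p j) (e *: act A B X) - evalq (p j) (e *: X) = 0.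
  move: j; apply: (@power_series_eq0 R _ 1 (M2 + M1)) => //.
    move=> N; apply: le_trans (lerD (hM2 N) (hM1 N)); rewrite -big_split.
    apply: ler_sum => j _ /=; rewrite expr1n !mulr1.
    by rewrite (le_trans (normcD _ _)) // normcN.
  move=> t t0 t1.
  have ht : `|t| <= 1 by rewrite gtr0_norm.
  have := cvgCB (c2 t ht) (c1 t ht); rewrite !add0r.
  have -> : G (t *: (e *: act A B X)) = G (t *: (e *: X)).
    have L c Y : c *: act A B Y = act A B (c *: Y).
      by rewrite /act /=; congr (_, _); rewrite -scalemxAr -scalemxAl.
    by rewrite !L Gact.
  rewrite subrr (_ : (fun N => _ - _) = fun N => \sum_(j < N)
    (evalq (p j) (e *: act A B X) - evalq (p j) (e *: X)) * t%:C ^+ j) //.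
  by apply/funext => N; rewrite -sumrB; apply: eq_bigr => j _; rewrite mulrBl.
have := key d; rewrite !(evalq_scale _ _ (hp d)) -mulrBr => /eqP.
rewrite mulf_eq0 expf_eq0 => /orP[/andP[_]|]; last by rewrite subr_eq0 => /eqP.
by rewrite fmorph_eq0 gt_eqF.
Qed.

(* Testing the eigen-equation for star P against an approximate delta at 0
   extracts the pairing of P with the component p d. *)
Lemma eigen_component0 G r p : Ccont G -> expands G 0 r p -> G 0 = 0 ->
  forall P d, homog d P ->
  (forall f, test_function f -> integralq (fun X => G X * partialT (star P) f X) =
     chi (star P) * integralq (fun X => G X * f X)) ->
  evalq (polyop (star P) (p d)) 0 = 0.
Proof.
move=> cG [r0 sp hp Gp] G0 P d hP eig; set P' := star P in eig *.
apply: normc_eq0.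
(* Differentiation costs radius ([mnorm_polyop]): on the smaller radius s the norms of all [Q N]
   have a common bound C M. *)
pose s := r / 2; have s0 : 0 < s by rewrite divr_gt0.
have sr : s < r by rewrite /s; lra.
have [C [C0 hC]] := mnorm_polyop P' (ltW s0) sr.
have [M hM] := sp.
pose Q N := \sum_(j < N) polyop P' (p j).
have Qb N : mnorm s (Q N) <= C * M.
  rewrite (le_trans (mnorm_sum _ _ (ltW s0))) // (@le_trans _ _ (C * \sum_(j < N) mnorm r (p j))) //.
    by rewrite mulr_sumr; apply: ler_sum.
  by rewrite ler_wpM2l.
pose kap := evalq (polyop P' (p d)) 0; rewrite -/kap.
have Q0 N : (d < N)%N -> evalq (Q N) 0 = kap.
  move=> dN; rewrite /Q /evalq raddf_sum (bigD1 (Ordinal dN)) //= big1 ?addr0 // => j jd.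
  apply: (pairing_homog hP (hp j)); apply: contra jd => /eqP dj.
  by apply/eqP/val_inj.
have bnd e : 0 < e -> nc kap <= e.
  move=> e0.
  (* The final estimate is 2 t C M + e / 2 + 2 a |chi P'| with t <= a. As a D = e / 2, the first and
     third terms together are at most e / 2; the summand 1 keeps D positive. *)
  pose D := 2 * (C * M) + 2 * nc (chi P') + 1.
  have CM0 : 0 <= C * M by apply: le_trans (Qb 0); exact: mnorm_ge0 (ltW s0).
  have K0 : 0 <= nc (chi P') := normc_ge0 _.
  have D0 : 0 < D by rewrite /D; lra.
  pose a := e / (2 * D); have a0 : 0 < a by rewrite divr_gt0 // mulr_gt0.
  have [u u0 hu] := Ccont_modulus 0 cG a0.
  pose t := Num.min 1 a; have t0 : 0 < t by rewrite lt_min ltr01.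
  have t1 : t <= 1 by rewrite ge_min lexx.
  (* On the box of radius v, G differs from G 0 = 0 by at most a, and every [Q N] from its value at
     0 by at most t C M, uniformly in N. So the bump can be fixed before N tends to infinity. *)
  pose v := Num.min u (t * s); have v0 : 0 < v by rewrite lt_min u0 mulr_gt0.
  have [b [tb b0 bo cb b1]] := delta_test 0 v0.
  have hQ N : nc (integralq (fun X => evalq (Q N) X * (b X)%:C) - evalq (Q N) 0) <= 2 * (t * (C * M)).
    apply: (delta_approx (r := v)) => // [|X hX]; first exact: Ccont_evalq.
    apply: (@le_trans _ _ (t * mnorm s (Q N))); last by rewrite ler_wpM2l // ltW.
    have -> : evalq (Q N) 0 = meval (fun=> 0) (Q N).
      by congr meval; apply/funext => k; rewrite qcoord0.
    apply: meval_near0; rewrite ?(ltW s0) ?(ltW t0) // => k.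
    rewrite normc_real; have := hX k; rewrite subr0 => h; apply: le_trans h _.
    by rewrite ge_min lexx orbT.
  have hG : nc (integralq (fun X => G X * (b X)%:C)) <= 2 * a.
    have := @delta_approx R G 0 v a b cG; rewrite G0 subr0; apply=> // X hX.
    rewrite -[X in _ - X]G0; apply: hu => k; apply: le_trans (hX k) _.
    by rewrite ge_min lexx.
  have tP := test_function_partialT P' tb.
  have ct := CC_test tP.
  have suppP : qsupp r (partialT P' (fun X => (b X)%:C)).
    apply: qsupp_partialT => X Xr; rewrite bo // => Xv; apply: Xr => k.
    have := Xv k; rewrite subr0 => h; apply: le_trans h _.
    rewrite ge_min; apply/orP; right; apply: (@le_trans _ _ s); last exact: ltW.
    by rewrite ler_piMl // ltW.
  have Gp' X : qbox r X -> G X = psum p (coordC X).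
    by move=> Xr; rewrite -[X in G X]add0r Gp.
  have lim := integralq_psum (ltW r0) sp cG Gp' ct suppP.
  have lim2 : cvgC (fun N => integralq (fun X => evalq (Q N) X * (b X)%:C))
      (chi P' * integralq (fun X => G X * (b X)%:C)).
    rewrite -(eig _ tb).
    have <- : (fun N => integralq (fun X => evalq (\sum_(j < N) p j) X *
        partialT P' (fun X => (b X)%:C) X)) =
      fun N => integralq (fun X => evalq (Q N) X * (b X)%:C).
      apply/funext => N; have -> : Q N = polyop P' (\sum_(j < N) p j) by rewrite polyop_sumr.
      exact: (integralq_partialT P' (\sum_(j < N) p j) tb).
    exact: lim.
  have e2 : 0 < e / 2 by rewrite divr_gt0.
  have /cvgrPdist_le/(_ _ e2)[K _ hK] := lim2.
  have := hK (K + d.+1)%N (leq_addr _ _).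
  rewrite sub0r normrN ger0_norm ?normc_ge0 // => h.
  have hQ' := hQ (K + d.+1)%N; rewrite Q0 ?addnS ?ltnS ?leq_addl // in hQ' h.
  set I := integralq _ in hQ' h; set J := integralq _ in hG h.
  have -> : kap = - (I - kap) + ((I - chi P' * J) + chi P' * J) by ring.
  rewrite (le_trans (normcD _ _)) // normcN.
  have h3 : nc (I - chi P' * J + chi P' * J) <= e / 2 + nc (chi P') * (2 * a).
    rewrite (le_trans (normcD _ _)) // lerD // normcM ler_wpM2l ?normc_ge0 //.
  rewrite (le_trans (lerD hQ' h3)) //.
  have ta : t <= a by rewrite ge_min lexx orbT.
  have h4 : 2 * (t * (C * M)) <= 2 * (a * (C * M)) by rewrite ler_wpM2l // ler_wpM2r.
  have h5 : a * D = e / 2 by rewrite /a; field; rewrite gt_eqF.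
  move: h5 h4; rewrite /D; nra.
apply/eqP; rewrite eq_le normc_ge0 andbT; apply/ler_addgt0Pr => e e0.
by rewrite add0r; exact: bnd.
Qed.

Lemma eigen_vanishing G : Ccont G -> expandable G -> G 0 = 0 ->
  (forall A B X, A \in unitmx -> B \in unitmx -> G (act A B X) = G X) ->
  (forall P, invariant_poly P -> forall f, test_function f ->
     integralq (fun X => G X * partialT P f X) =
     chi P * integralq (fun X => G X * f X)) ->
  forall X, G X = 0.
Proof.
move=> cG eG G0 Gact eig; have [r [p ep]] := eG 0; have [r0 sp hp Gp] := ep.
have pz d : p d = 0.
  have ip := homog_components_invariant ep Gact d.
  apply: pairing_definite; apply: (eigen_component0 cG ep G0 (hp d)).
  by move=> f tf; apply: eig => //; exact: invariant_star.
apply: (expandable_eq0 eG r0) => X hX; rewrite -[X]add0r Gp // /psum.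
apply: cvgC_lim; rewrite (_ : (fun N => _) = fun _ => 0); first exact: cvgC_cst.
by apply/funext => N; rewrite big1 // => d _; rewrite pz meval0.
Qed.

End Uniqueness.

(** * Analytic eigendensities are multiples of Fana *)

Section Conclusion.
Variable R : realType.
Local Notation nc := (@ComplexField.Normc.normc R).
Implicit Types (X Y : qspace R) (f g F G : qspace R -> R[i]).
Variables lambda1 lambda2 : R[i].
Local Notation Fana := (Fana_fun lambda1 lambda2).

Lemma Fana_scale_analytic c : analytic (fun X => c * Fana X).
Proof.
pose p d := c *: fpoly lambda1 lambda2 d.
have sp r : 0 <= r -> nsummable r p.
  move=> r0; have [M hM] := fpoly_nsummable lambda1 lambda2 r0; exists (nc c * M) => N.
  apply: le_trans (ler_wpM2l (normc_ge0 c) (hM N)); rewrite mulr_sumr.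
  by apply: ler_sum => d _; rewrite mnormZ.
suff -> : (fun X => c * Fana X) = fun X => psum p (coordC X) by exact: psum_analytic.
apply/funext => X; apply/esym/cvgC_lim.
pose r := \sum_k `|qcoord X 0 k|; have r0 : 0 <= r by exact: sumr_ge0.
have vr k : nc (coordC X k) <= r by rewrite normc_real /r (bigD1 k) //= lerDl sumr_ge0.
have := cvgCZ c (psum_cvg r0 (fpoly_nsummable lambda1 lambda2 r0) vr).
rewrite (_ : (fun N => c * _) = fun N => \sum_(d < N) meval (coordC X) (p d)) //.
by apply/funext => N; rewrite mulr_sumr; apply: eq_bigr => d _; rewrite mevalZ.
Qed.

Lemma Ccont_act A B F : Ccont F -> Ccont (fun X => F (act A B X)).
Proof.
move=> [cr ci]; split=> X.
  apply: (continuous_comp (f := act A B) (g := rpart F)); [exact: act_continuous|exact: cr].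
apply: (continuous_comp (f := act A B) (g := ipart F)); [exact: act_continuous|exact: ci].
Qed.

Lemma CcontB c F G : Ccont F -> Ccont G -> Ccont (fun X => F X - c * G X).
Proof.
move=> [fr fi] [gr gi].
have -> : (fun X => F X - c * G X) = fun X => F X + - c * G X.
  by apply/funext => X; rewrite mulNr.
rewrite /Ccont rpartD ipartD (rpartM (fun=> - c)) (ipartM (fun=> - c)).
have cD (h k : qspace R -> R^o) : continuous h -> continuous k -> continuous (fun X => h X + k X).
  by move=> ch ck X; apply: cvgD; [exact: ch|exact: ck].
have cZ (a : R) (h : qspace R -> R^o) : continuous h -> continuous (fun X => a * h X : R^o).
  by move=> ch X; apply: cvgM; [exact: cvg_cst|exact: ch].
split; first exact: (cD _ _ fr (cD _ _ (cZ _ _ gr) (cZ _ _ (cZ _ _ gi)))).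
exact: (cD _ _ fi (cD _ _ (cZ _ _ gi) (cZ _ _ gr))).
Qed.

(** Moving the action from F to the test function by the invariance of the integral shows that F and
    its transform define the same distribution; being continuous, they are equal. *)
Lemma invariant_density F (T : functional R) : Ccont F -> H_invariant T -> defined_by F T ->
  forall A B X, A \in unitmx -> B \in unitmx -> F (act A B X) = F X.
Proof.
move=> cF iT dT A B X uA uB.
have uA' : invmx A \in unitmx by rewrite unitmx_inv.
have uB' : invmx B \in unitmx by rewrite unitmx_inv.
suff E : (fun X => F (act A B X)) = F by exact: (congr1 (fun f => f X) E).
apply: Ccont_determined => // [|f tf]; first exact: Ccont_act.
have tf' := test_function_act uA' uB' tf.
have c' : CC (fun Y => F Y * f (act (invmx A) (invmx B) Y)) by apply: CCM => //; exact: CC_test.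
have := iT _ _ uA' uB' f tf; rewrite (dT _ tf') (dT _ tf) /distribution_of => <-.
rewrite -(integralq_act uA uB c').2; congr integralq; apply/funext => Y.
congr (_ * f _); rewrite -(actM _ uA' uB' uA uB) !mulVmx // /act invmx1 !mul1mx !mulmx1.
by case: (Y).
Qed.

Lemma eigen_density_unique (chi : Cpolyq R -> R[i]) F (T : functional R) :
  lambda1 - lambda2 != 0 -> is_character chi ->
  chi (Qpoly R) = lambda1 + lambda2 -> chi (Spoly R) = lambda1 * lambda2 ->
  is_invariant_eigendistribution chi T -> analytic F -> defined_by F T ->
  forall X, F X = F 0 / Fana 0 * Fana X.
Proof.
move=> hl hchi chiQ chiS [_ iT eT] aF dT X; set c := F 0 / Fana 0.
have F0 : Fana 0 != 0 by rewrite Fana_at0 mulf_neq0 // invr_eq0 pnatr_eq0.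
have cF := analytic_Ccont aF; have cA := Ccont_Fana lambda1 lambda2.
pose G X := F X - c * Fana X.
have cG : Ccont G := CcontB c cF cA.
have GE h : test_function h -> integralq (fun X => G X * h X) =
    integralq (fun X => F X * h X) - c * integralq (fun X => Fana X * h X).
  move=> th; have ch := CC_test th.
  have c1 : CC (fun X => F X * h X) by exact: CCM.
  have c2 : CC (fun X => Fana X * h X) by exact: CCM.
  have -> : (fun X => G X * h X) = fun X => F X * h X + - c * (Fana X * h X).
    by apply/funext => Y; rewrite /G; ring.
  by rewrite integralqD ?integralqZ //; [rewrite mulNr|exact: CCZ].
apply/eqP; rewrite -subr_eq0; apply/eqP; move: X.
apply: (@eigen_vanishing R chi G cG).
- exact: expandsB (analytic_expandable aF) (analytic_expandable (Fana_analytic lambda1 lambda2)).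
- by rewrite /G /c divfK // subrr.
- move=> A B X uA uB; rewrite /G (Fana_act _ _ X uA uB); congr (_ - _).
  exact: invariant_density iT dT _ _ _ uA uB.
- move=> P iP f tf; have tP := test_function_partialT P tf.
  rewrite (GE _ tP) (GE _ tf) (integralq_Fana_partialT hchi chiQ chiS iP tf).
  have := eT P iP f tf; rewrite /partialD (dT _ tP) (dT _ tf) /distribution_of => ->.
  by rewrite mulrBr mulrCA.
Qed.

End Conclusion.

Theorem mainTheorem13 (R : realType) (lambda1 lambda2 : R[i])
    (hlambda : lambda1 * lambda2 * (lambda1 - lambda2) != 0)
    (chi : Cpolyq R -> R[i]) (hchi : is_character chi)
    (hchiQ : chi (Qpoly R) = lambda1 + lambda2)
    (hchiS : chi (Spoly R) = lambda1 * lambda2) :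
  exists Fana : qspace R -> R[i],
    is_Fana lambda1 lambda2 Fana /\
    forall T : functional R,
      (is_invariant_eigendistribution chi T /\
       exists F : qspace R -> R[i], analytic F /\ defined_by F T)
      <->
      (exists c : R[i], forall f, test_function f ->
         T f = c * distribution_of Fana f).
Proof.
have hl : lambda1 - lambda2 != 0 by apply: contraNneq hlambda => ->; rewrite mulr0.
exists (Fana_fun lambda1 lambda2); split.
  by split; [exact: Fana_analytic|exact: Fana_quotientE].
have scale c f : test_function f ->
    integralq (fun X => c * Fana_fun lambda1 lambda2 X * f X) =
    c * distribution_of (Fana_fun lambda1 lambda2) f.
  move=> tf; rewrite /distribution_of -integralqZ.
    by congr integralq; apply/funext => X; rewrite mulrA.
  by apply: CCM; [exact: Ccont_Fana|exact: CC_test].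
move=> T; split=> [[eT [F [aF dT]]]|[c hT]].
  exists (F 0 / Fana_fun lambda1 lambda2 0) => f tf.
  rewrite (dT f tf) /distribution_of -scale //; congr integralq; apply/funext => X.
  by rewrite (eigen_density_unique hl hchi hchiQ hchiS eT aF dT X).
split; first exact: distribution_Fana_eigen hchi hchiQ hchiS hT.
exists (fun X => c * Fana_fun lambda1 lambda2 X); split; first exact: Fana_scale_analytic.
by move=> f tf; rewrite (hT f tf) /distribution_of scale.
Qed.
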